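(* Let $(M,\langle\cdot,\cdot\rangle)$ be a connected, geodesically complete Riemannian manifold with Riemannian distance $d$, and let $f:M\to\mathbb{R}$ be smooth. Fix constants $0<c_1<c_2<1$ and $\mu>1/4$. Let $\{x_k\}_{k=0,1,\dots}\subset M$, together with step sizes $\alpha_k>0$ and search directions $\eta_k\in T_{x_k}M$, be a sequence generated by the HZ-type Riemannian conjugate gradient method with the exponential retraction (described in the context), with $\beta_{k+1}=\beta_{k+1}^{\mathrm{HZ}}$ for all $k$. In particular, writing $g_k:=\operatorname{grad} f(x_k)$, each step size satisfies the Wolfe conditions $$f(\exp_{x_k}(\alpha_k\eta_k))\le f(x_k)+c_1\alpha_k\langle g_k,\eta_k\rangle_{x_k},\qquad \langle g_{k+1},\mathcal{T}_{\alpha_k\eta_k}(\eta_k)\rangle_{x_{k+1}}\ge c_2\langle g_k,\eta_k\rangle_{x_k}.$$ Assume moreover that: (i) $f$ is bounded below, and there is a constant $L_1>0$, independent of $k$, such that for every $k$ the function $f\circ\exp_{x_k}:T_{x_k}M\to\mathbb{R}$ is Lipschitz continuously differentiable with Lipschitz constant $L_1$ on the line $\mathrm{span}\{\eta_k\}$ (that is, its restriction to this line is continuously differentiable with $L_1$-Lipschitz derivative with respect to the norm $\|\cdot\|_{x_k}$); (ii) there is a constant $L_2>0$ such that for all $x,y\in M$ and every $X\in T_yM$ with $x=\exp_y(X)$, $$\|\operatorname{grad} f(x)-\mathcal{T}_X(\operatorname{grad} f(y))\|_x\le L_2\,d(x,y);$$ (iii) $f$ is strongly convex, in the sense that there is a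 constant $\nu>0$ such that for all $x\in M$ the smallest eigenvalue of the Riemannian Hessian $\operatorname{Hess} f(x)$ is not less than $\nu$. Then either $\|g_{k_0}\|_{x_{k_0}}=0$ for some $k_0\in\mathbb{N}$, or $$\lim_{k\to\infty}\|g_k\|_{x_k}=0.$$
   Context: $T_xM$ is the tangent space at $x$, $\exp_x:T_xM\to M$ is the Riemannian exponential map, $\|\cdot\|_x$ is the norm induced by $\langle\cdot,\cdot\rangle_x$, and $\operatorname{grad} f$ and $\operatorname{Hess} f$ are the Riemannian gradient and Hessian of $f$. The vector transport is the differential of the exponential map: for $x\in M$ and $\eta,\xi\in T_xM$, $$\mathcal{T}_\eta(\xi):=(d\exp_x)_\eta(\xi)\in T_{\exp_x(\eta)}M,$$ using the canonical identification $T_\eta(T_xM)\simeq T_xM$. HZ-type Riemannian conjugate gradient method with the exponential retraction. Start from $x_0\in M$ with $g_0=\operatorname{grad} f(x_0)$ and $\eta_0=-g_0$. For $k=0,1,2,\dots$, as long as $g_k\ne 0$: choose $\alpha_k>0$ satisfying the two Wolfe conditions displayed in the claim, where $g_{k+1}$ and $x_{k+1}$ are given by $$x_{k+1}=\exp_{x_k}(\alpha_k\eta_k),\qquad g_{k+1}=\operatorname{grad} f(x_{k+1}),$$ and set $$\eta_{k+1}=-g_{k+1}+\beta_{k+1}\,\mathcal{T}_{\alpha_k\eta_k}(\eta_k).$$ With $y_k:=g_{k+1}-\mathcal{T}_{\alpha_k\eta_k}(g_k)\in T_{x_{k+1}}M$, the Hager--Zhang parameter is $$\beta_{k+1}^{\mathrm{HZ}}:=\frac{\langle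 g_{k+1},y_k\rangle_{x_{k+1}}}{\langle y_k,\mathcal{T}_{\alpha_k\eta_k}(\eta_k)\rangle_{x_{k+1}}}-\mu\,\frac{\|y_k\|_{x_{k+1}}^2\,\langle g_{k+1},\mathcal{T}_{\alpha_k\eta_k}(\eta_k)\rangle_{x_{k+1}}}{\langle y_k,\mathcal{T}_{\alpha_k\eta_k}(\eta_k)\rangle_{x_{k+1}}^2}.$$ *)

(* Defs.v *)
From mathcomp Require Import all_boot all_order all_algebra.
From mathcomp Require Import all_classical all_reals all_analysis.

Set Implicit Arguments.
Unset Strict Implicit.
Unset Printing Implicit Defensive.

Import Order.TTheory GRing.Theory Num.Theory.
Import numFieldNormedType.Exports.

Local Open Scope ring_scope.
Local Open Scope classical_set_scope.

Section Smooth.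
Context {R : realType} {n : nat} {W : normedModType R}.

Definition partial (i : 'I_n) (F : 'rV[R]_n -> W) : 'rV[R]_n -> W :=
  fun u => 'D_(delta_mx 0 i) F u.

(* C^oo on an open set U: all iterated partial derivatives exist and are
   continuous at every point of U. *)
Definition smooth_on (U : set 'rV[R]_n) (F : 'rV[R]_n -> W) : Prop :=
  forall (s : seq 'I_n) (u : 'rV[R]_n), U u ->
    {for u, continuous (foldr partial F s)} /\
    forall i : 'I_n, derivable (foldr partial F s) u (delta_mx 0 i).

End Smooth.

(* A smooth manifold of dimension n, given by a smooth atlas that need not be
   maximal.  The functions coord c and param c are total, but only their values
   on chart_dom c and on its image are meaningful.  Tangent vectors at x are
   represented by their components in chart_at x, an arbitrarily chosen chart
   around x. *)
Record smooth_manifold (R : realType) (n : nat) := SmoothManifold {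
  manifold_space :> topologicalType;
  manifold_hausdorff : hausdorff_space manifold_space;
  manifold_second_countable : @second_countable manifold_space;
  chart : Type;
  chart_dom : chart -> set manifold_space;
  coord : chart -> manifold_space -> 'rV[R]_n;
  param : chart -> 'rV[R]_n -> manifold_space;
  chart_dom_open : forall c, open (chart_dom c);
  chart_image_open : forall c, open (coord c @` chart_dom c);
  coordK : forall c x, chart_dom c x -> param c (coord c x) = x;
  coord_continuous : forall c x, chart_dom c x ->
    {for x, continuous (coord c)};
  param_continuous : forall c u, (coord c @` chart_dom c) u ->
    {for u, continuous (param c)};
  transition_smooth : forall c c',
    smooth_on (coord c @` (chart_dom c `&` chart_dom c')) (coord c' \o param c);
  chart_at : manifold_space -> chart;
  chart_at_dom : forall x, chart_dom (chart_at x) x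
}.

Section Tangent.
Context {R : realType} {n : nat} {M : smooth_manifold R n}.

(* A tangent vector at x is represented by its components in the chart
   chart_at x.  The spaces at different points are thus convertible as types,
   but vectors based at different points are never to be compared. *)
Definition tangent (x : M) : normedModType R := 'rV[R]_n.

Definition chart_image (c : chart M) : set 'rV[R]_n :=
  coord c @` chart_dom c.

(* The change of components between chart_at x and another chart c around x. *)
Definition to_chart (c : chart M) (x : M) (w : tangent x) : 'rV[R]_n :=
  'd (coord c \o param (chart_at x)) (coord (chart_at x) x) w.

Definition of_chart (c : chart M) (x : M) (v : 'rV[R]_n) : tangent x :=
  'd (coord (chart_at x) \o param c) (coord c x) v.

Definition smooth_fun (f : M -> R) : Prop :=
  forall c, smooth_on (chart_image c) (f \o param c : 'rV[R]_n -> R).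

Definition dfun (f : M -> R) (x : M) (v : tangent x) : R :=
  'd (f \o param (chart_at x) : 'rV[R]_n -> R) (coord (chart_at x) x) v.

Definition velocity (gamma : R -> M) (t : R) : tangent (gamma t) :=
  (coord (chart_at (gamma t)) \o gamma)^`() t.

Definition C1_curve (gamma : R -> M) : Prop :=
  continuous gamma /\
  forall c t, chart_dom c (gamma t) ->
    derivable (coord c \o gamma) t 1 /\
    {for t, continuous (coord c \o gamma)^`()}.

End Tangent.

(* The i-th coordinate vector field of the chart c. *)
Definition coord_vect (R : realType) (n : nat) (M : smooth_manifold R n)
    (c : chart M) (x : M) (i : 'I_n) : tangent x :=
  of_chart c x (delta_mx 0 i).

Record riemannian_manifold (R : realType) (n : nat) := RiemannianManifold {
  riemannian_base :> smooth_manifold R n;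
  inner : forall x : riemannian_base, tangent x -> tangent x -> R;
  inner_linear : forall x (a : R) (u v w : tangent x),
    inner (a *: u + v) w = a * inner u w + inner v w;
  inner_sym : forall x (u v : tangent x), inner u v = inner v u;
  inner_gt0 : forall x (v : tangent x), v != 0 -> 0 < inner v v;
  inner_smooth : forall (c : chart riemannian_base) (i j : 'I_n),
    smooth_on (chart_image c)
      (fun u => inner (coord_vect c (param c u) i)
                      (coord_vect c (param c u) j) : R)
}.

Section Riemannian.
Context {R : realType} {n : nat} {M : riemannian_manifold R n}.

Definition rnorm (x : M) (v : tangent x) : R := Num.sqrt (inner v v).

Definition gram (c : chart M) (u : 'rV[R]_n) : 'M[R]_n :=
  \matrix_(i, j) inner (coord_vect c (param c u) i) (coord_vect c (param c u) j).

(* Christoffel symbols Gamma^k_ij of the Levi-Civita connection. *)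
Definition christoffel (c : chart M) (u : 'rV[R]_n) (k i j : 'I_n) : R :=
  2^-1 * \sum_l invmx (gram c u) k l *
    (partial i (fun v => gram c v j l : R) u
     + partial j (fun v => gram c v i l : R) u
     - partial l (fun v => gram c v i j : R) u).

(* The covariant derivative of the vector field X at x along xi. *)
Definition nabla (X : forall x : M, tangent x) (x : M) (xi : tangent x) :
    tangent x :=
  let c := chart_at x in
  let Xc := fun u => to_chart c (X (param c u)) in
  'd Xc (coord c x) xi
  + \row_k \sum_i \sum_j christoffel c (coord c x) k i j
                         * xi 0 i * Xc (coord c x) 0 j.

Definition grad (f : M -> R) (x : M) : tangent x :=
  xget 0 [set w | forall v : tangent x, inner w v = dfun f v].

Definition Hess (f : M -> R) (x : M) (xi : tangent x) : tangent x :=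
  nabla (grad f) xi.

Definition geodesic (gamma : R -> M) : Prop :=
  continuous gamma /\
  forall c t, chart_dom c (gamma t) ->
    let u := coord c \o gamma in
    let du := u^`() in
    let ddu := du^`() in
    [/\ derivable u t 1, derivable du t 1 &
      forall k, ddu t 0 k =
        - \sum_i \sum_j christoffel c (u t) k i j * du t 0 i * du t 0 j].

Definition geodesic_from (x : M) (v : tangent x) (gamma : R -> M) : Prop :=
  [/\ geodesic gamma, gamma 0 = x & velocity gamma 0 = v].

Definition geodesically_complete : Prop :=
  forall (x : M) (v : tangent x), exists gamma, geodesic_from v gamma.

(* The default value x is irrelevant when M is geodesically complete. *)
Definition rexp (x : M) (v : tangent x) : M :=
  xget x [set y | exists2 gamma, geodesic_from v gamma & y = gamma 1].

Definition transport (x : M) (eta xi : tangent x) : tangent (rexp eta) :=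
  'd (coord (chart_at (rexp eta)) \o @rexp x) eta xi.

Definition arc_length (gamma : R -> M) : R :=
  \int[lebesgue_measure]_(t in `[0, 1]) rnorm (velocity gamma t).

(* There is a piecewise C^1 curve of length l from x to y, obtained by
   concatenating C^1 curves parametrized by [0, 1].  Each of these is taken as
   the restriction of a C^1 curve defined on the whole line, which is no loss:
   a C^1 curve on [0, 1] extends beyond its endpoints inside charts. *)
Inductive piecewise_C1_length (x : M) : M -> R -> Prop :=
| pC1_nil : piecewise_C1_length x x 0
| pC1_rcons gamma l : piecewise_C1_length x (gamma 0) l -> C1_curve gamma ->
    piecewise_C1_length x (gamma 1) (l + arc_length gamma).

Definition rdist (x y : M) : R := inf [set l | piecewise_C1_length x y l].

Definition HZ_beta (mu : R) (x : M) (g y t : tangent x) : R :=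
  inner g y / inner y t
  - mu * (rnorm y ^+ 2 * inner g t / inner y t ^+ 2).

(* The method has not stopped at step k or before. *)
Definition running (f : M -> R) (x : nat -> M) (k : nat) : Prop :=
  forall j, (j <= k)%N -> grad f (x j) <> 0.

(* A run that stops is represented by total sequences with arbitrary values
   after the stopping index. *)
Definition HZ_run (f : M -> R) (c1 c2 mu : R) (x : nat -> M) (alpha : nat -> R)
    (eta : forall k, tangent (x k)) : Prop :=
  eta 0%N = - grad f (x 0%N) /\
  forall k, running f x k ->
    let g := fun i => grad f (x i) in
    let T := fun xi : tangent (x k) =>
      transport (alpha k *: eta k) xi : tangent (x k.+1) in
    let y : tangent (x k.+1) := g k.+1 - T (g k) in
    [/\ 0 < alpha k,
        x k.+1 = rexp (alpha k *: eta k),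
        f (rexp (alpha k *: eta k))
          <= f (x k) + c1 * alpha k * inner (g k) (eta k),
        c2 * inner (g k) (eta k) <= inner (g k.+1) (T (eta k)) &
        eta k.+1 = - g k.+1 + HZ_beta mu (g k.+1) y (T (eta k)) *: T (eta k)].

End Riemannian.

Arguments geodesically_complete {R n} M.

(* Main.v *)
(* The HZ parameter is built so that, by the inequality of Cauchy and Schwarz,
   <g_k, eta_k> <= - (1 - 1 / (4 mu)) |g_k|^2 whatever the transport is.  By the
   Gauss lemma the transport along eta_k preserves inner products with eta_k, so
   <y_k, T eta_k> is the increment of the slope of f along a geodesic; the bound
   on the Hessian makes it at least nu alpha_k |eta_k|^2, while |y_k| is at most
   L_2 alpha_k |eta_k|.  Hence |eta_{k+1}| <= C |g_{k+1}|.  The curvature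
   condition and the Lipschitz bound on the slope give
   - <g_k, eta_k> <= K alpha_k |eta_k|^2, and the sufficient decrease condition
   then yields f(x_k) - f(x_{k+1}) >= c |g_k|^2.

   Smooth dependence of geodesics on their initial data is not used.  The Gauss
   lemma is derived from their Lipschitz dependence, through the first variation
   formula written with finite differences.  It is available at the points where
   the exponential map is differentiable; elsewhere its differential is 0 by
   convention, the transport vanishes, and the bounds above become simpler. *)

From HB Require Import structures.
From mathcomp Require Import all_boot all_order all_algebra.
From mathcomp Require Import all_classical all_reals all_analysis.
From mathcomp Require Import ring lra.
Require Import Defs.
Import Order.TTheory GRing.Theory Num.Theory.
Import numFieldNormedType.Exports.
Set Implicit Arguments.
Unset Strict Implicit.
Unset Printing Implicit Defensive.
Local Open Scope ring_scope.
Local Open Scope classical_set_scope.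

(** * Differentiability *)

(** The Gauss lemma rests on a pairing: the coordinate difference of two geodesics against the
    velocity of the first. Up to an error quadratic in their gap, its time derivative is half the
    difference of their energies, and energies are constant. Hence the pairing of the geodesic of
    velocity [X] with that of velocity [X + s *: xi] is [s * inner X xi] at time 1, up to a multiple
    of [s ^+ 2], and it remains to divide by [s]. The same estimate for a constant family gives the
    uniqueness of geodesics, which makes [rexp] well determined. Charts change along the way, at the
    cost of constants only; real induction on time takes the place of a finite subdivision. The
    Hessian hypothesis speaks of eigenvalues of a coordinate matrix that need not be symmetric. It
    bounds the quadratic form because the covariant derivative of the gradient is self-adjoint for
    the metric. Where the differential of the exponential map is 0 by convention, the hypothesis on
    the transport bounds the new gradient itself by [L2] times the length of the step; hence the
    summand [L1 + L2] in the bound on [- inner (grad f x) eta]. *)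

Section DiffGeneral.
Context {R : realType}.

(** ['d f x] is picked by [get]; without differentiability no linear map qualifies, and the default
    [point] is the zero map. This is what makes [transport] vanish there. *)
Lemma diff_eq0_not_differentiable (V W : normedModType R) (f : V -> W) x v :
  ~ differentiable f x -> 'd f x v = 0.
Proof.
move=> nd; suff -> : 'd f x = point by [].
rewrite /diff; apply: getPN => g [gc gP]; apply: nd.
have ex : exists df : {linear V -> W}, continuous df /\ forall y,
    f y = f (lim (nbhs x)) + df (y - lim (nbhs x)) +o_(y \near x) (y - lim (nbhs x)).
  by exists g.
have [dc dP] := getPex ex.
by apply/diffP; split.
Qed.

Lemma near_norm (V : normedModType R) (u : V) (P : set V) :
  (\forall w \near u, P w) <-> exists2 d, 0 < d & forall w, `|w - u| < d -> P w.
Proof.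
split=> [/nbhs_ballP[d d0 dP]|[d d0 dP]].
  by exists d => // w wd; apply: dP; rewrite -ball_normE/= distrC.
apply/nbhs_ballP; exists d => //= w; rewrite -ball_normE/= => wd.
by apply: dP; rewrite distrC.
Qed.

Lemma near_forall (T : topologicalType) m (P : 'I_m -> T -> Prop) (x : T) :
  (forall i, \forall w \near x, P i w) -> \forall w \near x, forall i, P i w.
Proof. exact: filter_forall. Qed.

Lemma is_diff_of (V W : normedModType R) (f : V -> W) (df : {linear V -> W}) x :
  continuous df ->
  (forall e : R, 0 < e -> exists2 d : R, 0 < d &
    forall v, `|v| < d -> `|f (x + v) - f x - df v| <= e * `|v|) ->
  is_diff x f df.
Proof.
move=> dfc dxf.
have H : f \o shift x = cst (f x) + df +o_ (0 : V) id.
  apply/eqaddoP => e e0; have [d d0 dP] := dxf e e0.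
  suff H : \forall v \near (0 : V), `|(f \o shift x - (cst (f x) + df)) v| <= e * `|v|.
    exact: H.
  apply/near_norm; exists d => // v; rewrite subr0 => /dP; apply: le_trans.
  have -> : (f \o shift x - (cst (f x) + df)) v = f (v + x) - (f x + df v) by [].
  by rewrite opprD addrA [v + x]addrC.
apply: DiffDef; last exact: diff_unique.
by apply/diff_locallyP; rewrite (diff_unique dfc H).
Qed.

Lemma is_derive_line (V W : normedModType R) (F : V -> W) (a v : V) (s : R) :
  derivable F (a + s *: v) v ->
  is_derive s 1 (fun t : R => F (a + t *: v)) ('D_v F (a + s *: v)).
Proof.
have E : (fun h : R => h^-1 *: (((fun t : R => F (a + t *: v)) \o shift s) (h *: 1) - F (a + s *: v)))
    = (fun h : R => h^-1 *: ((F \o shift (a + s *: v)) (h *: v) - F (a + s *: v))).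
  apply/funext => h /=; congr (_ *: (F _ - _)).
  by rewrite [_ *: 1]mulr1 scalerDl addrCA.
by move=> dF; split; rewrite /derivable /derive E.
Qed.

Lemma MVT_sym (phi dphi : R -> R) (a : R) :
  (forall s : R, `|s| <= `|a| -> is_derive s 1 phi (dphi s)) ->
  exists2 c, `|c| <= `|a| & phi a - phi 0 = dphi c * a.
Proof.
move=> dphiP; have [a0|a0] := leP 0 a.
  have [||c] := @MVT_segment R phi dphi 0 a a0.
  - move=> x; rewrite in_itv/= => /andP[x0 xa]; apply: dphiP.
    by rewrite !ger0_norm// ltW.
  - apply: derivable_within_continuous => x; rewrite in_itv/= => /andP[x0 xa].
    by apply: (@ex_derive _ _ _ _ _ _ (dphi x)); apply: dphiP; rewrite !ger0_norm.
  - rewrite in_itv/= subr0 => /andP[c0 ca] E; exists c => //.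
    by rewrite !ger0_norm.
have [||c] := @MVT_segment R phi dphi a 0 (ltW a0).
- move=> x; rewrite in_itv/= => /andP[x0 xa]; apply: dphiP.
  by rewrite !ler0_norm ?lerN2// ltW.
- apply: derivable_within_continuous => x; rewrite in_itv/= => /andP[x0 xa].
  by apply: (@ex_derive _ _ _ _ _ _ (dphi x)); apply: dphiP; rewrite !ler0_norm ?lerN2// ltW.
- rewrite in_itv/= sub0r => /andP[c0 ca] E; exists c.
    by rewrite !ler0_norm ?lerN2// ltW.
  by rewrite -opprB E mulrN opprK.
Qed.

End DiffGeneral.

(** * Coordinates, partial derivatives and differentials *)

Section Euclidean.
Context {R : realType} {n : nat}.
Implicit Types (u v w : 'rV[R]_n).

Lemma coord_le_norm v i : `|v 0 i| <= `|v|.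
Proof. by rewrite [leRHS]/Num.Def.normr/= mx_normrE (le_bigmax _ _ (0, i)). Qed.

Lemma rV_norm_le v b : 0 <= b -> (forall i, `|v 0 i| <= b) -> `|v| <= b.
Proof.
move=> b0 vb; rewrite [leLHS]/Num.Def.normr/= mx_normrE.
by apply: bigmax_le => // -[i j] _ /=; rewrite ord1.
Qed.

Lemma rV_sum_delta v : v = \sum_i v 0 i *: delta_mx 0 i.
Proof. by rewrite -row_sum_delta. Qed.

(** The points [truncate 0 v], ..., [truncate n v] lead from 0 to [v] by changing one coordinate at
    a time, so that increments can be telescoped. *)
Definition truncate (k : nat) v : 'rV[R]_n :=
  \row_i (if (i < k)%N then v 0 i else 0).

Lemma truncate0 v : truncate 0 v = 0.
Proof. by apply/rowP => i; rewrite !mxE. Qed.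

Lemma truncate_all v : truncate n v = v.
Proof. by apply/rowP => i; rewrite !mxE ltn_ord. Qed.

Lemma truncateS v (i : 'I_n) : truncate i.+1 v = truncate i v + v 0 i *: delta_mx 0 i.
Proof.
apply/rowP => j; rewrite !mxE eqxx/= eq_sym.
rewrite ltnS leq_eqVlt val_eqE eq_sym; have [->|ij] := eqVneq i j.
  by rewrite ltnn/= mulr1 add0r.
by rewrite mulr0 addr0.
Qed.

Lemma truncate_norm k v (i : 'I_n) (s : R) : `|s| <= `|v 0 i| -> (k <= i)%N ->
  `|truncate k v + s *: delta_mx 0 i| <= `|v|.
Proof.
move=> sv ki; apply: rV_norm_le => // j; rewrite !mxE eqxx/=.
have [->|ij] := eqVneq j i.
  by rewrite ltnNge ki/= add0r mulr1 (le_trans sv)// coord_le_norm.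
by rewrite mulr0 addr0; case: ifP => _; rewrite ?coord_le_norm ?normr0.
Qed.

End Euclidean.

Section Partial.
Context {R : realType} {n : nat}.
Implicit Types (F : 'rV[R]_n -> R) (u v w : 'rV[R]_n).

Lemma linear_rV_continuous (W : normedModType R) (f : {linear 'rV[R]_n -> W}) : continuous f.
Proof.
apply/linear_bounded_continuous/linear_boundedP.
near=> M => v; rewrite {1}[v]rV_sum_delta linear_sum.
apply: le_trans (ler_norm_sum _ _ _) _.
have : `|v| * (\sum_i `|f (delta_mx 0 i)|) <= M * `|v|.
  by rewrite mulrC ler_wpM2r//; near: M; apply: nbhs_pinfty_ge; rewrite num_real.
apply: le_trans; rewrite mulr_sumr; apply: ler_sum => i _.
by rewrite linearZ/= normrZ ler_wpM2r// coord_le_norm.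
Unshelve. all: by end_near. Qed.

(** The increment of [F] is telescoped along the truncations of [v]; on each piece a single
    coordinate moves, and the mean value theorem produces a partial derivative at a point close to
    [u]. *)
Lemma C1_is_diff F u (dF : {linear 'rV[R]_n -> R}) :
  (forall i, \forall w \near u, derivable F w (delta_mx 0 i)) ->
  (forall i, {for u, continuous (partial i F)}) ->
  (forall v, dF v = \sum_i v 0 i * partial i F u) ->
  is_diff u F dF.
Proof.
move=> dF_near pF_cont dFE; apply: is_diff_of; first exact: linear_rV_continuous.
move=> e e0.
have /near_norm[d1 d10 d1P] : \forall w \near u, forall i, derivable F w (delta_mx 0 i).
  exact: near_forall.
(* One share for each of the [n] pieces; [n.+1] keeps the quotient meaningful when [n] is 0. *)
pose e' := e / n.+1%:R.
have e'0 : 0 < e' by rewrite divr_gt0.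
have /near_norm[d2 d20 d2P] : \forall w \near u, forall i, `|partial i F w - partial i F u| <= e'.
  apply: near_forall => i; have /cvgrPdist_le /(_ _ e'0) := pF_cont i.
  by apply: filterS => w; rewrite distrC.
exists (Num.min d1 d2); first by rewrite lt_min d10.
move=> v /=; rewrite lt_min => /andP[vd1 vd2].
have tele : F (u + v) - F u = \sum_(i < n) (F (u + truncate i.+1 v) - F (u + truncate i v)).
  rewrite -(big_mkord xpredT (fun i => F (u + truncate i.+1 v) - F (u + truncate i v))).
  by rewrite telescope_sumr// truncate0 truncate_all addr0.
rewrite tele dFE -sumrB.
apply: le_trans (ler_norm_sum _ _ _) _.
have : \sum_(i < n) e' * `|v| <= e * `|v|.
  rewrite -mulr_suml ler_wpM2r// sumr_const card_ord /e' -[X in _ <= X](@divfK _ n.+1%:R)//.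
  by rewrite -[X in X <= _]mulr_natr; apply: ler_wpM2l; rewrite ?ler_nat// ltW.
apply: le_trans; apply: ler_sum => i _.
have ball_in s : `|s| <= `|v 0 i| ->
    `|u + (truncate i v + s *: delta_mx 0 i) - u| <= `|v|.
  by move=> sv; rewrite addrC addKr truncate_norm.
have [s sv|c cv E] := @MVT_sym R (fun s => F (u + (truncate i v + s *: delta_mx 0 i)))
    (fun s => partial i F (u + (truncate i v + s *: delta_mx 0 i))) (v 0 i).
  have := d1P (u + (truncate i v + s *: delta_mx 0 i)).
  move=> /(_ (le_lt_trans (ball_in s sv) vd1) i) dd.
  have -> : (fun s => F (u + (truncate i v + s *: delta_mx 0 i)))
      = (fun s => F ((u + truncate i v) + s *: delta_mx 0 i)).
    by apply/funext => t; rewrite addrA.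
  by move: dd; rewrite !addrA => /is_derive_line.
have -> : u + truncate i.+1 v = u + (truncate i v + v 0 i *: delta_mx 0 i).
  by rewrite truncateS.
rewrite scale0r addr0 in E.
rewrite E mulrC -mulrBr normrM mulrC ler_pM// ?coord_le_norm//.
apply: d2P; exact: le_lt_trans (ball_in c cv) vd2.
Unshelve. all: by end_near. Qed.

Definition pdiff F u v : R := \sum_i v 0 i * partial i F u.

Lemma pdiff_linear F u : linear (pdiff F u).
Proof.
move=> a v w; rewrite [_ *: pdiff _ _ _]mulr_sumr -big_split/=.
by apply: eq_bigr => i _; rewrite !mxE mulrDl mulrA.
Qed.

HB.instance Definition _ F u :=
  GRing.isLinear.Build R 'rV[R]_n R _ (pdiff F u) (pdiff_linear F u).

Lemma smooth_on_partial (W : normedModType R) (U : set 'rV[R]_n)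
  (F : 'rV[R]_n -> W) i : smooth_on U F -> smooth_on U (partial i F).
Proof. by move=> sF s u Uu; have := sF (rcons s i) u Uu; rewrite foldr_rcons. Qed.

Lemma smooth_on_continuous (W : normedModType R) (U : set 'rV[R]_n)
  (F : 'rV[R]_n -> W) u : smooth_on U F -> U u -> {for u, continuous F}.
Proof. by move=> sF /(sF [::])[]. Qed.

Lemma smooth_on_derivable (W : normedModType R) (U : set 'rV[R]_n)
  (F : 'rV[R]_n -> W) u i : smooth_on U F -> U u -> derivable F u (delta_mx 0 i).
Proof. by move=> sF /(sF [::])[]. Qed.

Lemma smooth_is_diff U F u : open U -> smooth_on U F -> U u ->
  is_diff u F (pdiff F u).
Proof.
move=> oU sF Uu; apply: (@C1_is_diff F u (pdiff F u)) => //.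
- move=> i; have : \forall w \near u, U w by exact: open_nbhs_nbhs.
  by apply: filterS => w Uw; have [_] := sF [::] w Uw; exact.
- by move=> i; apply: smooth_on_continuous Uu; exact: smooth_on_partial.
Qed.

End Partial.

Section Curves.
Context {R : realType}.

Lemma is_derive_comp_diff (V W : normedModType R) (F : V -> W) (g : R -> V) t dg :
  differentiable F (g t) -> is_derive t 1 g dg ->
  is_derive t 1 (F \o g) ('d F (g t) dg).
Proof.
move=> dF [gd gE]; have gd' : differentiable g t by apply/derivable1_diffP.
split; first by apply/derivable1_diffP/differentiable_comp.
rewrite deriveE; last exact: differentiable_comp.
by rewrite diff_comp//= -gE [in RHS]deriveE.
Qed.

Lemma is_derive_continuous (W : normedModType R) (f : R -> W) (t : R) df :
  is_derive t 1 f df -> {for t, continuous f}.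
Proof. by case=> fd _; apply: differentiable_continuous; apply/derivable1_diffP. Qed.

Lemma is_derive_rV (V : normedModType R) n (g : V -> 'rV[R]_n) t v dg :
  is_derive t v g dg <-> (forall i, is_derive t v (fun s => g s 0 i) (dg 0 i)).
Proof.
split=> [[gd gE] i|H].
  split; first exact: (derivable_mxP _ _ _).1.
  by rewrite -gE derive_mx// mxE.
have gd : derivable g t v.
  by apply/derivable_mxP => i j; rewrite ord1; have [] := H j.
split=> //; rewrite derive_mx//; apply/rowP => i; rewrite mxE.
by have [_ ->] := H i.
Qed.

End Curves.

Section VectorValued.
Context {R : realType} {n m : nat}.
Implicit Types (F : 'rV[R]_n -> 'rV[R]_m) (u v : 'rV[R]_n).

Lemma differentiable_rV F u :
  (forall k, differentiable (fun w => F w 0 k) u) ->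
  is_diff u F (fun v => \row_k 'd (fun w => F w 0 k) u v).
Proof.
move=> dF.
pose L v : 'rV[R]_m := \row_k 'd (fun w => F w 0 k) u v.
have Ll : linear L by move=> a v w; apply/rowP => k; rewrite !mxE linearP.
pose L' : {linear 'rV[R]_n -> 'rV[R]_m} := HB.pack L (GRing.isLinear.Build _ _ _ _ L Ll).
apply: (@is_diff_of _ _ _ F L'); first exact: linear_rV_continuous.
move=> e e0.
have : \forall v \near (0 : 'rV[R]_n), forall k,
    `|F (u + v) 0 k - F u 0 k - 'd (fun w => F w 0 k) u v| <= e * `|v|.
  apply: near_forall => k.
  have /diff_locally/eqaddoP/(_ e e0) := dF k.
  have H : forall v, (((fun w => F w 0 k) \o shift u) - (cst (F u 0 k) + 'd (fun w => F w 0 k) u)) v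
     = F (u + v) 0 k - F u 0 k - 'd (fun w => F w 0 k) u v.
    move=> v; transitivity (F (v + u) 0 k - (F u 0 k + 'd (fun w => F w 0 k) u v)) => //.
    by rewrite [v + u]addrC opprD addrA.
  by apply: filterS => v; rewrite H.
move=> /near_norm[d d0 dP]; exists d => // v vd.
apply: rV_norm_le; first by rewrite mulr_ge0// ltW.
move=> k; have := dP v; rewrite subr0 => /(_ vd k).
by rewrite !mxE.
Qed.

End VectorValued.

Section Smooth.
Context {R : realType} {n : nat}.
Implicit Types (F : 'rV[R]_n -> R) (u v w : 'rV[R]_n) (U : set 'rV[R]_n).

(** An iterated derivative and its component agree on all of [U]; since [U] is open they agree near
    [u], and one more derivative can be taken. *)
Lemma smooth_on_coord m (F : 'rV[R]_n -> 'rV[R]_m) U k : open U ->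
  smooth_on U F -> smooth_on U (fun u => F u 0 k).
Proof.
move=> oU sF.
have E s : forall u, U u -> (foldr partial F s u) 0 k = foldr partial (fun u => F u 0 k) s u.
  elim: s => [|i s IH] u Uu //=.
  have [_ Fd] := sF s u Uu.
  rewrite [in LHS]/partial derive_mx; last exact: Fd.
  rewrite mxE; apply: near_eq_derive.
  by have : \forall w \near u, U w by [exact: open_nbhs_nbhs]; apply: filterS.
move=> s u Uu; have [Fc Fd] := sF s u Uu.
have nE : \forall w \near u, (foldr partial F s w) 0 k = foldr partial (fun u => F u 0 k) s w.
  by have : \forall w \near u, U w by [exact: open_nbhs_nbhs]; apply: filterS => w /E.
split=> [|i].
  rewrite /prop_for /continuous_at -E//.
  apply: cvg_trans; first exact: near_eq_cvg nE.
  apply: (@continuous_comp _ _ _ (foldr partial F s) (fun M : 'rV[R]_m => M 0 k)) => //.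
  exact: matrix_normedtype.coord_continuous.
apply: (@near_eq_derivable _ _ _ (fun w => foldr partial F s w 0 k)); first exact: nE.
by have /derivable_mxP := Fd i; exact.
Qed.

End Smooth.

(** * Locally Lipschitz functions and Taylor estimates *)

Lemma dist_le_half (R : realFieldType) (x y z e : R) :
  `|x - z| <= e / 2 -> `|y - z| <= e / 2 -> `|x - y| <= e.
Proof. by rewrite !ler_norml => /andP[? ?] /andP[? ?]; apply/andP; split; lra. Qed.

Section LocalLipschitz.
Context {R : realType} {V : normedModType R}.
Implicit Types (F G : V -> R) (p w : V).

Definition loclip F p := exists2 C : R, 0 <= C & exists2 d : R, 0 < d &
  forall w w', `|w - p| < d -> `|w' - p| < d -> `|F w - F w'| <= C * `|w - w'|.

Lemma loclip_near F p : loclip F p -> exists2 C : R, 0 <= C & exists2 d : R, 0 < d &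
  forall w w', `|w - p| < d -> `|w' - p| < d ->
    `|F w - F w'| <= C * `|w - w'| /\ `|F w| <= C.
Proof.
move=> [C C0 [d d0 H]]; exists (C * d + `|F p| + C).
  by rewrite !addr_ge0// mulr_ge0// ltW.
exists d => // w w' wd wd'; split.
  apply: le_trans (H _ _ wd wd') _; apply: ler_wpM2r => //.
  by rewrite lerDr addr_ge0// mulr_ge0// ltW.
have := H w p wd; rewrite subrr normr0 => /(_ d0) Hp.
rewrite -[F w](subrK (F p)); apply: le_trans (ler_normD _ _) _.
apply: (@le_trans _ _ (C * d + `|F p|)); last by rewrite lerDl.
by rewrite lerD2r (le_trans Hp)// ler_wpM2l// ltW.
Qed.

Lemma loclip_cst (a : R) p : loclip (cst a) p.
Proof.
by exists 0 => //; exists 1 => // w w' _ _; rewrite /cst subrr normr0 mul0r.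
Qed.

Lemma loclip_eq F G p : (\forall w \near p, F w = G w) -> loclip F p -> loclip G p.
Proof.
move=> /near_norm[e e0 FG] [C C0 [d d0 H]]; exists C => //.
exists (Num.min d e); first by rewrite lt_min d0.
move=> w w'; rewrite !lt_min => /andP[wd we] /andP[wd' we'].
by rewrite -!FG//; exact: H.
Qed.

Lemma loclipD F G p : loclip F p -> loclip G p -> loclip (fun w => F w + G w) p.
Proof.
move=> [C C0 [d d0 H]] [C' C0' [d' d0' H']]; exists (C + C'); first exact: addr_ge0.
exists (Num.min d d'); first by rewrite lt_min d0.
move=> w w'; rewrite !lt_min => /andP[wd we] /andP[wd' we'].
rewrite opprD addrACA mulrDl; apply: le_trans (ler_normD _ _) _.
by rewrite lerD ?H ?H'.
Qed.

Lemma loclipN F p : loclip F p -> loclip (fun w => - F w) p.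
Proof.
move=> [C C0 [d d0 H]]; exists C => //; exists d => // w w' wd wd'.
by rewrite opprK addrC distrC; exact: H.
Qed.

Lemma loclipM F G p : loclip F p -> loclip G p -> loclip (fun w => F w * G w) p.
Proof.
move=> /loclip_near[C C0 [d d0 H]] /loclip_near[C' C0' [d' d0' H']].
exists (C * C' + C' * C); first by rewrite addr_ge0// mulr_ge0.
exists (Num.min d d'); first by rewrite lt_min d0.
move=> w w'; rewrite !lt_min => /andP[wd we] /andP[wd' we'].
have -> : F w * G w - F w' * G w' = F w * (G w - G w') + G w' * (F w - F w') by ring.
have [H1 H2] := H w w' wd wd'; have [H3 _] := H' w w' we we'.
have [_ H4] := H' w' w we' we.
rewrite mulrDl; apply: le_trans (ler_normD _ _) _.
by rewrite !normrM -!mulrA lerD// ler_pM.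
Qed.

Lemma loclipV F p : F p != 0 -> loclip F p -> loclip (fun w => (F w)^-1) p.
Proof.
move=> Fp0 [C C0 [d d0 H]].
have Fp : 0 < `|F p| by rewrite normr_gt0.
(* Within this radius [F] varies by at most half of its value at [p], so its inverse stays bounded;
   [C + 1] is positive even if [C] is 0. *)
pose e := `|F p| / (2 * (C + 1)).
have C1 : 0 < C + 1 by rewrite ltr_wpDl.
have e0 : 0 < e by rewrite divr_gt0// mulr_gt0.
exists (C * (4 / `|F p| ^+ 2)).
  by rewrite mulr_ge0// divr_ge0// exprn_ge0.
exists (Num.min d e); first by rewrite lt_min d0.
have low w : `|w - p| < Num.min d e -> `|F p| / 2 <= `|F w|.
  rewrite lt_min => /andP[wd we].
  have := H w p wd; rewrite subrr normr0 => /(_ d0) Hp.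
  have : C * `|w - p| <= `|F p| / 2.
    have : C * e <= `|F p| / 2.
      have -> : `|F p| / 2 = (C + 1) * e by rewrite /e; field; rewrite gt_eqF.
      by rewrite ler_wpM2r ?lerDl// ltW.
    by apply: le_trans; rewrite ler_wpM2l// ltW.
  have : `|F p| <= `|F w - F p| + `|F w|.
    by rewrite distrC -{1}[F p](subrK (F w)) ler_normD.
  by move=> ? ?; lra.
move=> w w' wd wd'.
have l := low _ wd; have l' := low _ wd'.
have Fw0 : 0 < `|F w| by apply: lt_le_trans l; rewrite divr_gt0.
have Fw0' : 0 < `|F w'| by apply: lt_le_trans l'; rewrite divr_gt0.
have -> : (F w)^-1 - (F w')^-1 = - ((F w - F w') * ((F w)^-1 * (F w')^-1)).
  by field; rewrite -!normr_gt0 Fw0 Fw0'.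
rewrite normrN normrM mulrAC; apply: ler_pM => //.
  by move: wd wd'; rewrite !lt_min => /andP[? _] /andP[? _]; exact: H.
rewrite normrM !normfV -invfM (_ : 4 / _ = (`|F p| / 2 * (`|F p| / 2))^-1).
  by rewrite lef_pV2 ?posrE ?mulr_gt0// ler_pM// divr_ge0.
by field; rewrite gt_eqF.
Qed.

Lemma loclip_sum I (r : seq I) (P : pred I) (F : I -> V -> R) p :
  (forall i, P i -> loclip (F i) p) -> loclip (fun w => \sum_(i <- r | P i) F i w) p.
Proof.
move=> H; elim: r => [|i r IH].
  by apply: loclip_eq (loclip_cst 0 p); apply: nearW => w; rewrite big_nil.
case Pi: (P i); last first.
  by apply: loclip_eq IH; apply: nearW => w; rewrite big_cons Pi.
apply: loclip_eq (loclipD (H i Pi) IH).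
by apply: nearW => w; rewrite big_cons Pi.
Qed.

Lemma loclip_prod I (r : seq I) (P : pred I) (F : I -> V -> R) p :
  (forall i, P i -> loclip (F i) p) -> loclip (fun w => \prod_(i <- r | P i) F i w) p.
Proof.
move=> H; elim: r => [|i r IH].
  by apply: loclip_eq (loclip_cst 1 p); apply: nearW => w; rewrite big_nil.
case Pi: (P i); last first.
  by apply: loclip_eq IH; apply: nearW => w; rewrite big_cons Pi.
apply: loclip_eq (loclipM (H i Pi) IH).
by apply: nearW => w; rewrite big_cons Pi.
Qed.

Lemma loclip_det n (A : V -> 'M[R]_n) p :
  (forall i j, loclip (fun w => A w i j) p) -> loclip (fun w => \det (A w)) p.
Proof.
move=> H; apply: loclip_sum => s _; apply: loclipM; first exact: loclip_cst.
by apply: loclip_prod => i _; exact: H.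
Qed.

(** By the cofactor formula an entry of the inverse is a signed minor divided by the determinant. *)
Lemma loclip_invmx n (A : V -> 'M[R]_n) p i j :
  (\forall w \near p, A w \in unitmx) ->
  (forall i j, loclip (fun w => A w i j) p) -> loclip (fun w => invmx (A w) i j) p.
Proof.
move=> Au H.
have Ap : \det (A p) != 0.
  by have := nbhs_singleton Au; rewrite unitmxE unitfE.
apply: (@loclip_eq (fun w => (\det (A w))^-1 * ((-1) ^+ (j + i) * \det (row' j (col' i (A w)))))).
  apply: filterS Au => w Aw; rewrite /invmx Aw !mxE /cofactor.
  by [].
apply: loclipM; first by apply: loclipV => //; exact: loclip_det.
apply: loclipM; first exact: loclip_cst.
apply: loclip_det => k l.
by apply: loclip_eq (H (lift j k) (lift i l)); apply: nearW => w; rewrite !mxE.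
Qed.

Lemma loclip_family m (F : 'I_m -> V -> R) p : (forall k, loclip (F k) p) ->
  exists2 C : R, 0 <= C & exists2 d : R, 0 < d & forall k w w',
    `|w - p| < d -> `|w' - p| < d -> `|F k w - F k w'| <= C * `|w - w'|.
Proof.
move=> H.
have /choice[C HC] : forall k, exists C : R, 0 <= C /\ exists2 d : R, 0 < d &
    forall w w', `|w - p| < d -> `|w' - p| < d -> `|F k w - F k w'| <= C * `|w - w'|.
  by move=> k; have [C C0 Hd] := H k; exists C.
have : \forall e \near (0:R)^'+, forall k w w', `|w - p| < e -> `|w' - p| < e ->
    `|F k w - F k w'| <= C k * `|w - w'|.
  apply: (@filter_forall _ 'I_m) => k; have [_ [d d0 Hd]] := HC k.
  near=> e => w w' we we'; apply: Hd.
    by apply: lt_trans we _; near: e; apply: nbhs_right_lt.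
  by apply: lt_trans we' _; near: e; apply: nbhs_right_lt.
move=> HN; exists (\sum_k C k).
  by apply: sumr_ge0 => k _; have [] := HC k.
have [e [e0 He]] : exists e : R, 0 < e /\ forall k w w', `|w - p| < e -> `|w' - p| < e ->
    `|F k w - F k w'| <= C k * `|w - w'|.
  near ((0:R)^'+) => e; exists e; split; first by [].
  by near: e.
exists e => // k w w' we we'; apply: le_trans (He k w w' we we') _.
apply: ler_wpM2r => //; rewrite (bigD1 k)//= lerDl.
by apply: sumr_ge0 => i _; have [] := HC i.
Unshelve. all: by end_near. Qed.

End LocalLipschitz.

Lemma loclip_comp (R : realType) (V W : normedModType R) (F : W -> R) (h : V -> W) p :
  (forall w w', `|h w - h w'| <= `|w - w'|) ->
  loclip F (h p) -> loclip (fun w => F (h w)) p.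
Proof.
move=> hh [C C0 [d d0 H]]; exists C => //; exists d => // w w' wd wd'.
apply: (@le_trans _ _ (C * `|h w - h w'|)); last by rewrite ler_wpM2l.
by apply: H; apply: le_lt_trans (hh _ _) _.
Qed.

(** * Mean value theorem, second-order Taylor estimate, symmetry of second derivatives *)

Section MeanValue.
Context {R : realType} {n : nat}.
Implicit Types (F : 'rV[R]_n -> R) (u v w : 'rV[R]_n) (U : set 'rV[R]_n).

Lemma ball_convex u w w' (d c : R) : 0 <= c -> c <= 1 ->
  `|w - u| < d -> `|w' - u| < d -> `|w' + c *: (w - w') - u| < d.
Proof.
move=> c0 c1 wd wd'.
have -> : w' + c *: (w - w') - u = (1 - c) *: (w' - u) + c *: (w - u).
  by apply/rowP => i; rewrite !mxE; ring.
apply: le_lt_trans (ler_normD _ _) _; rewrite !normrZ !ger0_norm ?subr_ge0//.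
have [->|c0'] := eqVneq c 0; first by rewrite mul0r addr0 subr0 mul1r.
have cp : 0 < c by rewrite lt_neqAle eq_sym c0'.
have : c * `|w - u| < c * d by rewrite ltr_pM2l.
have : (1 - c) * `|w' - u| <= (1 - c) * d by rewrite ler_wpM2l ?subr_ge0// ltW.
by move=> ? ?; lra.
Qed.

Lemma MVT_ball F u (d : R) w w' :
  (forall w, `|w - u| < d -> is_diff w F (pdiff F w)) ->
  `|w - u| < d -> `|w' - u| < d ->
  exists2 c : R, 0 <= c <= 1 & F w - F w' = pdiff F (w' + c *: (w - w')) (w - w').
Proof.
move=> dF wd wd'.
have D (s : R) : 0 <= s -> s <= 1 -> is_derive s 1 (fun t : R => F (w' + t *: (w - w')))
    (pdiff F (w' + s *: (w - w')) (w - w')).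
  move=> s0 s1.
  have := dF _ (ball_convex s0 s1 wd wd') => -[Fd FE].
  rewrite -FE -deriveE//; apply: is_derive_line; exact: diff_derivable.
have [||c] := @MVT_segment R (fun t : R => F (w' + t *: (w - w')))
   (fun t => pdiff F (w' + t *: (w - w')) (w - w')) 0 1 ler01.
- by move=> t; rewrite in_itv/= => /andP[t0 t1]; apply: D; exact: ltW.
- apply: derivable_within_continuous => t; rewrite in_itv/= => /andP[t0 t1].
  by have [] := D t t0 t1.
rewrite in_itv/= subr0 mulr1 scale1r scale0r addr0 => c01.
by rewrite [w' + _]addrC subrK => E; exists c.
Qed.

Lemma open_ball U u : open U -> U u -> exists2 d : R, 0 < d & forall w, `|w - u| < d -> U w.
Proof.
move=> oU Uu; have : \forall w \near u, U w by exact: open_nbhs_nbhs.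
by move/near_norm.
Qed.

Lemma pdiff_le F u v (B : 'I_n -> R) : (forall i, `|partial i F u| <= B i) ->
  `|pdiff F u v| <= (\sum_i B i) * `|v|.
Proof.
move=> FB; apply: le_trans (ler_norm_sum _ _ _) _; rewrite mulr_suml.
apply: ler_sum => i _; rewrite normrM mulrC ler_pM//; exact: coord_le_norm.
Qed.

Lemma smooth_loclip F U u : open U -> smooth_on U F -> U u -> loclip F u.
Proof.
move=> oU sF Uu; have [d d0 dU] := open_ball oU Uu.
have : \forall w \near u, forall i, `|partial i F w| <= `|partial i F u| + 1.
  apply: near_forall => i.
  have /cvgrPdist_le/(_ _ ltr01) := smooth_on_continuous (smooth_on_partial i sF) Uu.
  apply: filterS => w H.
  rewrite -[X in `|X| <= _](subKr (partial i F u)).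
  by apply: le_trans (ler_normB _ _) _; rewrite lerD2l.
move=> /near_norm[e e0 eP].
exists (\sum_i (`|partial i F u| + 1)); first by apply: sumr_ge0 => i _; rewrite addr_ge0.
exists (Num.min d e); first by rewrite lt_min d0.
move=> w w'; rewrite !lt_min => /andP[wd we] /andP[wd' we'].
have [c /andP[c0 c1] ->] := MVT_ball (fun w wd => smooth_is_diff oU sF (dU w wd)) wd wd'.
by apply: pdiff_le; apply: eP; exact: ball_convex.
Qed.

(** The mean value theorem gives the differential at an intermediate point; moving it to [w'] costs
    a second factor, since the partial derivatives are locally Lipschitz. The bound is uniform in
    the base point [w']. *)
Lemma smooth_taylor F U u : open U -> smooth_on U F -> U u ->
  exists2 C : R, 0 <= C & exists2 d : R, 0 < d & forall w w',
    `|w - u| < d -> `|w' - u| < d ->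
    `|F w - F w' - pdiff F w' (w - w')| <= C * `|w - w'| ^+ 2.
Proof.
move=> oU sF Uu; have [d d0 dU] := open_ball oU Uu.
have [C C0 [e e0 eP]] := loclip_family (fun i => smooth_loclip oU (smooth_on_partial i sF) Uu).
exists (C *+ n); first by rewrite mulrn_wge0.
exists (Num.min d e); first by rewrite lt_min d0.
move=> w w'; rewrite !lt_min => /andP[wd we] /andP[wd' we'].
have [c /andP[c0 c1] ->] := MVT_ball (fun w wd => smooth_is_diff oU sF (dU w wd)) wd wd'.
rewrite /pdiff -sumrB; apply: le_trans (ler_norm_sum _ _ _) _.
rewrite -[X in C *+ X]card_ord -sumr_const mulr_suml; apply: ler_sum => i _.
rewrite -mulrBr normrM expr2 mulrA mulrC; apply: ler_pM => //; last exact: coord_le_norm.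
have := eP i _ _ (ball_convex c0 c1 we we') we'.
move=> /le_trans; apply; rewrite ler_wpM2l//.
by rewrite addrC addKr normrZ ger0_norm// ler_piMl.
Qed.

Lemma norm_delta_le1 (k : 'I_n) : `|delta_mx 0 k : 'rV[R]_n| <= 1.
Proof. by apply: rV_norm_le => // l; rewrite mxE; case: (_ && _); rewrite ?normr1 ?normr0. Qed.

(** The second difference of [F] over a square of side [h] is the same in both orders. The mean
    value theorem, applied twice, makes it [h * h] times either mixed derivative at a nearby point,
    and continuity at [u] concludes. *)
Lemma schwarz F U u i j : open U -> smooth_on U F -> U u ->
  partial i (partial j F) u = partial j (partial i F) u.
Proof.
move=> oU sF Uu; have [d d0 dU] := open_ball oU Uu.
have mixed a b (h : R) : `|h| < d / 2 -> exists c c', [/\ `|c| <= `|h|, `|c'| <= `|h| &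
   F (u + h *: delta_mx 0 a + h *: delta_mx 0 b) - F (u + h *: delta_mx 0 a)
   - F (u + h *: delta_mx 0 b) + F u =
   partial b (partial a F) (u + c *: delta_mx 0 a + c' *: delta_mx 0 b) * h * h].
  move=> hd.
  have in_ball (s t : R) : `|s| <= `|h| -> `|t| <= `|h| ->
      U (u + s *: delta_mx 0 a + t *: delta_mx 0 b).
    move=> sh th; apply: dU; rewrite -[u + _ + _]addrA [_ - u]addrC addKr.
    apply: le_lt_trans (ler_normD _ _) _; rewrite !normrZ.
    have := norm_delta_le1 a; have := norm_delta_le1 b => ? ?.
    apply: (@le_lt_trans _ _ (`|h| * 1 + `|h| * 1)); last by lra.
    by rewrite lerD// ler_pM.
  have [|c ch Ec] := @MVT_sym R (fun s => F (u + s *: delta_mx 0 a + h *: delta_mx 0 b) - F (u + s *: delta_mx 0 a))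
      (fun s => partial a F (u + s *: delta_mx 0 a + h *: delta_mx 0 b) - partial a F (u + s *: delta_mx 0 a)) h.
    move=> s sh; apply: is_deriveB.
      have -> : (fun s => F (u + s *: delta_mx 0 a + h *: delta_mx 0 b)) =
           (fun s => F ((u + h *: delta_mx 0 b) + s *: delta_mx 0 a)).
        by apply/funext => t; rewrite addrAC.
      rewrite addrAC; apply: is_derive_line; rewrite addrAC.
      by apply: smooth_on_derivable sF _; exact: in_ball.
    apply: is_derive_line; apply: smooth_on_derivable sF _.
    by have := in_ball s 0 sh; rewrite normr0 scale0r addr0; exact.
  have [|c' ch' Ec'] := @MVT_sym R (fun t => partial a F (u + c *: delta_mx 0 a + t *: delta_mx 0 b))
      (fun t => partial b (partial a F) (u + c *: delta_mx 0 a + t *: delta_mx 0 b)) h.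
    move=> s sh; apply: is_derive_line.
    by apply: smooth_on_derivable (smooth_on_partial a sF) _; exact: in_ball.
  exists c, c'; split=> //.
  rewrite -Ec' scale0r addr0 -Ec scale0r addr0; ring.
apply/eqP; rewrite -subr_eq0 -normr_le0; apply/ler_addgt0Pr => e e0; rewrite add0r.
have e2 : 0 < e / 2 by rewrite divr_gt0.
have /cvgrPdist_le/(_ _ e2)/near_norm[d1 d10 H1] :=
  smooth_on_continuous (smooth_on_partial i (smooth_on_partial j sF)) Uu.
have /cvgrPdist_le/(_ _ e2)/near_norm[d2 d20 H2] :=
  smooth_on_continuous (smooth_on_partial j (smooth_on_partial i sF)) Uu.
have [h [h0 hd hd1 hd2]] : exists h : R, [/\ 0 < h, h < d / 2, 2 * h < d1 & 2 * h < d2].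
  exists (Num.min d (Num.min d1 d2) / 4).
  have : Num.min d (Num.min d1 d2) <= d by rewrite ge_min lexx.
  have : Num.min d (Num.min d1 d2) <= d1 by rewrite !ge_min lexx orbT.
  have : Num.min d (Num.min d1 d2) <= d2 by rewrite !ge_min lexx !orbT.
  have : 0 < Num.min d (Num.min d1 d2) by rewrite !lt_min d0 d10.
  by move=> ? ? ? ?; split; lra.
have nb (a b : 'I_n) (s t : R) : `|s| <= `|h| -> `|t| <= `|h| ->
    `|u + s *: delta_mx 0 a + t *: delta_mx 0 b - u| <= 2 * h.
  move=> sh th; rewrite -[u + _ + _]addrA [_ - u]addrC addKr.
  apply: le_trans (ler_normD _ _) _; rewrite !normrZ.
  rewrite (gtr0_norm h0) in sh th; have -> : 2 * h = h * 1 + h * 1.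
    by rewrite mulr1 -mulr2n mulr_natl.
  by apply: lerD; apply: ler_pM => //; exact: norm_delta_le1.
have hd' : `|h| < d / 2 by rewrite gtr0_norm.
have [c [c' [ch ch' E1]]] := mixed i j h hd'.
have [k [k' [kh kh' E2]]] := mixed j i h hd'.
have E : partial j (partial i F) (u + c *: delta_mx 0 i + c' *: delta_mx 0 j) =
   partial i (partial j F) (u + k *: delta_mx 0 j + k' *: delta_mx 0 i).
  have hn0 : h != 0 by rewrite gt_eqF.
  move: E1; rewrite [u + h *: delta_mx 0 i + _]addrAC.
  rewrite [X in X + F u]addrAC E2 => /esym.
  by move=> /(mulIf hn0)/(mulIf hn0).
have := H1 _ (le_lt_trans (nb j i _ _ kh kh') hd1).
have := H2 _ (le_lt_trans (nb i j _ _ ch ch') hd2).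
rewrite E => A B.
exact: dist_le_half B A.
Qed.

End MeanValue.

(** * Metrics and geodesic equation in coordinates *)

Section Multilinear.
Context {R : comNzRingType} {n : nat}.
Implicit Types (a b c : 'rV[R]_n) (A : 'M[R]_n) (D : 'I_n -> 'I_n -> 'I_n -> R).

Definition bil A a b := \sum_i \sum_j A i j * a 0 i * b 0 j.

(** For [D] the first derivatives of a metric, this is the derivative of the metric in the direction
    [a], evaluated on [b] and [c]. *)
Definition tri D a b c := \sum_l \sum_i \sum_j D l i j * a 0 l * b 0 i * c 0 j.

Lemma bil_sym A a b : (forall i j, A i j = A j i) -> bil A a b = bil A b a.
Proof.
move=> As; rewrite /bil exchange_big; apply: eq_bigr => i _; apply: eq_bigr => j _.
by rewrite As mulrAC.
Qed.

Lemma bilDl A a b c : bil A (a + b) c = bil A a c + bil A b c.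
Proof.
rewrite /bil -big_split; apply: eq_bigr => i _; rewrite -big_split.
by apply: eq_bigr => j _; rewrite !mxE /=; ring.
Qed.

Lemma bilDr A a b c : bil A c (a + b) = bil A c a + bil A c b.
Proof.
rewrite /bil -big_split; apply: eq_bigr => i _; rewrite -big_split.
by apply: eq_bigr => j _; rewrite !mxE /=; ring.
Qed.

Lemma bilNl A a b : bil A (- a) b = - bil A a b.
Proof.
rewrite /bil -sumrN; apply: eq_bigr => i _; rewrite -sumrN.
by apply: eq_bigr => j _; rewrite !mxE /=; ring.
Qed.

Lemma bilNr A a b : bil A a (- b) = - bil A a b.
Proof.
rewrite /bil -sumrN; apply: eq_bigr => i _; rewrite -sumrN.
by apply: eq_bigr => j _; rewrite !mxE /=; ring.
Qed.

Lemma bilBB A a b : (forall i j, A i j = A j i) ->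
  bil A a a - bil A b b = bil A (a - b) b *+ 2 + bil A (a - b) (a - b).
Proof.
by move=> As; rewrite !(bilDl, bilDr, bilNl, bilNr) (bil_sym b a As); ring.
Qed.

Lemma tri_sym D a b c : (forall l i j, D l i j = D l j i) -> tri D a b c = tri D a c b.
Proof.
move=> Ds; apply: eq_bigr => l _; rewrite exchange_big.
by apply: eq_bigr => i _; apply: eq_bigr => j _; rewrite Ds mulrAC.
Qed.

Lemma tri_bil D a b c : tri D a b c = bil (\matrix_(i, j) \sum_l D l i j * a 0 l) b c.
Proof.
rewrite /tri /bil exchange_big; apply: eq_bigr => i _; rewrite exchange_big.
by apply: eq_bigr => j _; rewrite mxE !mulr_suml.
Qed.

End Multilinear.

Section Metric.
Context {R : realType} {n : nat}.
Local Notation V := 'rV[R]_n.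
Variables (U : set V) (g : V -> 'M[R]_n).
Hypothesis U_open : open U.
Hypothesis g_smooth : forall i j, smooth_on U (fun u => g u i j : R).
Hypothesis g_sym : forall u, U u -> forall i j, g u i j = g u j i.
Hypothesis g_unit : forall u, U u -> g u \in unitmx.

Definition dmetric (u : V) l i j : R := partial l (fun v => g v i j : R) u.

(** The formula of [christoffel] for an arbitrary matrix field, so that the computations take place
    on an open set of coordinates. For [g := gram c] the two are convertible. *)
Definition chris (u : V) (k i j : 'I_n) : R :=
  2^-1 * \sum_l invmx (g u) k l * (dmetric u i j l + dmetric u j i l - dmetric u l i j).

(** The right-hand side of the geodesic equation, at position [u] and velocity [q]. *)
Definition accel (u q : V) : V :=
  \row_k - \sum_i \sum_j chris u k i j * q 0 i * q 0 j.

Definition chris_vec (u a b : V) : V :=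
  \row_k \sum_i \sum_j chris u k i j * a 0 i * b 0 j.

Lemma dmetric_sym u : U u -> forall l i j, dmetric u l i j = dmetric u l j i.
Proof.
move=> Uu l i j; apply: near_eq_derive.
have : \forall w \near u, U w by exact: open_nbhs_nbhs.
by apply: filterS => w Uw; exact: g_sym.
Qed.

(** Lowering the index with [g] cancels the inverse matrix and leaves the Christoffel symbols of the
    first kind. *)
Lemma chris_lower u l i j : U u ->
  \sum_k g u l k * chris u k i j = 2^-1 * (dmetric u i j l + dmetric u j i l - dmetric u l i j).
Proof.
move=> Uu; rewrite /chris.
pose h m := dmetric u i j m + dmetric u j i m - dmetric u m i j.
transitivity (2^-1 * \sum_m (\sum_k g u l k * invmx (g u) k m) * h m).
  rewrite mulr_sumr; under eq_bigr do rewrite mulrCA mulr_sumr mulr_sumr.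
  rewrite exchange_big; apply: eq_bigr => m _; rewrite mulr_suml mulr_sumr.
  by apply: eq_bigr => k _; rewrite -!mulrA.
congr (_ * _); rewrite (bigD1 l)//= [X in _ + X]big1 ?addr0.
  have := mulmxV (g_unit Uu) => /matrixP/(_ l l); rewrite !mxE eqxx => ->.
  by rewrite mul1r.
move=> m ml; have := mulmxV (g_unit Uu) => /matrixP/(_ l m).
rewrite !mxE eq_sym (negbTE ml) => ->.
by rewrite mul0r.
Qed.

Lemma bil_chris u a b c : U u ->
  bil (g u) a (chris_vec u b c) = 2^-1 *
    (tri (dmetric u) b c a + tri (dmetric u) c b a - tri (dmetric u) a b c).
Proof.
move=> Uu.
transitivity (\sum_l a 0 l * \sum_i \sum_j (\sum_k g u l k * chris u k i j) * b 0 i * c 0 j).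
  apply: eq_bigr => l _.
  transitivity (\sum_k a 0 l * (g u l k * \sum_i \sum_j chris u k i j * b 0 i * c 0 j)).
    by apply: eq_bigr => k _; rewrite mxE; ring.
  rewrite -mulr_sumr; congr (_ * _).
  under eq_bigr do rewrite mulr_sumr.
  rewrite exchange_big; apply: eq_bigr => i _.
  under eq_bigr do rewrite mulr_sumr.
  rewrite exchange_big; apply: eq_bigr => j _.
  by rewrite !mulr_suml; apply: eq_bigr => k _; rewrite !mulrA.
have E1 x y : tri (dmetric u) x y a = \sum_l \sum_i \sum_j dmetric u i j l * x 0 i * y 0 j * a 0 l.
  by rewrite /tri; under eq_bigr do rewrite exchange_big; rewrite exchange_big.
have E2 : tri (dmetric u) c b a = \sum_l \sum_i \sum_j dmetric u j i l * b 0 i * c 0 j * a 0 l.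
  rewrite E1; apply: eq_bigr => l _; rewrite exchange_big.
  by apply: eq_bigr => i _; apply: eq_bigr => j _; ring.
rewrite E1 E2 /tri -big_split -sumrB mulr_sumr.
apply: eq_bigr => l _; rewrite mulr_sumr -big_split -sumrB mulr_sumr.
apply: eq_bigr => i _; rewrite mulr_sumr -big_split -sumrB mulr_sumr.
by apply: eq_bigr => j _; rewrite chris_lower//=; ring.
Qed.

(** The geodesic equation with its index lowered, that is, the Euler-Lagrange equation of the energy
    [2^-1 * bil (g u) q q]. *)
Lemma bil_accel u a q : U u ->
  bil (g u) a (accel u q) = 2^-1 * tri (dmetric u) a q q - tri (dmetric u) q a q.
Proof.
move=> Uu; have -> : accel u q = - chris_vec u q q by apply/rowP => k; rewrite !mxE.
rewrite bilNr bil_chris// (tri_sym q a q (dmetric_sym Uu)).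
by move: (tri _ _ _ _) (tri _ _ _ _) => x y; field.
Qed.

Lemma is_derive_sumE m (h : 'I_m -> R -> R) (dh : 'I_m -> R) (t : R) :
  (forall i, is_derive t 1 (h i) (dh i)) ->
  is_derive t 1 (fun s => \sum_i h i s) (\sum_i dh i).
Proof.
move=> H; have -> : (fun s => \sum_i h i s) = \sum_(i < m) h i.
  by apply/funext => s; rewrite fct_sumE.
exact: is_derive_sum.
Qed.

Lemma is_derive_metric (u : R -> V) t du i j : U (u t) -> is_derive t 1 u du ->
  is_derive t 1 (fun s => g (u s) i j) (\sum_l dmetric (u t) l i j * du 0 l).
Proof.
move=> Ut Hu; have [Fd FE] := smooth_is_diff U_open (g_smooth i j) Ut.
have H := is_derive_comp_diff Fd Hu; apply: (is_derive_eq H); rewrite FE.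
by apply: eq_bigr => l _; rewrite mulrC.
Qed.

Lemma is_derive_bil (u a b : R -> V) t du da db : U (u t) ->
  is_derive t 1 u du -> is_derive t 1 a da -> is_derive t 1 b db ->
  is_derive t 1 (fun s => bil (g (u s)) (a s) (b s))
    (tri (dmetric (u t)) du (a t) (b t) + bil (g (u t)) da (b t) + bil (g (u t)) (a t) db).
Proof.
move=> Ut Hu Ha Hb.
have -> : tri (dmetric (u t)) du (a t) (b t) + bil (g (u t)) da (b t) + bil (g (u t)) (a t) db =
   \sum_i \sum_j ((\sum_l dmetric (u t) l i j * du 0 l) * a t 0 i * b t 0 j
      + g (u t) i j * da 0 i * b t 0 j + g (u t) i j * a t 0 i * db 0 j).
  rewrite tri_bil /bil -!big_split; apply: eq_bigr => i _; rewrite -!big_split.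
  by apply: eq_bigr => j _; rewrite mxE.
apply: is_derive_sumE => i; apply: is_derive_sumE => j.
have H1 := is_derive_metric i j Ut Hu.
have H2 := (is_derive_rV _ _ _ _).1 Ha i; have H3 := (is_derive_rV _ _ _ _).1 Hb j.
have H := is_deriveM (is_deriveM H1 H2) H3.
apply: (is_derive_eq H).
transitivity (g (u t) i j * a t 0 i * db 0 j + b t 0 j * (g (u t) i j * da 0 i
   + a t 0 i * \sum_l dmetric (u t) l i j * du 0 l)) => //; ring.
Qed.

(* d/dt of the pairing of the difference of two solutions with the velocity
   of the first: no second derivative of the second solution enters. *)
Lemma is_derive_pairing (u v du : R -> V) t dv : U (u t) ->
  is_derive t 1 u (du t) -> is_derive t 1 v dv -> is_derive t 1 du (accel (u t) (du t)) ->
  is_derive t 1 (fun s => bil (g (u s)) (v s - u s) (du s))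
    (2^-1 * tri (dmetric (u t)) (v t - u t) (du t) (du t) + bil (g (u t)) (dv - du t) (du t)).
Proof.
move=> Ut Hu Hv Hdu.
have H := is_derive_bil Ut Hu (is_deriveB Hv Hu) Hdu; apply: (is_derive_eq H).
by rewrite bil_accel//=; ring.
Qed.

Lemma is_derive_energy (u du : R -> V) t : U (u t) ->
  is_derive t 1 u (du t) -> is_derive t 1 du (accel (u t) (du t)) ->
  is_derive t 1 (fun s => bil (g (u s)) (du s) (du s)) 0.
Proof.
move=> Ut Hu Hdu; have H := is_derive_bil Ut Hu Hdu Hdu; apply: (is_derive_eq H).
rewrite (bil_sym _ _ (g_sym Ut)) !bil_accel//=; by field.
Qed.

Lemma loclip_coord (p : V) (i : 'I_n) : loclip (fun q : V => q 0 i) p.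
Proof.
exists 1 => //; exists 1 => // w w' _ _; rewrite mul1r.
by have := coord_le_norm (w - w') i; rewrite !mxE.
Qed.

Lemma fst_lip (z z' : V * V) : `|z.1 - z'.1| <= `|z - z'|.
Proof. by rewrite [leRHS]/Num.norm/= le_max lexx. Qed.

Lemma snd_lip (z z' : V * V) : `|z.2 - z'.2| <= `|z - z'|.
Proof. by rewrite [leRHS]/Num.norm/= le_max lexx orbT. Qed.

Lemma loclip_accel (p q : V) k : U p -> loclip (fun z : V * V => accel z.1 z.2 0 k) (p, q).
Proof.
move=> Up.
have lchris i j : loclip (fun w => chris w k i j) p.
  apply: loclipM; first exact: loclip_cst.
  apply: loclip_sum => l _; apply: loclipM.
    apply: loclip_invmx.
      have : \forall w \near p, U w by exact: open_nbhs_nbhs.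
      by apply: filterS => w; exact: g_unit.
    by move=> a b; apply: smooth_loclip Up.
  have ld a b c : loclip (fun w => dmetric w a b c) p.
    exact: smooth_loclip U_open (smooth_on_partial _ (g_smooth b c)) Up.
  apply: loclipD; first exact: loclipD.
  exact: loclipN.
have -> : (fun z : V * V => accel z.1 z.2 0 k) =
    (fun z => - \sum_i \sum_j chris z.1 k i j * z.2 0 i * z.2 0 j).
  by apply/funext => z; rewrite mxE.
apply: loclipN.
apply: loclip_sum => i _; apply: loclip_sum => j _.
have coord2 l : loclip (fun z : V * V => z.2 0 l) (p, q).
  exact: (@loclip_comp R (V * V)%type V (fun q : V => q 0 l) snd (p, q) snd_lip (loclip_coord q l)).
apply: loclipM; last exact: coord2.
apply: loclipM; last exact: coord2.
exact: (@loclip_comp R (V * V)%type V (fun w => chris w k i j) fst (p, q) fst_lip (lchris i j)).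
Qed.

Lemma norm_bil_le (A : 'M[R]_n) (a b : V) (C : R) : (forall i j, `|A i j| <= C) ->
  `|bil A a b| <= C * `|a| * `|b| * n%:R ^+ 2.
Proof.
move=> AC; have -> : C * `|a| * `|b| * n%:R ^+ 2 = \sum_(i < n) \sum_(j < n) C * `|a| * `|b|.
  by rewrite !sumr_const !card_ord -mulrnA -[RHS]mulr_natr natrM expr2.
apply: le_trans (ler_norm_sum _ _ _) _; apply: ler_sum => i _.
apply: le_trans (ler_norm_sum _ _ _) _; apply: ler_sum => j _.
by rewrite !normrM !ler_pM ?mulr_ge0// coord_le_norm.
Qed.

Lemma uniform_consts (I : finType) (P : I -> R -> R -> Prop) :
  (forall k C C' d d', C <= C' -> d' <= d -> P k C d -> P k C' d') ->
  (forall k, exists2 C : R, 0 <= C & exists2 d : R, 0 < d & P k C d) ->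
  exists2 C : R, 0 <= C & exists2 d : R, 0 < d & forall k, P k C d.
Proof.
move=> mono H.
have /choice[Cd HCd] : forall k, exists Cd : R * R, [/\ 0 <= Cd.1, 0 < Cd.2 & P k Cd.1 Cd.2].
  by move=> k; have [C C0 [d d0 Pk]] := H k; exists (C, d).
exists (\sum_k (Cd k).1); first by apply: sumr_ge0 => k _; have [] := HCd k.
exists (\big[Num.min/1]_k (Cd k).2).
  by elim/big_ind: _ => // [x y x0 y0|k _]; [rewrite lt_min x0|have [] := HCd k].
move=> k; have [_ _] := HCd k; apply: mono; last exact: bigmin_le.
by rewrite (bigD1 k)//= lerDl; apply: sumr_ge0 => i _; have [] := HCd i.
Qed.

Lemma metric_local_bounds (p : V) (ij : 'I_n * 'I_n) : U p ->
  exists2 C : R, 0 <= C & exists2 d : R, 0 < d & forall w w',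
    `|w - p| < d -> `|w' - p| < d ->
    [/\ `|g w ij.1 ij.2| <= C,
      `|\sum_l dmetric w l ij.1 ij.2 * (w' - w) 0 l| <= C * `|w' - w| &
      `|g w' ij.1 ij.2 - g w ij.1 ij.2
        - \sum_l dmetric w l ij.1 ij.2 * (w' - w) 0 l| <= C * `|w' - w| ^+ 2].
Proof.
case: ij => i j Up /=; pose G (u : V) : R := g u i j.
have pE w (v : V) : \sum_l dmetric w l i j * v 0 l = pdiff G w v.
  by apply: eq_bigr => l _; rewrite mulrC.
have [C1 C10 [d1 d10 H1]] := loclip_near (smooth_loclip U_open (g_smooth i j) Up).
have [C2 C20 [d2 d20 H2]] := smooth_taylor U_open (g_smooth i j) Up.
exists (C1 + C2 + C1 + C2 * (d1 + d1)); first by rewrite !addr_ge0// mulr_ge0// addr_ge0// ltW.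
exists (Num.min d1 d2); first by rewrite !lt_min d10.
move=> w w'; rewrite !lt_min => /andP[w1 w2] /andP[w1' w2'].
have [L1 B1] := H1 w' w w1' w1; have [_ B2] := H1 w w' w1 w1'.
have T := H2 w' w w2' w2.
have C3 : 0 <= C2 * (d1 + d1) by rewrite mulr_ge0// addr_ge0// ltW.
have ww : `|w' - w| <= d1 + d1.
  rewrite -(subrKA p) (le_trans (ler_normD _ _))//.
  by rewrite lerD ?ltW// distrC.
split.
- by apply: le_trans B2 _; rewrite -!addrA lerDl !addr_ge0.
- rewrite pE.
  have -> : pdiff G w (w' - w) = (G w' - G w) - (G w' - G w - pdiff G w (w' - w)) by ring.
  apply: le_trans (ler_normB _ _) _.
  apply: (@le_trans _ _ (C1 * `|w' - w| + C2 * (d1 + d1) * `|w' - w|)).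
    rewrite lerD//; apply: le_trans T _; rewrite expr2 mulrA ler_wpM2r//.
    by rewrite ler_wpM2l.
  by rewrite -mulrDl ler_wpM2r// lerD2r lerDr addr_ge0.
- rewrite pE; apply: le_trans T _; rewrite ler_wpM2r ?exprn_ge0//.
  by rewrite -addrA addrAC lerDr !addr_ge0.
Qed.

(** The linear part of the half energy is the expression found in [is_derive_pairing]. So the
    pairing of two geodesics grows at the rate of half their energy gap, up to a quadratic error. *)
Lemma energy_taylor (p : V) (B : R) : U p -> 0 <= B ->
  exists2 C : R, 0 <= C & exists2 d : R, 0 < d & forall (w w' q q' : V) (b : R),
    `|w - p| < d -> `|w' - p| < d -> `|q| <= B -> `|q'| <= B ->
    `|w' - w| <= b -> `|q' - q| <= b ->
    `|2^-1 * (bil (g w') q' q' - bil (g w) q q)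
      - (2^-1 * tri (dmetric w) (w' - w) q q + bil (g w) (q' - q) q)| <= C * b ^+ 2.
Proof.
move=> Up B0.
have [d' d'0 dU] := open_ball U_open Up.
have [C C0 [d d0 H]] := @uniform_consts _ (fun ij C d => forall w w',
    `|w - p| < d -> `|w' - p| < d ->
    [/\ `|g w ij.1 ij.2| <= C,
      `|\sum_l dmetric w l ij.1 ij.2 * (w' - w) 0 l| <= C * `|w' - w| &
      `|g w' ij.1 ij.2 - g w ij.1 ij.2
        - \sum_l dmetric w l ij.1 ij.2 * (w' - w) 0 l| <= C * `|w' - w| ^+ 2])
  (fun ij C C' d d' CC' dd' H w w' wd wd' =>
     let: And3 b c e := H w w' (lt_le_trans wd dd') (lt_le_trans wd' dd') in
     And3 (le_trans b CC') (le_trans c (ler_wpM2r (normr_ge0 _) CC'))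
       (le_trans e (ler_wpM2r (exprn_ge0 2 (normr_ge0 _)) CC')))
  (fun ij => metric_local_bounds ij Up).
pose N := n%:R ^+ 2 : R; have N0 : 0 <= N by rewrite exprn_ge0.
exists (C * N * (2^-1 * B ^+ 2 + B + B + 2^-1)).
  by rewrite !mulr_ge0// !addr_ge0// mulr_ge0// exprn_ge0.
exists (Num.min d d'); first by rewrite lt_min d0.
move=> w w' q q' b; rewrite !lt_min => /andP[wd /dU Uw] /andP[wd' _] qB q'B wb qb.
have b0 : 0 <= b by apply: le_trans wb.
(* [g w'] is split as [g w + D + E], with [D] of first order in [w' - w] and [E] of second order. *)
pose D := \matrix_(i, j) \sum_l dmetric w l i j * (w' - w) 0 l : 'M[R]_n.
pose E := g w' - g w - D.
have Dsym i j : D i j = D j i.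
  by rewrite !mxE; apply: eq_bigr => l _; rewrite (dmetric_sym Uw).
have bilDm (A A' : 'M[R]_n) x y : bil (A + A') x y = bil A x y + bil A' x y.
  rewrite /bil -big_split; apply: eq_bigr => i _; rewrite -big_split.
  by apply: eq_bigr => j _; rewrite !mxE /=; ring.
have Q1 : bil (g w') q' q' = bil E q' q' + bil D q' q' + bil (g w) q' q'.
  by rewrite -!bilDm /E subrK addrC subrKC.
have Q2 := bilBB q' q Dsym; have Q3 := bilBB q' q (g_sym Uw).
have -> : 2^-1 * (bil (g w') q' q' - bil (g w) q q)
      - (2^-1 * tri (dmetric w) (w' - w) q q + bil (g w) (q' - q) q) =
   2^-1 * bil E q' q' + bil D (q' - q) q + 2^-1 * bil D (q' - q) (q' - q)
     + 2^-1 * bil (g w) (q' - q) (q' - q).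
  rewrite tri_bil -/D.
  have -> : bil (g w') q' q' - bil (g w) q q =
     bil E q' q' + (bil D q' q' - bil D q q) + bil D q q + (bil (g w) q' q' - bil (g w) q q).
    by rewrite Q1; ring.
  by rewrite Q2 Q3; field.
have bE : `|bil E q' q'| <= C * b ^+ 2 * B * B * N.
  apply: (@le_trans _ _ (C * b ^+ 2 * `|q'| * `|q'| * N)).
    apply: norm_bil_le => i j; have [_ _] := H (i, j) w w' wd wd'.
    rewrite !mxE /= => /le_trans; apply; rewrite ler_wpM2l//.
    by rewrite lerXn2r ?nnegrE.
  by rewrite ler_wpM2r// ler_pM ?mulr_ge0 ?exprn_ge0// ler_wpM2l ?mulr_ge0 ?exprn_ge0.
have Db i j : `|D i j| <= C * b.
  have [_ + _] := H (i, j) w w' wd wd'.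
  by rewrite !mxE /= => /le_trans; apply; rewrite ler_wpM2l.
have bD1 : `|bil D (q' - q) q| <= C * b * b * B * N.
  apply: (le_trans (norm_bil_le _ _ Db)).
  by rewrite ler_wpM2r// ler_pM ?mulr_ge0// ler_wpM2l ?mulr_ge0.
have qq : `|q' - q| <= B + B by rewrite (le_trans (ler_normB _ _))// lerD.
have bD2 : `|bil D (q' - q) (q' - q)| <= C * b * b * (B + B) * N.
  apply: (le_trans (norm_bil_le _ _ Db)).
  by rewrite ler_wpM2r// ler_pM ?mulr_ge0// ler_wpM2l ?mulr_ge0.
have bG : `|bil (g w) (q' - q) (q' - q)| <= C * b * b * N.
  apply: (@le_trans _ _ (C * `|q' - q| * `|q' - q| * N)).
    by apply: norm_bil_le => i j; have [+ _ _] := H (i, j) w w' wd wd'.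
  by rewrite ler_wpM2r// ler_pM ?mulr_ge0// ler_wpM2l.
apply: le_trans (ler_normD _ _) _; rewrite normrM (@ger0_norm _ 2^-1)//.
have A1 := ler_normD (2^-1 * bil E q' q' + bil D (q' - q) q) (2^-1 * bil D (q' - q) (q' - q)).
have A2 := ler_normD (2^-1 * bil E q' q') (bil D (q' - q) q).
rewrite !normrM (@ger0_norm _ 2^-1)// in A1 A2.
have -> : C * N * (2^-1 * B ^+ 2 + B + B + 2^-1) * b ^+ 2 =
  2^-1 * (C * b ^+ 2 * B * B * N) + C * b * b * B * N + 2^-1 * (C * b * b * (B + B) * N)
   + 2^-1 * (C * b * b * N) by field.
by lra.
Qed.

End Metric.

(** * Real induction *)

Section RealInduction.
Context {R : realType}.

(** If [P] failed somewhere, it would still hold at the infimum of its counterexamples, by the last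
    hypothesis, and then just after it, by the one before: a contradiction. *)
Lemma real_induction (a b : R) (P : R -> Prop) : P a ->
  (forall t, a <= t -> t < b -> P t ->
     exists2 e, 0 < e & forall s, t < s -> s < t + e -> s <= b -> P s) ->
  (forall t, a < t -> t <= b -> (forall s, a <= s -> s < t -> P s) -> P t) ->
  forall t, a <= t -> t <= b -> P t.
Proof.
move=> Pa Popen Pclosed t at_ tb; apply: contrapT => nPt.
pose B : set R := [set s | [/\ a <= s, s <= b & ~ P s]].
have Bt : B t by [].
have Binf : has_inf B by split; [exists t|exists a => s []].
have am : a <= inf B by apply: lb_le_inf; [exists t|move=> s []].
have Pm s : a <= s -> s < inf B -> P s.
  move=> as_ sm; apply: contrapT => nPs.
  have [sb|bs] := leP s b.
    have /(ge_inf Binf.2) : B s by [].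
    by rewrite leNgt sm.
  have : inf B <= t by apply: (ge_inf Binf.2).
  by move=> mt; have := lt_le_trans bs (ltW (lt_le_trans sm mt)); rewrite ltNge tb.
have mt : inf B <= t by apply: (ge_inf Binf.2).
have Pinf : P (inf B).
  have [<- //|am'] := eqVneq a (inf B).
  by apply: Pclosed => //; rewrite ?lt_neqAle ?am' ?am// (le_trans mt).
have mt' : inf B < t.
  by rewrite lt_neqAle mt andbT; apply/eqP => E; apply: nPt; rewrite -E.
have [e e0 He] := Popen _ am (lt_le_trans mt' tb) Pinf.
have [s [as_ sb nPs] se] := inf_adherent e0 Binf.
have : inf B <= s by apply: (ge_inf Binf.2).
by rewrite le_eqVlt => /predU1P[E|ms]; apply: nPs; [rewrite -E|exact: He].
Qed.

Lemma closed_left_limit (T : topologicalType) (A : set T) (h : R -> T) (a t : R) :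
  closed A -> {for t, continuous h} -> a < t ->
  (forall s, a <= s -> s < t -> A (h s)) -> A (h t).
Proof.
move=> cA ch at_ H; apply: (@closed_cvg _ _ (t^'-) _ h A cA _ (h t)); last first.
  exact: cvg_at_left_filter.
near=> s; apply: H; near: s; last exact: nbhs_left_lt.
exact: nbhs_left_ge.
Unshelve. all: by end_near. Qed.

End RealInduction.

(** * Lipschitz dependence for second-order differential equations *)

Section OdeStability.
Context {R : realType} {n : nat}.
Local Notation V := 'rV[R]_n.
Variables (G : V * V -> V) (z0 : V * V) (r L : R).
Hypothesis L_ge1 : 1 <= L.
Hypothesis G_lip : forall k z z', `|z - z0| < r -> `|z' - z0| < r ->
  `|G z 0 k - G z' 0 k| <= L * `|z - z'|.

(** A short-time form of the Gronwall inequality: with [(t1 - t0) * L <= 2^-1], the maximum [D] of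
    the gap over the interval satisfies [D <= delta + D / 2]. Thanks to [L_ge1], the constant [L]
    also serves for the positions, whose derivatives are the velocities. *)
Lemma ode_close (t0 t1 delta : R) (u v du dv : R -> V) : t0 <= t1 ->
  (t1 - t0) * L <= 2^-1 ->
  (forall t, t0 <= t -> t <= t1 -> is_derive t 1 u (du t) /\ is_derive t 1 v (dv t)) ->
  (forall t, t0 <= t -> t <= t1 ->
     is_derive t 1 du (G (u t, du t)) /\ is_derive t 1 dv (G (v t, dv t))) ->
  (forall t, t0 <= t -> t <= t1 ->
     `|(u t, du t) - z0| < r /\ `|(v t, dv t) - z0| < r) ->
  `|v t0 - u t0| <= delta -> `|dv t0 - du t0| <= delta ->
  forall t, t0 <= t -> t <= t1 ->
    `|v t - u t| <= 2 * delta /\ `|dv t - du t| <= 2 * delta.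
Proof.
move=> t01 tL Hu Hdu Hr d0 d0'.
pose m t := Num.max `|v t - u t| `|dv t - du t|.
have [|ts tsI tsM] := @EVT_max R m t0 t1 t01.
  apply: continuous_in_subspaceT => t; rewrite inE/= in_itv/= => /andP[t0t tt1].
  have [/is_derive_continuous cu /is_derive_continuous cv] := Hu t t0t tt1.
  have [/is_derive_continuous cdu /is_derive_continuous cdv] := Hdu t t0t tt1.
  apply: (@continuous_max _ _ (fun t => `|v t - u t|) (fun t => `|dv t - du t|)).
    exact: (@cvg_norm _ _ _ _ _ _ _ (continuousB cv cu)).
  exact: (@cvg_norm _ _ _ _ _ _ _ (continuousB cdv cdu)).
set D := m ts in tsM.
have D0 : 0 <= D by rewrite le_max normr_ge0.
have bound (f f0 : R -> V) (df df0 : R -> V) : 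
  (forall t, t0 <= t -> t <= t1 -> is_derive t 1 f (df t) /\ is_derive t 1 f0 (df0 t)) ->
  (forall t i, t0 <= t -> t <= t1 -> `|df t 0 i - df0 t 0 i| <= L * D) ->
  `|f t0 - f0 t0| <= delta -> forall t, t0 <= t -> t <= t1 -> `|f t - f0 t| <= delta + D / 2.
  move=> Hf Hdf fd t t0t tt1; apply: rV_norm_le.
    by rewrite addr_ge0 ?divr_ge0// (le_trans _ fd).
  move=> i; pose h s := f s 0 i - f0 s 0 i.
  have hD s : t0 <= s -> s <= t1 -> is_derive s 1 h (df s 0 i - df0 s 0 i).
    move=> s0 s1; have [/is_derive_rV/(_ i) A /is_derive_rV/(_ i) B] := Hf s s0 s1.
    exact: is_deriveB.
  have [||c] := @MVT_segment R h (fun s => df s 0 i - df0 s 0 i) t0 t t0t.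
  - move=> x; rewrite in_itv/= => /andP[x0 x1]; apply: hD; first exact: ltW.
    by rewrite (le_trans (ltW x1)).
  - apply: derivable_within_continuous => x; rewrite in_itv/= => /andP[x0 x1].
    by have [] := hD x x0 (le_trans x1 tt1).
  rewrite in_itv/= => /andP[c0 c1] E.
  have -> : (f t - f0 t) 0 i = h t0 + (h t - h t0).
    by rewrite [RHS]addrC subrK !mxE.
  apply: le_trans (ler_normD _ _) _; apply: lerD.
    by apply: le_trans fd; have := coord_le_norm (f t0 - f0 t0) i; rewrite !mxE.
  rewrite E normrM (ger0_norm (_ : 0 <= t - t0)) ?subr_ge0//.
  apply: (@le_trans _ _ (L * D * (t1 - t0))).
    apply: ler_pM => //; first by rewrite subr_ge0.
      by apply: Hdf => //; exact: le_trans tt1.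
    by rewrite lerD2r.
  have -> : L * D * (t1 - t0) = (t1 - t0) * L * D by ring.
  by rewrite mulrC ler_wpM2l.
have mD t : t0 <= t -> t <= t1 -> m t <= D.
  by move=> a b; apply: tsM; rewrite in_itv/= a.
have Lm t : t0 <= t -> t <= t1 -> L * m t <= L * D.
  by move=> a b; rewrite ler_wpM2l ?mD// (le_trans _ L_ge1).
have B1 t : t0 <= t -> t <= t1 -> `|v t - u t| <= delta + D / 2.
  apply: (bound v u dv du) => // [s s0 s1|s i s0 s1]; first by have [] := Hu s s0 s1.
  apply: (@le_trans _ _ (m s)); last first.
    by rewrite (le_trans _ (Lm s s0 s1))// ler_peMl// le_max normr_ge0.
  rewrite le_max; apply/orP; right.
  by have := coord_le_norm (dv s - du s) i; rewrite !mxE.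
have B2 t : t0 <= t -> t <= t1 -> `|dv t - du t| <= delta + D / 2.
  apply: (bound dv du (fun s => G (v s, dv s)) (fun s => G (u s, du s))) => //.
    by move=> s s0 s1; have [] := Hdu s s0 s1.
  move=> s i s0 s1; have [ru rv] := Hr s s0 s1.
  by apply: le_trans (G_lip i rv ru) (Lm s s0 s1).
have D2 : D <= 2 * delta.
  move: tsI; rewrite in_itv/= => /andP[ts0 ts1].
  have : D <= delta + D / 2 by rewrite ge_max B1// B2.
  by move=> ?; lra.
move=> t a b; have := mD t a b; rewrite ge_max => /andP[x y].
by split; apply: le_trans D2.
Qed.

End OdeStability.

Lemma near_eq_is_diff (R : realType) (V W : normedModType R) (f g df : V -> W) x :
  (\forall w \near x, f w = g w) -> is_diff x f df -> is_diff x g df.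
Proof.
move=> fg [fd <-].
have H : is_diff x g ('d f x).
  apply: is_diff_of; first exact: diff_continuous.
  move=> e e0; have [d1 d10 H1] := (near_norm _ _).1 fg.
  have /diff_locally/eqaddoP/(_ e e0) H2 := fd.
  have /near_norm[d2 d20 H3] : \forall v \near (0 : V), `|(f \o shift x - (cst (f x) + 'd f x)) v| <= e * `|v|.
    exact: H2.
  exists (Num.min d1 d2); first by rewrite lt_min d10.
  move=> v; rewrite lt_min => /andP[vd1 vd2].
  have := H3 v; rewrite subr0 => /(_ vd2).
  have -> : (f \o shift x - (cst (f x) + 'd f x)) v = f (v + x) - (f x + 'd f x v) by [].
  rewrite opprD addrA [v + x]addrC H1 ?H1// ?subrr ?normr0//.
  by rewrite [x + v]addrC addrK.
exact: H.
Qed.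

(** * Charts *)

Section Charts.
Context {R : realType} {n : nat} {M : smooth_manifold R n}.
Implicit Types (c : chart M) (x : M) (v : 'rV[R]_n).

Definition overlap c c' : set 'rV[R]_n := coord c @` (chart_dom c `&` chart_dom c').

Definition transition c c' x : {linear 'rV[R]_n -> 'rV[R]_n} :=
  'd (coord c' \o param c) (coord c x).

Lemma chart_near c x : chart_dom c x -> \forall u \near coord c x, chart_image c u.
Proof.
move=> cx; apply: open_nbhs_nbhs; split; first exact: chart_image_open.
by exists x.
Qed.

Lemma param_near c x (A : set M) : chart_dom c x -> open A -> A x ->
  \forall u \near coord c x, A (param c u).
Proof.
move=> cx oA Ax.
have : {for coord c x, continuous (param c)} by apply: param_continuous; exists x.
move=> /(_ A); rewrite coordK//; apply.
exact: open_nbhs_nbhs.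
Qed.

Lemma param_dom c u : chart_image c u -> chart_dom c (param c u).
Proof. by case=> x cx <-; rewrite coordK. Qed.

Lemma paramK c u : chart_image c u -> coord c (param c u) = u.
Proof. by case=> x cx <-; rewrite coordK. Qed.

Lemma overlapP c c' u : overlap c c' u <-> chart_image c u /\ chart_dom c' (param c u).
Proof.
split=> [[x [cx cx'] <-]|[[x cx <-]]]; last by rewrite coordK// => cx'; exists x.
by rewrite coordK//; split=> //; exists x.
Qed.

Lemma overlap_open c c' : open (overlap c c').
Proof.
rewrite openE => _ [x [cx cx'] <-].
have H1 := chart_near cx; have H2 := param_near cx (chart_dom_open c') cx'.
by near=> u; apply/overlapP; split; near: u.
Unshelve. all: by end_near. Qed.

Lemma transition_is_diff c c' x : chart_dom c x -> chart_dom c' x ->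
  is_diff (coord c x) (coord c' \o param c) (transition c c' x).
Proof.
move=> cx cx'.
have Ox : overlap c c' (coord c x) by exists x.
have [|d _] := @differentiable_rV R n n (coord c' \o param c) (coord c x); last exact: differentiableP.
move=> k; have sk := smooth_on_coord k (@overlap_open c c') (@transition_smooth _ _ M c c').
by have [] := smooth_is_diff (@overlap_open c c') sk Ox.
Qed.

Lemma transition_id c x v : chart_dom c x -> transition c c x v = v.
Proof.
move=> cx; have [_ E] : is_diff (coord c x) (coord c \o param c) id.
  apply: near_eq_is_diff (is_diff_id _).
  by apply: filterS (chart_near cx) => u cu /=; rewrite paramK.
exact: (congr1 (fun h => h v) E).
Qed.

Lemma transition_comp c c' c'' x v :
  chart_dom c x -> chart_dom c' x -> chart_dom c'' x ->
  transition c' c'' x (transition c c' x v) = transition c c'' x v.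
Proof.
move=> cx cx' cx''.
have D1 := transition_is_diff cx cx'.
have D2 : is_diff ((coord c' \o param c) (coord c x)) (coord c'' \o param c') (transition c' c'' x).
  have -> : (coord c' \o param c) (coord c x) = coord c' x by rewrite /= coordK.
  exact: (transition_is_diff cx' cx'').
have D3 := is_diff_comp D1 D2.
have [_ E] : is_diff (coord c x) (coord c'' \o param c) (transition c' c'' x \o transition c c' x).
  apply: near_eq_is_diff D3.
  have H2 := param_near cx (chart_dom_open c') cx'.
  by apply: filterS H2 => u cu /=; rewrite coordK.
exact: (esym (congr1 (fun h => h v) E)).
Qed.

Lemma to_chartE c x (w : tangent x) : to_chart c w = transition (chart_at x) c x w.
Proof. by []. Qed.

Lemma of_chartE c x v : of_chart c x v = transition c (chart_at x) x v.
Proof. by []. Qed.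

Lemma to_chartK c x (w : tangent x) : chart_dom c x -> of_chart c x (to_chart c w) = w.
Proof.
move=> cx; rewrite of_chartE to_chartE transition_comp//; try exact: chart_at_dom.
by rewrite transition_id//; exact: chart_at_dom.
Qed.

Lemma of_chartK c x v : chart_dom c x -> to_chart c (of_chart c x v) = v.
Proof.
move=> cx; rewrite of_chartE to_chartE transition_comp//; last exact: chart_at_dom.
by rewrite transition_id.
Qed.

Lemma to_chart_at x (w : tangent x) : to_chart (chart_at x) w = w.
Proof. by rewrite to_chartE transition_id//; exact: chart_at_dom. Qed.

Lemma to_of_chart c c' x v : chart_dom c x -> chart_dom c' x ->
  to_chart c' (of_chart c x v) = transition c c' x v.
Proof. by move=> cx cx'; exact: (transition_comp v cx (chart_at_dom x) cx'). Qed.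

Lemma curve_near (gamma : R -> M) t c : {for t, continuous gamma} ->
  chart_dom c (gamma t) -> \forall s \near t, chart_dom c (gamma s).
Proof.
move=> gc cg; apply: (gc (chart_dom c)).
by apply: open_nbhs_nbhs; split => //; exact: chart_dom_open.
Qed.

Lemma is_derive_chart (gamma : R -> M) t c c' v : {for t, continuous gamma} ->
  chart_dom c (gamma t) -> chart_dom c' (gamma t) ->
  is_derive t 1 (coord c \o gamma) v ->
  is_derive t 1 (coord c' \o gamma) (transition c c' (gamma t) v).
Proof.
move=> gc cg cg' dg.
have [D E] := transition_is_diff cg cg'.
have := is_derive_comp_diff D dg; rewrite E; apply: near_eq_is_derive.
by apply: filterS (curve_near gc cg) => s cs /=; rewrite coordK.
Qed.

Lemma velocity_chart (gamma : R -> M) t c v : {for t, continuous gamma} ->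
  chart_dom c (gamma t) -> is_derive t 1 (coord c \o gamma) v ->
  to_chart c (velocity gamma t) = v.
Proof.
move=> gc cg dg; have [_ E] := is_derive_chart gc cg (chart_at_dom (gamma t)) dg.
by rewrite /velocity derive1E E of_chartK.
Qed.

Lemma smooth_fun_is_diff (f : M -> R) c x : smooth_fun f -> chart_dom c x ->
  is_diff (coord c x) (f \o param c) (pdiff (f \o param c) (coord c x)).
Proof.
move=> sf cx; apply: (smooth_is_diff (@chart_image_open _ _ M c) (sf c)).
by exists x.
Qed.

Lemma dfun_chart (f : M -> R) c x (w : tangent x) : smooth_fun f -> chart_dom c x ->
  dfun f w = pdiff (f \o param c) (coord c x) (to_chart c w).
Proof.
move=> sf cx; have cx0 := chart_at_dom x.
have D1 := transition_is_diff cx0 cx.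
have D2 : is_diff ((coord c \o param (chart_at x)) (coord (chart_at x) x)) (f \o param c)
    (pdiff (f \o param c) (coord c x)).
  have -> : (coord c \o param (chart_at x)) (coord (chart_at x) x) = coord c x by rewrite /= coordK.
  exact: (smooth_fun_is_diff sf cx).
have [_ E] : is_diff (coord (chart_at x) x) (f \o param (chart_at x))
    (pdiff (f \o param c) (coord c x) \o transition (chart_at x) c x).
  apply: near_eq_is_diff (is_diff_comp D1 D2).
  have H2 := param_near cx0 (chart_dom_open c) cx.
  by apply: filterS H2 => u cu /=; rewrite coordK.
by rewrite /dfun E.
Qed.

Lemma is_derive_along (f : M -> R) (gamma : R -> M) t c v : smooth_fun f ->
  {for t, continuous gamma} -> chart_dom c (gamma t) ->
  is_derive t 1 (coord c \o gamma) v ->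
  is_derive t 1 (f \o gamma) (pdiff (f \o param c) (coord c (gamma t)) v).
Proof.
move=> sf gc cg dg; have [D E] := smooth_fun_is_diff sf cg.
have := is_derive_comp_diff D dg; rewrite E; apply: near_eq_is_derive.
by apply: filterS (curve_near gc cg) => s cs /=; rewrite coordK.
Qed.

End Charts.

Lemma bil_mulmx (R : comNzRingType) n (A : 'M[R]_n) (a b : 'rV[R]_n) :
  bil A a b = (a *m A *m b^T) 0 0.
Proof.
rewrite /bil mxE exchange_big; apply: eq_bigr => j _; rewrite !mxE mulr_suml.
by apply: eq_bigr => i _; ring.
Qed.

(** * The inner product and its Gram matrix *)

Section RiemannianCharts.
Context {R : realType} {n : nat} {M : riemannian_manifold R n}.
Implicit Types (c : chart M) (x : M).

Lemma innerDl x (u v w : tangent x) : inner (u + v) w = inner u w + inner v w.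
Proof. by have := inner_linear 1 u v w; rewrite scale1r mul1r. Qed.

Lemma inner0l x (w : tangent x) : inner 0 w = 0.
Proof. by apply: (addrI (inner 0 w)); rewrite -innerDl !addr0. Qed.

Lemma innerZl x a (u w : tangent x) : inner (a *: u) w = a * inner u w.
Proof. by have := inner_linear a u 0 w; rewrite addr0 inner0l addr0. Qed.

Lemma innerNl x (u w : tangent x) : inner (- u) w = - inner u w.
Proof. by rewrite -scaleN1r innerZl mulN1r. Qed.

Lemma innerDr x (u v w : tangent x) : inner w (u + v) = inner w u + inner w v.
Proof. by rewrite inner_sym innerDl !(inner_sym w). Qed.

Lemma innerZr x a (u w : tangent x) : inner u (a *: w) = a * inner u w.
Proof. by rewrite inner_sym innerZl inner_sym. Qed.

Lemma innerNr x (u w : tangent x) : inner u (- w) = - inner u w.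
Proof. by rewrite inner_sym innerNl inner_sym. Qed.

Lemma inner0r x (u : tangent x) : inner u 0 = 0.
Proof. by rewrite inner_sym inner0l. Qed.

Lemma inner_ge0 x (u : tangent x) : 0 <= inner u u.
Proof. by have [->|/inner_gt0/ltW//] := eqVneq u 0; rewrite inner0l. Qed.

Lemma inner_suml x (I : Type) (r : seq I) (F : I -> tangent x) w :
  inner (\sum_(i <- r) F i) w = \sum_(i <- r) inner (F i) w.
Proof.
elim: r => [|i r IH]; first by rewrite !big_nil inner0l.
by rewrite !big_cons innerDl IH.
Qed.

Lemma rnorm_ge0 x (u : tangent x) : 0 <= rnorm u.
Proof. exact: sqrtr_ge0. Qed.

Lemma sqr_rnorm x (u : tangent x) : rnorm u ^+ 2 = inner u u.
Proof. by rewrite sqr_sqrtr// inner_ge0. Qed.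

Lemma rnorm_eq0 x (u : tangent x) : rnorm u = 0 -> u = 0.
Proof.
move=> u0; apply: contrapT => /eqP/inner_gt0.
by rewrite -sqr_rnorm u0 expr0n ltxx.
Qed.

Lemma cauchy_schwarz x (u v : tangent x) : `|inner u v| <= rnorm u * rnorm v.
Proof.
have [->|v0] := eqVneq v 0.
  by rewrite inner0r normr0 mulr_ge0// rnorm_ge0.
have vv := inner_gt0 v0.
rewrite -(ler_pXn2r (_ : 0 < 2)%N)// ?nnegrE ?mulr_ge0 ?rnorm_ge0//.
rewrite exprMn !sqr_rnorm real_normK ?num_real//.
(* This is [inner v v] times the component of [u] orthogonal to [v], which avoids a division. *)
have := inner_ge0 (inner v v *: u - inner u v *: v).
rewrite !(innerDl, innerDr, innerNl, innerNr, innerZl, innerZr) (inner_sym v u).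
set a := inner u u; set b := inner u v; set d := inner v v => H.
have : 0 <= d * (a * d - b ^+ 2) by apply: le_trans H _; rewrite le_eqVlt; apply/orP; left; apply/eqP; ring.
by rewrite pmulr_rge0// subr_ge0.
Qed.

Lemma rnormZ x a (u : tangent x) : rnorm (a *: u) = `|a| * rnorm u.
Proof.
by rewrite /rnorm innerZl innerZr mulrA -expr2 sqrtrM ?sqr_ge0// sqrtr_sqr.
Qed.

Lemma rnormN x (u : tangent x) : rnorm (- u) = rnorm u.
Proof. by rewrite -scaleN1r rnormZ normrN1 mul1r. Qed.

Lemma rnormD x (u v : tangent x) : rnorm (u + v) <= rnorm u + rnorm v.
Proof.
rewrite -(ler_pXn2r (_ : 0 < 2)%N)// ?nnegrE ?addr_ge0 ?rnorm_ge0//.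
rewrite sqrrD !sqr_rnorm !(innerDl, innerDr) (inner_sym v u).
have := le_trans (ler_norm _) (cauchy_schwarz u v).
by move=> ?; rewrite mulr2n; lra.
Qed.

Lemma coord_vect_sum c x (w : tangent x) : chart_dom c x ->
  w = \sum_i to_chart c w 0 i *: coord_vect c x i.
Proof.
move=> cx; rewrite -[LHS](to_chartK w cx) {1}[to_chart c w]rV_sum_delta.
by rewrite /of_chart linear_sum; apply: eq_bigr => i _; rewrite linearZ.
Qed.

Lemma gram_coord c x i j : chart_dom c x ->
  gram c (coord c x) i j = inner (coord_vect c x i) (coord_vect c x j).
Proof. by move=> cx; rewrite mxE coordK. Qed.

Lemma inner_chart c x (v w : tangent x) : chart_dom c x ->
  inner v w = bil (gram c (coord c x)) (to_chart c v) (to_chart c w).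
Proof.
move=> cx; rewrite {1}(coord_vect_sum v cx) inner_suml; apply: eq_bigr => i _.
rewrite {1}(coord_vect_sum w cx) inner_sym inner_suml; apply: eq_bigr => j _.
by rewrite innerZl innerZr gram_coord// inner_sym; ring.
Qed.

Lemma gram_smooth c i j : smooth_on (chart_image c) (fun u => gram c u i j : R).
Proof.
have -> : (fun u => gram c u i j) =
    (fun u => inner (coord_vect c (param c u) i) (coord_vect c (param c u) j)).
  by apply/funext => u; rewrite mxE.
exact: inner_smooth.
Qed.

Lemma gram_sym c u i j : gram c u i j = gram c u j i.
Proof. by rewrite !mxE inner_sym. Qed.

(** A nonzero row in the kernel would give the components of a nonzero tangent vector of length
    0. *)
Lemma gram_unit c u : chart_image c u -> gram c u \in unitmx.
Proof.
case=> x cx <-; rewrite -row_free_unit -kermx_eq0; apply/negPn/negP => /rowV0Pn[v].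
move=> /sub_kermxP vA v0.
have : 0 < inner (of_chart c x v) (of_chart c x v).
  apply: inner_gt0; apply: contra v0 => /eqP E.
  by rewrite -[v](of_chartK _ cx) E /to_chart linear0.
by rewrite (inner_chart _ _ cx) of_chartK// bil_mulmx vA mul0mx mxE ltxx.
Qed.

End RiemannianCharts.

Lemma is_derive_affine (R : realType) (W : normedModType R) (f : R -> W) (a b t : R) df :
  is_derive (a * t + b) 1 f df -> is_derive t 1 (fun s => f (a * s + b)) (a *: df).
Proof.
move=> [fd fE].
have gD : is_derive t 1 (fun s : R => a * s + b) a.
  have H := is_deriveD (is_deriveZ a (is_derive_id t (1 : R))) (is_derive_cst b t (1 : R)).
  by apply: (is_derive_eq H); rewrite addr0 [_ *: _]mulr1.
have fd' : differentiable f ((fun s : R => a * s + b) t) by apply/derivable1_diffP.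
have H := @is_derive_comp_diff R _ _ f (fun s : R => a * s + b) t a fd' gD.
apply: (is_derive_eq H).
by rewrite deriv1E// derive1E fE.
Qed.

Lemma closed_norm_le (R : realType) (V : normedModType R) (p : V) (r : R) :
  closed [set y | `|y - p| <= r].
Proof.
rewrite (_ : [set _ | _] = closed_ball_ Num.norm p r); first exact: closed_closed_ball_.
by apply/seteqP; split => y /=; rewrite /closed_ball_/= distrC.
Qed.

Lemma continuous_near_norm (R : realType) (V : normedModType R) (h : R -> V) t e :
  {for t, continuous h} -> 0 < e -> \forall s \near t, `|h s - h t| < e.
Proof. by move=> /cvgrPdist_lt/(_ _) H /H; apply: filterS => s; rewrite distrC. Qed.

Section NormTriangle.
Context {R : realType} {V : normedModType R}.

Lemma norm_tri_le (x y z : V) (a b c : R) :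
  `|x - y| <= a -> `|y - z| <= b -> a + b <= c -> `|x - z| <= c.
Proof.
move=> xy yz abc; rewrite -(subrKA y); apply: le_trans (ler_normD _ _) _.
by apply: le_trans abc; exact: lerD.
Qed.

Lemma norm_tri_lt (x y z : V) (a b c : R) :
  `|x - y| <= a -> `|y - z| < b -> a + b <= c -> `|x - z| < c.
Proof.
move=> xy yz abc; rewrite -(subrKA y); apply: le_lt_trans (ler_normD _ _) _.
by apply: lt_le_trans abc; exact: ler_ltD.
Qed.

Lemma pair_norm_lt (u v p q : V) (r : R) : `|u - p| < r -> `|v - q| < r ->
  `|(u, v) - (p, q)| < r.
Proof. by move=> up vq; rewrite [ltLHS]/Num.norm/= gt_max up vq. Qed.

End NormTriangle.

(** * Stability of geodesics *)

Section Geodesics.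
Context {R : realType} {n : nat} {M : riemannian_manifold R n}.
Local Notation V := 'rV[R]_n.
Implicit Types (c : chart M) (x : M) (gamma sigma : R -> M).

(** Position and velocity read in the chart [c]; the values are meaningful only at times when
    [gamma] is in [chart_dom c]. *)
Definition lpos c gamma : R -> V := coord c \o gamma.
Definition lvel c gamma : R -> V := (coord c \o gamma)^`().
Definition geo_field c (z : V * V) : V := accel (gram c) z.1 z.2.

Lemma geodesic_continuous gamma t : geodesic gamma -> {for t, continuous gamma}.
Proof. by case=> gc _; exact: gc. Qed.

Lemma lpos_image c gamma t : chart_dom c (gamma t) -> chart_image c (lpos c gamma t).
Proof. by exists (gamma t). Qed.

Lemma geodesic_lpos c gamma t : geodesic gamma -> chart_dom c (gamma t) ->
  is_derive t 1 (lpos c gamma) (lvel c gamma t).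
Proof.
move=> [_ H] cg; have [D _ _] := H c t cg.
by split; [exact: D|rewrite /lvel derive1E].
Qed.

Lemma geodesic_lvel c gamma t : geodesic gamma -> chart_dom c (gamma t) ->
  is_derive t 1 (lvel c gamma) (geo_field c (lpos c gamma t, lvel c gamma t)).
Proof.
move=> [_ H] cg; have [_ D E] := H c t cg.
split; first exact: D.
rewrite -derive1E; apply/rowP => k; rewrite E mxE.
by [].
Qed.

Lemma to_chart_velocity c gamma t : geodesic gamma -> chart_dom c (gamma t) ->
  to_chart c (velocity gamma t) = lvel c gamma t.
Proof.
move=> gg cg; exact: (velocity_chart (geodesic_continuous gg) cg (geodesic_lpos gg cg)).
Qed.

Definition energy gamma t : R := inner (velocity gamma t) (velocity gamma t).

Lemma energy_chart c gamma t : geodesic gamma -> chart_dom c (gamma t) ->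
  energy gamma t = bil (gram c (lpos c gamma t)) (lvel c gamma t) (lvel c gamma t).
Proof. by move=> gg cg; rewrite /energy (inner_chart _ _ cg) to_chart_velocity. Qed.

Lemma energy_const gamma s t : geodesic gamma -> energy gamma s = energy gamma t.
Proof.
move=> gg; apply: is_derive_0_is_cst => r.
have cg := chart_at_dom (gamma r); set c := chart_at _ in cg.
have D := is_derive_energy (@chart_image_open _ _ M c) (@gram_smooth _ _ M c)
  (fun u _ i j => gram_sym c u i j) (fun u => @gram_unit _ _ M c u) (lpos_image cg)
  (geodesic_lpos gg cg) (geodesic_lvel gg cg).
apply: near_eq_is_derive D.
apply: filterS (curve_near (geodesic_continuous gg) cg) => s' cs.
by rewrite (energy_chart gg cs).
Qed.

Definition chart_close c gamma sigma t b :=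
  [/\ chart_dom c (sigma t), `|lpos c sigma t - lpos c gamma t| <= b
    & `|lvel c sigma t - lvel c gamma t| <= b].

(** The coordinate difference stands for the variation field of the first variation formula. It
    depends on the chart, but only to second order in the gap, by [close_chart]. *)
Definition pairing c gamma sigma t : R :=
  bil (gram c (lpos c gamma t)) (lpos c sigma t - lpos c gamma t) (lvel c gamma t).

Lemma pairing_inner c gamma sigma t : geodesic gamma -> chart_dom c (gamma t) ->
  pairing c gamma sigma t =
  inner (of_chart c (gamma t) (lpos c sigma t - lpos c gamma t)) (velocity gamma t).
Proof.
by move=> gg cg; rewrite (inner_chart _ _ cg) (of_chartK _ cg) (to_chart_velocity gg cg).
Qed.

(** Taken at time 0, but the same at all times for geodesics; to first order it is the growth rate
    of [pairing]. *)
Definition half_gap gamma sigma : R := 2^-1 * (energy sigma 0 - energy gamma 0).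

Lemma half_gap_chart c gamma sigma t : geodesic gamma -> geodesic sigma ->
  chart_dom c (gamma t) -> chart_dom c (sigma t) ->
  half_gap gamma sigma =
  2^-1 * (bil (gram c (lpos c sigma t)) (lvel c sigma t) (lvel c sigma t)
          - bil (gram c (lpos c gamma t)) (lvel c gamma t) (lvel c gamma t)).
Proof.
move=> gg gs cg cs.
by rewrite /half_gap (energy_const 0 t gs) (energy_const 0 t gg) (energy_chart gs cs) (energy_chart gg cg).
Qed.

(* A geodesic which starts close to gamma cannot leave the chart, because the
   part of the chart where it is trapped is compact, hence closed in M. *)
Lemma trapped c gamma sigma (p q : V) (r L t0 t1 b : R) :
  geodesic gamma -> geodesic sigma -> 1 <= L ->
  (forall k z z', `|z - (p, q)| < r -> `|z' - (p, q)| < r ->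
    `|geo_field c z 0 k - geo_field c z' 0 k| <= L * `|z - z'|) ->
  (forall u, `|u - p| < r -> chart_image c u) ->
  t0 <= t1 -> (t1 - t0) * L <= 2^-1 ->
  (forall t, t0 <= t -> t <= t1 -> [/\ chart_dom c (gamma t),
     `|lpos c gamma t - p| < r / 4 & `|lvel c gamma t - q| < r / 4]) ->
  b < r / 8 -> chart_close c gamma sigma t0 b ->
  forall t, t0 <= t -> t <= t1 -> chart_close c gamma sigma t (2 * b).
Proof.
move=> gg gs L1 lip im t01 tL near_gamma br [cs0 ps0 vs0].
have b0 : 0 <= b by apply: le_trans ps0.
have [r0 r1 r2 r3 r4] : [/\ 0 < r, r / 4 <= r, 2 * b + r / 4 <= r / 2, b + r / 4 <= r & r / 2 < r].
  by clear -br b0; split; lra.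
pose P t := [/\ chart_dom c (sigma t), `|lpos c sigma t - p| < r
  & `|lvel c sigma t - q| < r].
have ode t2 : t0 <= t2 -> t2 <= t1 -> (forall t, t0 <= t -> t <= t2 -> P t) ->
    forall t, t0 <= t -> t <= t2 -> `|lpos c sigma t - lpos c gamma t| <= 2 * b
      /\ `|lvel c sigma t - lvel c gamma t| <= 2 * b.
  move=> t02 t21 HP.
  have tL2 : (t2 - t0) * L <= 2^-1.
    by apply: le_trans tL; rewrite ler_wpM2r ?lerD2r// (le_trans _ L1).
  apply: (ode_close L1 lip t02 tL2 _ _ _ ps0 vs0).
  - move=> t a e; have [cs _ _] := HP t a e; have [cg _ _] := near_gamma t a (le_trans e t21).
    by split; exact: geodesic_lpos.
  - move=> t a e; have [cs _ _] := HP t a e; have [cg _ _] := near_gamma t a (le_trans e t21).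
    by split; exact: geodesic_lvel.
  - move=> t a e; have [cs ps vs] := HP t a e.
    have [cg pg vg] := near_gamma t a (le_trans e t21).
    by split; apply: pair_norm_lt; [exact: lt_le_trans pg r1|exact: lt_le_trans vg r1|exact: ps|exact: vs].
have ode_half t2 : t0 <= t2 -> t2 <= t1 -> (forall t, t0 <= t -> t <= t2 -> P t) ->
    `|lpos c sigma t2 - p| <= r / 2 /\ `|lvel c sigma t2 - q| <= r / 2.
  move=> t02 t21 HP; have [H1 H2] := ode t2 t02 t21 HP t2 t02 (lexx _).
  have [cg pg vg] := near_gamma t2 t02 t21.
  by split; [exact: norm_tri_le H1 (ltW pg) r2|exact: norm_tri_le H2 (ltW vg) r2].
(* Bootstrap: as long as [sigma] stays within [r], the stability estimate confines it to [r / 2].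
   The latter bound passes to limits, and the strict one persists for a short time. *)
have HP : forall t, t0 <= t -> t <= t1 -> P t.
  apply: real_induction.
  - have [cg pg vg] := near_gamma t0 (lexx _) t01.
    by split; [exact: cs0|exact: norm_tri_lt ps0 pg r3|exact: norm_tri_lt vs0 vg r3].
  - move=> t t0t tt1 [cs ps vs].
    have N1 := curve_near (geodesic_continuous gs) cs.
    have e1 : 0 < r - `|lpos c sigma t - p| by rewrite subr_gt0.
    have e2 : 0 < r - `|lvel c sigma t - q| by rewrite subr_gt0.
    have N2 := continuous_near_norm (is_derive_continuous (geodesic_lpos gs cs)) e1.
    have N3 := continuous_near_norm (is_derive_continuous (geodesic_lvel gs cs)) e2.
    have : \forall s \near t, P s.
      near=> s; split; first by near: s.
        rewrite -(subrKA (lpos c sigma t)); apply: le_lt_trans (ler_normD _ _) _.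
        by rewrite -ltrBrDr; near: s.
      rewrite -(subrKA (lvel c sigma t)); apply: le_lt_trans (ler_normD _ _) _.
      by rewrite -ltrBrDr; near: s.
    move=> /near_norm[e e0 He]; apply: (ex_intro2 _ _ e e0) => s ts se _; apply: He.
    by rewrite gtr0_norm; [rewrite ltrBlDl|rewrite subr_gt0].
  - move=> t t0t tt1 HPs.
    have half s : t0 <= s -> s < t -> `|lpos c sigma s - p| <= r / 2 /\ `|lvel c sigma s - q| <= r / 2.
      move=> a e; apply: ode_half; [exact: a|exact: le_trans (ltW e) tt1|].
      by move=> s' a' e'; apply: HPs; [exact: a'|exact: le_lt_trans e' e].
    have cs : chart_dom c (sigma t).
      pose K := [set u : V | `|u - p| <= r / 2].
      have Kim u : K u -> chart_image c u by move=> Ku; exact: im (le_lt_trans Ku r4).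
      have cK : closed (param c @` K).
        apply: compact_closed; first exact: manifold_hausdorff.
        apply: continuous_compact.
          apply: continuous_in_subspaceT => u; rewrite inE => Ku.
          by apply: param_continuous; exact: Kim.
        apply: bounded_closed_compact; last exact: closed_norm_le.
        exists (`|p| + r / 2); split; first exact: num_real.
        move=> N HN u Ku; apply: le_trans (ltW HN).
        rewrite -[u](subrK p); apply: le_trans (ler_normD _ _) _.
        by rewrite addrC lerD2l.
      have [u Ku <-] : (param c @` K) (sigma t).
        apply: (closed_left_limit cK (geodesic_continuous gs) t0t) => s a e.
        exists (lpos c sigma s); first by have [] := half s a e.
        by have [cs _ _] := HPs s a e; rewrite /lpos/= coordK.
      by apply: param_dom; exact: Kim.
    have H1 := closed_left_limit (@closed_norm_le R V p (r / 2))
      (is_derive_continuous (geodesic_lpos gs cs)) t0t (fun s a e => proj1 (half s a e)).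
    have H2 := closed_left_limit (@closed_norm_le R V q (r / 2))
      (is_derive_continuous (geodesic_lvel gs cs)) t0t (fun s a e => proj2 (half s a e)).
    by split; [exact: cs|exact: le_lt_trans H1 r4|exact: le_lt_trans H2 r4].
move=> t a e; have [H1 H2] := ode t1 t01 (lexx _) HP t a e.
by have [cs _ _] := HP t a e.
Unshelve. all: by end_near. Qed.

(** By [energy_taylor], the derivative of the pairing differs from [half_gap] by a multiple of
    [b ^+ 2], and the mean value theorem integrates this. The constants are fixed before [sigma], so
    that a whole family of geodesics can be propagated at once. *)
Lemma local_step c gamma s : geodesic gamma -> chart_dom c (gamma s) ->
  exists2 e : R, 0 < e & exists2 rho : R, 0 < rho & exists2 C : R, 0 <= C &
  forall t0 t1, s - e < t0 -> t0 <= t1 -> t1 < s + e ->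
  [/\ chart_dom c (gamma t0), chart_dom c (gamma t1) &
  forall sigma b, geodesic sigma -> b < rho -> chart_close c gamma sigma t0 b ->
    chart_close c gamma sigma t1 (2 * b) /\
    `|pairing c gamma sigma t1 - pairing c gamma sigma t0
      - (t1 - t0) * half_gap gamma sigma| <= C * b ^+ 2].
Proof.
move=> gg cs.
set p := lpos c gamma s; set q := lvel c gamma s.
have pim : chart_image c p by exact: lpos_image.
have iop := @chart_image_open _ _ M c.
have gsm := @gram_smooth _ _ M c.
have gsy u (_ : chart_image c u) i j := gram_sym c u i j.
have gun u (H : chart_image c u) := gram_unit H.
have [L0 L00 [r1 r10 lip]] := loclip_family (fun k => loclip_accel iop gsm gun q k pim).
have [r2 r20 im] := open_ball iop pim.
have B0 : 0 <= `|q| + 1 by rewrite addr_ge0.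
have [C C0 [r3 r30 tay]] := energy_taylor iop gsm gsy pim B0.
have [r [r0 rr1 rr2 rr3 rle1]] : exists r : R, [/\ 0 < r, r <= r1, r <= r2, r <= r3 & r <= 1].
  exists (Num.min 1 (Num.min r1 (Num.min r2 r3))).
  by rewrite !lt_min !ge_min !lexx r10 r20 r30 ltr01 !orbT.
have r4 : 0 < r / 4 by rewrite divr_gt0.
have N1 := curve_near (geodesic_continuous gg) cs.
have N2 := continuous_near_norm (is_derive_continuous (geodesic_lpos gg cs)) r4.
have N3 := continuous_near_norm (is_derive_continuous (geodesic_lvel gg cs)) r4.
have [e1 e10 He1] : exists2 e, 0 < e & forall t, `|t - s| < e -> [/\ chart_dom c (gamma t),
     `|lpos c gamma t - p| < r / 4 & `|lvel c gamma t - q| < r / 4].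
  by apply/near_norm; near=> t; split; near: t.
pose L := L0 + 1; have L1 : 1 <= L by rewrite lerDr.
have Lp : 0 < L by rewrite ltr_wpDl.
(* Two times within [m] of [s] are at most [2 * m] apart, so [m * L <= 4^-1] yields the smallness
   required by [trapped]. *)
have [m [m0 me1 mL]] : exists m : R, [/\ 0 < m, m <= e1 & m * L <= 4^-1].
  exists (Num.min e1 (4 * L)^-1); split.
  - by rewrite lt_min e10 invr_gt0 mulr_gt0.
  - by rewrite ge_min lexx.
  - rewrite -ler_pdivlMr// -invfM ge_min; apply/orP; right.
    by rewrite lexx.
have [r1' r2' r3' r4'] : [/\ r / 4 <= r, forall b, b < r / 8 -> 2 * b + r / 4 <= r, r / 4 <= 1 & r / 4 < r].
  by clear -r0 rle1; split; first lra; [move=> b br; lra|lra|lra].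
exists m => //.
exists (r / 8); first by rewrite divr_gt0.
(* At intermediate times the gap is only known to be at most [2 * b], whence the error
   [C * (2 * b) ^+ 2] over a length of time at most 1. *)
exists (4 * C); first by rewrite mulr_ge0.
move=> t0 t1 st0 t01 t1s.
have in_e1 t : t0 <= t -> t <= t1 -> `|t - s| < e1.
  move=> a e; apply: lt_le_trans me1; rewrite ltr_norml; apply/andP; split.
    by rewrite ltrBrDl (lt_le_trans st0 a).
  by rewrite ltrBlDl (le_lt_trans e t1s).
have near_gamma t a e := He1 t (in_e1 t a e).
have t10 : t1 - t0 <= 2 * m by clear -st0 t1s; lra.
have tL : (t1 - t0) * L <= 2^-1.
  apply: (@le_trans _ _ (2 * m * L)); first by rewrite ler_wpM2r// ltW.
  by rewrite -mulrA; clear -mL; lra.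
have t1le : t1 - t0 <= 1.
  have : t1 - t0 <= (t1 - t0) * L by rewrite ler_peMr// subr_ge0.
  by clear -tL; lra.
have lip' k (z z' : V * V) : `|z - (p, q)| < r -> `|z' - (p, q)| < r ->
    `|geo_field c z 0 k - geo_field c z' 0 k| <= L * `|z - z'|.
  move=> zr z'r; apply: (@le_trans _ _ (L0 * `|z - z'|)).
    exact: lip (lt_le_trans zr rr1) (lt_le_trans z'r rr1).
  by rewrite ler_wpM2r// lerDl.
have im' (u : V) (H : `|u - p| < r) := im u (lt_le_trans H rr2).
split; [by have [] := near_gamma t0 (lexx _) t01|by have [] := near_gamma t1 t01 (lexx _)|].
move=> sigma b gs br cl.
have b0 : 0 <= b by have [_ H _] := cl; exact: le_trans H.
have tr := trapped gg gs L1 lip' im' t01 tL near_gamma br cl.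
split; first exact: tr.
pose D t := 2^-1 * tri (dmetric (gram c) (lpos c gamma t)) (lpos c sigma t - lpos c gamma t)
   (lvel c gamma t) (lvel c gamma t)
  + bil (gram c (lpos c gamma t)) (lvel c sigma t - lvel c gamma t) (lvel c gamma t).
pose h t := pairing c gamma sigma t - t * half_gap gamma sigma.
have hD t : t0 <= t -> t <= t1 -> is_derive t 1 h (D t - half_gap gamma sigma).
  move=> a e; have [csig _ _] := tr t a e; have [cg _ _] := near_gamma t a e.
  have D1 := is_derive_pairing iop gsm gsy gun (lpos_image cg) (geodesic_lpos gg cg)
    (geodesic_lpos gs csig) (geodesic_lvel gg cg).
  have D2 : is_derive t 1 (fun t => t * half_gap gamma sigma) (half_gap gamma sigma).
    have H := is_deriveM (is_derive_id t (1 : R)) (is_derive_cst (half_gap gamma sigma) t (1 : R)).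
    by apply: (is_derive_eq H); rewrite scaler0 add0r [_ *: _]mulr1.
  exact: (is_deriveB D1 D2).
have Dle t : t0 <= t -> t <= t1 -> `|D t - half_gap gamma sigma| <= C * (2 * b) ^+ 2.
  move=> a e; have [csig vu dvu] := tr t a e; have [cg up dup] := near_gamma t a e.
  rewrite (half_gap_chart gg gs cg csig).
  have nq (w : V) : `|w - q| <= 1 -> `|w| <= `|q| + 1.
    move=> wq; rewrite -[w](subrK q) addrC; apply: le_trans (ler_normD _ _) _.
    by rewrite lerD2l.
  have vp := norm_tri_lt vu up (r2' b br); have dvp := norm_tri_lt dvu dup (r2' b br).
  rewrite distrC; apply: tay.
  - exact: lt_le_trans up (le_trans r1' rr3).
  - exact: lt_le_trans vp rr3.
  - exact: nq (le_trans (ltW dup) r3').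
  - exact: nq (le_trans (ltW dvp) rle1).
  - exact: vu.
  - exact: dvu.
have [||c0] := @MVT_segment R h (fun t => D t - half_gap gamma sigma) t0 t1 t01.
- move=> t; rewrite in_itv/= => /andP[a e]; exact: hD (ltW a) (ltW e).
- apply: derivable_within_continuous => t; rewrite in_itv/= => /andP[a e].
  by have [] := hD t a e.
rewrite in_itv/= => /andP[a e] E.
have -> : pairing c gamma sigma t1 - pairing c gamma sigma t0 - (t1 - t0) * half_gap gamma sigma
   = h t1 - h t0.
  by rewrite /h; move: (pairing _ _ _ t1) (pairing _ _ _ t0) (half_gap _ _) => x y z; ring.
rewrite E normrM (ger0_norm (_ : 0 <= t1 - t0)) ?subr_ge0//.
apply: (@le_trans _ _ (C * (2 * b) ^+ 2 * 1)).
  by apply: ler_pM => //; [rewrite subr_ge0|exact: Dle].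
by rewrite mulr1 exprMn; clear -b; rewrite le_eqVlt; apply/orP; left; apply/eqP; ring.
Unshelve. all: by end_near. Qed.

(* Passing to another chart only costs a constant factor, and changes the
   pairing by a second order term. *)
Lemma close_chart c c' gamma t : geodesic gamma ->
  chart_dom c (gamma t) -> chart_dom c' (gamma t) ->
  exists2 C : R, 0 <= C & exists2 rho : R, 0 < rho & forall sigma b,
    geodesic sigma -> b < rho -> chart_close c gamma sigma t b ->
    chart_close c' gamma sigma t (C * b) /\
    `|pairing c' gamma sigma t - pairing c gamma sigma t| <= C * b ^+ 2.
Proof.
move=> gg cg cg'.
set p := lpos c gamma t; set q := lvel c gamma t.
have op : overlap c c' p by exists (gamma t).
have oop := @overlap_open _ _ M c c'.
pose tau k (u : V) : R := coord c' (param c u) 0 k.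
have stau k : smooth_on (overlap c c') (tau k).
  exact: smooth_on_coord k oop (@transition_smooth _ _ M c c').
have [C1 C10 [r1 r10 H1]] := loclip_family (fun k => smooth_loclip oop (stau k) op).
pose dtau k (z : V * V) := \sum_i z.2 0 i * partial i (tau k) z.1.
have dtau_lip k : loclip (dtau k) (p, q).
  apply: loclip_sum => i _; apply: loclipM.
    exact: (@loclip_comp R (V * V)%type V (fun q : V => q 0 i) snd (p, q) (@snd_lip _ _) (loclip_coord q i)).
  exact: (@loclip_comp R (V * V)%type V (partial i (tau k)) fst (p, q) (@fst_lip _ _)
    (smooth_loclip oop (smooth_on_partial i (stau k)) op)).
have [C2 C20 [r2 r20 H2]] := loclip_family dtau_lip.
have [C3 C30 [r3 r30 H3]] : exists2 C : R, 0 <= C & exists2 d : R, 0 < d & forall k (w w' : V),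
    `|w - p| < d -> `|w' - p| < d ->
    `|tau k w - tau k w' - pdiff (tau k) w' (w - w')| <= C * `|w - w'| ^+ 2.
  apply: uniform_consts => [k C C' d d' CC' dd' H w w' wd wd'|k].
    apply: le_trans (H w w' (lt_le_trans wd dd') (lt_le_trans wd' dd')) _.
    by rewrite ler_wpM2r ?exprn_ge0.
  exact: smooth_taylor oop (stau k) op.
have [r4 r40 H4] := open_ball oop op.
set p' := lpos c' gamma t; set q' := lvel c' gamma t.
pose G := \sum_i \sum_j `|gram c' p' i j|.
have G0 : 0 <= G by apply: sumr_ge0 => i _; exact: sumr_ge0.
have gramG i j : `|gram c' p' i j| <= G.
  rewrite /G (bigD1 i)//= (bigD1 j)//= -addrA lerDl addr_ge0//.
    exact: sumr_ge0.
  by apply: sumr_ge0 => i' _; exact: sumr_ge0.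
pose K := G * `|q'| * n%:R ^+ 2.
have K0 : 0 <= K by rewrite !mulr_ge0// exprn_ge0.
have lposE sigma : chart_dom c (sigma t) -> lpos c' sigma t = coord c' (param c (lpos c sigma t)).
  by move=> cs; rewrite /lpos/= coordK.
have lvelE sigma : geodesic sigma -> chart_dom c (sigma t) -> chart_dom c' (sigma t) ->
    forall k, lvel c' sigma t 0 k = dtau k (lpos c sigma t, lvel c sigma t).
  move=> gs cs cs' k.
  have [_ E1] := is_derive_chart (geodesic_continuous gs) cs cs' (geodesic_lpos gs cs).
  have [_ E2] := geodesic_lpos gs cs'.
  rewrite -E2 E1.
  have os : overlap c c' (lpos c sigma t) by exists (sigma t).
  have [_ E3] := differentiable_rV (fun k => ex_diff (is_diff_def := smooth_is_diff oop (stau k) os)).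
  rewrite /transition -/(lpos c sigma t).
  have -> : 'd (coord c' \o param c) (lpos c sigma t) (lvel c sigma t) =
     \row_k 'd (tau k) (lpos c sigma t) (lvel c sigma t) by exact: (congr1 (fun h => h _) E3).
  rewrite mxE; have [_ ->] := smooth_is_diff oop (stau k) os.
  by [].
(* [C1] serves for the positions, [C2] for the velocities, and [C3 * K] for the second-order
   remainder of the transition map, paired with the velocity of [gamma]. *)
exists (C1 + C2 + C3 * K); first by rewrite !addr_ge0// mulr_ge0.
exists (Num.min (Num.min r1 r2) (Num.min r3 r4)); first by rewrite !lt_min r10 r20 r30.
move=> sigma b gs; rewrite !lt_min => /andP[/andP[b1 b2] /andP[b3 b4]] [cs vp vq].
have b0 : 0 <= b by apply: le_trans vp.
have CK : 0 <= C3 * K by rewrite mulr_ge0.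
have cs' : chart_dom c' (sigma t).
  have /overlapP[_] := H4 _ (le_lt_trans vp b4).
  by rewrite /lpos/= coordK.
have pp (d : R) : 0 < d -> `|p - p| < d by rewrite subrr normr0.
split; first split; first exact: cs'.
- apply: rV_norm_le; first by rewrite mulr_ge0// !addr_ge0.
  move=> k; rewrite !mxE !lposE//.
  have := H1 k _ _ (le_lt_trans vp b1) (pp r1 r10) => /le_trans; apply.
  apply: ler_pM => //; first by rewrite -addrA lerDl addr_ge0.
- apply: rV_norm_le; first by rewrite mulr_ge0// !addr_ge0.
  move=> k; rewrite !mxE !lvelE//.
  have zz : `|(lpos c sigma t, lvel c sigma t) - (p, q)| <= b.
    by rewrite [leLHS]/Num.norm/= ge_max vp vq.
  have pp2 : `|(p, q) - (p, q)| < r2 by rewrite subrr normr0.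
  have := H2 k _ _ (le_lt_trans zz b2) pp2 => /le_trans; apply.
  apply: ler_pM => //; first by rewrite addrAC lerDr addr_ge0.
have E1 : pairing c gamma sigma t = bil (gram c' p') (transition c c' (gamma t) (lpos c sigma t - p)) q'.
  by rewrite (pairing_inner sigma gg cg) (inner_chart _ _ cg') (to_chart_velocity gg cg') (to_of_chart _ cg cg').
have -> : pairing c' gamma sigma t - pairing c gamma sigma t =
   bil (gram c' p') (lpos c' sigma t - p' - transition c c' (gamma t) (lpos c sigma t - p)) q'.
  by rewrite E1 /pairing -bilNl -bilDl.
have W : `|lpos c' sigma t - p' - transition c c' (gamma t) (lpos c sigma t - p)| <= C3 * b ^+ 2.
  apply: rV_norm_le; first by rewrite mulr_ge0// exprn_ge0.
  move=> k; rewrite !mxE /p' !lposE//.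
  have [_ E3] := differentiable_rV (fun k => ex_diff (is_diff_def := smooth_is_diff oop (stau k) op)).
  have -> : transition c c' (gamma t) (lpos c sigma t - p) =
     \row_k 'd (tau k) p (lpos c sigma t - p) by exact: (congr1 (fun h => h _) E3).
  rewrite mxE; have [_ ->] := smooth_is_diff oop (stau k) op.
  apply: le_trans (H3 k _ _ (le_lt_trans vp b3) (pp r3 r30)) _.
  exact: (ler_wpM2l C30 (lerXn2r 2 (normr_ge0 _) b0 vp)).
apply: (@le_trans _ _ (G * (C3 * b ^+ 2) * `|q'| * n%:R ^+ 2)).
  apply: le_trans (norm_bil_le _ _ gramG) _.
  exact: (ler_wpM2r (exprn_ge0 2 (ler0n R n)) (ler_wpM2r (normr_ge0 q') (ler_wpM2l G0 W))).
have -> : G * (C3 * b ^+ 2) * `|q'| * n%:R ^+ 2 = C3 * K * b ^+ 2 by rewrite /K; ring.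
by rewrite ler_wpM2r ?exprn_ge0// lerDr addr_ge0.
Qed.

End Geodesics.

(** * First variation and Gauss lemma *)

Section Tracking.
Context {R : realType} {n : nat} {M : riemannian_manifold R n}.
Local Notation V := 'rV[R]_n.
Implicit Types (c : chart M) (x : M) (gamma sigma : R -> M) (Sg : R -> R -> M).

Lemma close_mono c gamma sigma t b b' : b <= b' ->
  chart_close c gamma sigma t b -> chart_close c gamma sigma t b'.
Proof. by move=> bb [cs p v]; split; [exact: cs|exact: le_trans p bb|exact: le_trans v bb]. Qed.

(* First variation formula in finite differences: Sg is not known to be
   differentiable in s, only Lipschitz. *)
Definition tracks gamma Sg c t :=
  exists2 C : R, 0 <= C & exists2 d : R, 0 < d & forall s, `|s| < d ->
    chart_close c gamma (Sg s) t (C * `|s|) /\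
    `|pairing c gamma (Sg s) t - t * half_gap gamma (Sg s)| <= C * s ^+ 2.

Lemma small_mul (C rho : R) : 0 <= C -> 0 < rho -> exists2 d : R, 0 < d &
  forall s : R, `|s| < d -> C * `|s| < rho.
Proof.
move=> C0 rho0; have C1 : 0 < C + 1 by rewrite ltr_wpDl.
exists (rho / (C + 1)); first by rewrite divr_gt0.
move=> s; rewrite ltr_pdivlMr// mulrC; apply: le_lt_trans.
by rewrite ler_wpM2r// lerDl.
Qed.

Lemma sqr_mul_norm (C s : R) : (C * `|s|) ^+ 2 = C ^+ 2 * s ^+ 2.
Proof. by rewrite exprMn real_normK// num_real. Qed.

Lemma tracks_chart gamma Sg c c' t : geodesic gamma -> (forall s, geodesic (Sg s)) ->
  chart_dom c (gamma t) -> chart_dom c' (gamma t) ->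
  tracks gamma Sg c t -> tracks gamma Sg c' t.
Proof.
move=> gg gs cg cg' [C C0 [d d0 H]].
have [C' C'0 [rho rho0 H']] := close_chart gg cg cg'.
have [d' d'0 Hd'] := small_mul C0 rho0.
exists (C' * C + (C' * C ^+ 2 + C)); first by rewrite !addr_ge0// !mulr_ge0// exprn_ge0.
exists (Num.min d d'); first by rewrite lt_min d0.
move=> s; rewrite lt_min => /andP[sd sd'].
have [cl pa] := H s sd; have [cl' pa'] := H' _ _ (gs s) (Hd' s sd') cl.
split.
  apply: close_mono cl'; rewrite mulrA ler_wpM2r// lerDl.
  by rewrite addr_ge0// mulr_ge0// exprn_ge0.
apply: (@le_trans _ _ ((C' * C ^+ 2 + C) * s ^+ 2)).
  rewrite sqr_mul_norm mulrA in pa'.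
  by rewrite mulrDl; exact: norm_tri_le pa' pa (lexx _).
by rewrite ler_wpM2r ?sqr_ge0// lerDr mulr_ge0.
Qed.

(** [e] is chosen before [t0] and [t1]: real induction uses both the steps that leave from [t] and
    those that arrive at [t]. *)
Lemma tracks_step gamma Sg c t : geodesic gamma -> (forall s, geodesic (Sg s)) ->
  chart_dom c (gamma t) -> exists2 e : R, 0 < e &
  forall t0 t1, t - e < t0 -> t0 <= t1 -> t1 < t + e ->
  [/\ chart_dom c (gamma t0), chart_dom c (gamma t1) &
   tracks gamma Sg c t0 -> tracks gamma Sg c t1].
Proof.
move=> gg gs cg.
have [e e0 [rho rho0 [C' C'0 H']]] := local_step gg cg.
exists e; first exact: e0.
move=> t0 t1 a b e'; have [cg0 cg1 H1] := H' t0 t1 a b e'.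
split; [exact: cg0|exact: cg1|] => -[C C0 [d d0 H]].
have [d' d'0 Hd'] := small_mul C0 rho0.
exists (2 * C + (C' * C ^+ 2 + C)); first by rewrite !addr_ge0// !mulr_ge0// exprn_ge0.
exists (Num.min d d'); first by rewrite lt_min d0.
move=> s; rewrite lt_min => /andP[sd sd'].
have [cl pa] := H s sd; have [cl' pa'] := H1 _ _ (gs s) (Hd' s sd') cl.
split.
  apply: close_mono cl'; rewrite mulrA ler_wpM2r// lerDl.
  by rewrite addr_ge0// mulr_ge0// exprn_ge0.
apply: (@le_trans _ _ ((C' * C ^+ 2 + C) * s ^+ 2)).
  rewrite sqr_mul_norm mulrA in pa'.
  rewrite mulrDl; apply: le_trans (lerD pa' pa).
  apply: le_trans (ler_normD _ _); rewrite le_eqVlt; apply/orP; left; apply/eqP.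
  by congr (`|_|); move: (pairing _ _ _ t1) (pairing _ _ _ t0) (half_gap _ _) => u v w; ring.
by rewrite ler_wpM2r ?sqr_ge0// lerDr mulr_ge0.
Qed.

(** The constants inside [tracks] get worse with each step and each change of chart. They are
    quantified at each time separately, so real induction applies without counting the steps. *)
Lemma tracks_propagate gamma Sg : geodesic gamma -> (forall s, geodesic (Sg s)) ->
  tracks gamma Sg (chart_at (gamma 0)) 0 ->
  forall t, 0 <= t -> t <= 1 -> tracks gamma Sg (chart_at (gamma t)) t.
Proof.
move=> gg gs tr0.
apply: (real_induction (P := fun t => tracks gamma Sg (chart_at (gamma t)) t) tr0).
- move=> t t0 t1 tr.
  have [e e0 H] := tracks_step gg gs (chart_at_dom (gamma t)).
  apply: (ex_intro2 _ _ e e0) => s ts se _.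
  have te : t - e < t by rewrite ltrBlDr ltrDl.
  have [_ cs Hs] := H t s te (ltW ts) se.
  exact: tracks_chart gg gs cs (chart_at_dom (gamma s)) (Hs tr).
- move=> t t0 t1 tr.
  have [e e0 H] := tracks_step gg gs (chart_at_dom (gamma t)).
  have [s [s0 st se]] : exists s, [/\ 0 <= s, s < t & t - e < s].
    exists (Num.max 0 (t - e / 2)); rewrite le_max gt_max lt_max lexx t0 /=; split=> //.
      by rewrite ltrBlDr ltrDl divr_gt0.
    by apply/orP; right; rewrite ltrD2l ltrN2 ltr_pdivrMr// ltr_pMr// ltr1n.
  have te : t < t + e by rewrite ltrDl.
  have [cs _ Hs] := H s t se (ltW st) te.
  apply: Hs; exact: tracks_chart gg gs (chart_at_dom (gamma s)) cs (tr s s0 st).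
Qed.

(** [to_chart] depends on the base point. The vector [w] is therefore kept in [V] and read at
    [gamma 0], the base point being replaced in the proof. *)
Lemma lvel0 c gamma sigma (w : V) : geodesic gamma -> geodesic sigma ->
  sigma 0 = gamma 0 -> chart_dom c (gamma 0) -> (velocity sigma 0 : V) = w ->
  lvel c sigma 0 = to_chart c (w : tangent (gamma 0)).
Proof.
move=> gg gs E cg <-; have cs : chart_dom c (sigma 0) by rewrite E.
rewrite -(to_chart_velocity gs cs).
move: (velocity sigma 0) => v; have -> : to_chart c v = to_chart c (v : tangent (gamma 0)).
  by rewrite /tangent in v *; rewrite E.
by [].
Qed.

Lemma pairing_eq0 c gamma sigma t : lpos c sigma t = lpos c gamma t ->
  pairing c gamma sigma t = 0.
Proof. by move=> E; rewrite /pairing bilDl bilNl E subrr. Qed.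

(** The family constantly equal to [sigma] tracks [gamma] with constant 0 at time 0. At time 1 the
    gap is at most [C * |s|] for every small [s], hence it is 0. *)
Lemma geodesic_unique x (v : tangent x) gamma sigma :
  geodesic_from v gamma -> geodesic_from v sigma -> sigma 1 = gamma 1.
Proof.
move=> [gg g0 gv] [gs s0 sv].
have E0 : sigma 0 = gamma 0 by rewrite s0.
have cg0 := chart_at_dom (gamma 0); set c := chart_at _ in cg0.
have tr0 : tracks gamma (fun=> sigma) c 0.
  exists 0 => //; exists 1 => // s _.
  have EL : lvel c sigma 0 = lvel c gamma 0.
    by rewrite (lvel0 gg gs E0 cg0 sv) (lvel0 gg gg erefl cg0 gv).
  have EP : lpos c sigma 0 = lpos c gamma 0 by rewrite /lpos/= E0.
  rewrite mul0r !mul0r; split.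
    by split; rewrite ?E0// ?EL ?EP subrr normr0.
  by rewrite (pairing_eq0 EP) subrr normr0.
have [C C0 [d d0 H]] := tracks_propagate gg (fun=> gs) tr0 ler01 (lexx 1).
set c1 := chart_at (gamma 1) in H; have cg1 := chart_at_dom (gamma 1).
have EP : lpos c1 sigma 1 = lpos c1 gamma 1.
  apply/eqP; rewrite -subr_eq0 -normr_le0; apply/ler_addgt0Pr => e e0; rewrite add0r.
  have [d' d'0 Hd'] := small_mul C0 e0.
  pose s := Num.min d d' / 2.
  have m0 : 0 < Num.min d d' by rewrite lt_min d0.
  have sm : `|s| < Num.min d d'.
    by rewrite gtr0_norm ?divr_gt0// ltr_pdivrMr// ltr_pMr// ltr1n.
  move: sm; rewrite lt_min => /andP[sd sd'].
  by have [[_ P _] _] := H s sd; exact: le_trans P (ltW (Hd' s sd')).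
have z : `|0 : R| < d by rewrite normr0.
have [[cs1 _ _] _] := H 0 z.
by rewrite -(coordK cs1) -[RHS](coordK cg1); congr param.
Qed.

Lemma rexpE x (v : tangent x) gamma : geodesic_from v gamma -> rexp v = gamma 1.
Proof.
move=> gv; apply: xget_unique; first by exists gamma.
by move=> y [sigma sv ->]; exact: geodesic_unique gv sv.
Qed.

Lemma lvelE c gamma (t : R) d : is_derive t 1 (lpos c gamma) d -> lvel c gamma t = d.
Proof. by case=> _ <-; rewrite /lvel derive1E. Qed.

Lemma lpos_affine c gamma a b t : geodesic gamma -> chart_dom c (gamma (a * t + b)) ->
  is_derive t 1 (lpos c (fun s => gamma (a * s + b))) (a *: lvel c gamma (a * t + b)).
Proof.
by move=> gg cg; exact: (is_derive_affine (f := lpos c gamma) (geodesic_lpos gg cg)).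
Qed.

Lemma affine_continuous gamma a b : geodesic gamma ->
  continuous (fun s : R => gamma (a * s + b)).
Proof.
move=> gg t; apply: (@continuous_comp _ _ _ (fun s : R => a * s + b) gamma).
  apply: continuousD; last exact: cst_continuous.
  exact: mulrl_continuous.
exact: geodesic_continuous.
Qed.

Lemma geodesic_affine gamma a b : geodesic gamma ->
  geodesic (fun t => gamma (a * t + b)).
Proof.
move=> gg; split; first exact: affine_continuous.
move=> c t cg /=.
have D1 := lpos_affine gg cg.
have nD : \forall s \near t, a *: lvel c gamma (a * s + b) = lvel c (fun s => gamma (a * s + b)) s.
  have := curve_near (@affine_continuous gamma a b gg t) cg.
  by apply: filterS => s cs; rewrite (lvelE (lpos_affine gg cs)).
have D2 : is_derive t 1 (lvel c (fun s => gamma (a * s + b)))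
    (a *: (a *: geo_field c (lpos c gamma (a * t + b), lvel c gamma (a * t + b)))).
  apply: near_eq_is_derive nD _; apply: is_deriveZ.
  exact: (is_derive_affine (f := lvel c gamma) (geodesic_lvel gg cg)).
split; [by have [] := D1|by have [] := D2|].
move=> k; have [_ E2] := D2; have [_ E1] := D1.
rewrite -/(lpos c _) -/(lvel c _) derive1E E2 -(nbhs_singleton nD) !mxE.
rewrite mulrN mulrN; congr (- _); rewrite !mulr_sumr; apply: eq_bigr => i _.
rewrite !mulr_sumr; apply: eq_bigr => j _; rewrite !mxE.
rewrite -[chris _ _ _ _ _]/(christoffel c (lpos c gamma (a * t + b)) k i j).
rewrite -[coord c (gamma _)]/(lpos c gamma (a * t + b)) [_.2]/=.
by move: (christoffel _ _ _ _ _) (lvel _ _ _ _ i) (lvel _ _ _ _ j) => u v w; ring.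
Qed.

Lemma velocity_affine gamma a b t : geodesic gamma ->
  (velocity (fun s => gamma (a * s + b)) t : V) = a *: velocity gamma (a * t + b).
Proof.
move=> gg; have cg := chart_at_dom (gamma (a * t + b)).
exact: (lvelE (lpos_affine gg cg)).
Qed.

Lemma velocity_congr gamma s t : s = t -> (velocity gamma s : V) = velocity gamma t.
Proof. by move=> ->. Qed.

Lemma geodesic_from_scale x (v : tangent x) gamma a : geodesic_from v gamma ->
  geodesic_from (a *: v) (fun t => gamma (a * t + 0)).
Proof.
move=> [gg g0 gv]; split; first exact: geodesic_affine.
  by rewrite mulr0 addr0.
have E : a * 0 + 0 = 0 :> R by rewrite mulr0 addr0.
have := velocity_affine a 0 0 gg; rewrite (velocity_congr gamma E) => ->.
by rewrite gv.
Qed.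

Lemma rexp_scale x (v : tangent x) gamma t : geodesic_from v gamma ->
  rexp (t *: v) = gamma t.
Proof. by move=> /(geodesic_from_scale t)/rexpE ->; rewrite mulr1 addr0. Qed.

Lemma energy_from x (v : tangent x) gamma t : geodesic_from v gamma ->
  energy gamma t = inner v v.
Proof.
move=> [gg g0 gv]; rewrite (energy_const t 0 gg) /energy.
by subst x; rewrite gv.
Qed.

Lemma geodesic_C1 gamma : geodesic gamma -> C1_curve gamma.
Proof.
move=> gg; split; first by case: gg.
move=> c t cg; split; first by have [] := geodesic_lpos gg cg.
exact: (is_derive_continuous (geodesic_lvel gg cg)).
Qed.

Lemma is_derive_bil_const (A : 'M[R]_n) (p q da : V) (a : R -> V) (t : R) :
  is_derive t 1 a da -> is_derive t 1 (fun s => bil A (a s - p) q) (bil A da q).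
Proof.
move=> Ha; apply: is_derive_sumE => i; apply: is_derive_sumE => j.
have Hi := (is_derive_rV _ _ _ _).1 Ha i.
have H := is_deriveZ (A i j * q 0 j) (is_deriveB Hi (is_derive_cst (p 0 i) t (1 : R))).
have -> : (fun s => A i j * (a s - p) 0 i * q 0 j) = (A i j * q 0 j) \*: (fun s => a s 0 i - p 0 i).
  by apply/funext => s; rewrite /= !mxE [RHS]mulrAC.
apply: (is_derive_eq H); rewrite subr0.
by rewrite [LHS]mulrAC.
Qed.

(* The velocity at time t of the geodesic s |-> rexp (s *: v), with the type
   required by the inner product at rexp (t *: v). *)
Definition exp_velocity x (v : tangent x) gamma t : tangent (rexp (t *: v)) :=
  lvel (chart_at (rexp (t *: v))) gamma t.

Lemma inner_exp_velocity x (v : tangent x) gamma t : geodesic_from v gamma ->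
  inner (exp_velocity v gamma t) (exp_velocity v gamma t) = inner v v.
Proof.
move=> gv; rewrite -(energy_from t gv) /energy /exp_velocity.
by rewrite (rexp_scale t gv).
Qed.

(** On the line through [v] the exponential map is [gamma] itself, so its derivative along [v] at
    [t *: v] is a velocity. Differentiability identifies the value of the differential with this
    directional derivative. *)
Lemma transport_line x (v : tangent x) gamma t : geodesic_from v gamma ->
  differentiable (coord (chart_at (rexp (t *: v))) \o @rexp _ _ M x) (t *: v) ->
  transport (t *: v) v = exp_velocity v gamma t.
Proof.
move=> gv; rewrite /transport /exp_velocity.
have cg : chart_dom (chart_at (rexp (t *: v))) (gamma t).
  by rewrite -(rexp_scale t gv); exact: chart_at_dom.
set c := chart_at _ in cg *; move=> D.
rewrite -deriveE//.
have D1 : is_derive (0 : R) 1 (fun s : R => (coord c \o @rexp _ _ M x) (t *: v + s *: v))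
    ('D_v (coord c \o @rexp _ _ M x) (t *: v + 0 *: v)).
  by apply: is_derive_line; rewrite scale0r addr0; exact: diff_derivable.
rewrite scale0r addr0 in D1.
have gg : geodesic gamma by case: gv.
have cg' : chart_dom c (gamma (1 * 0 + t)) by rewrite mulr0 add0r.
have D2 := lpos_affine gg cg'.
have E : (fun s : R => (coord c \o @rexp _ _ M x) (t *: v + s *: v)) =
    lpos c (fun s => gamma (1 * s + t)).
  by apply/funext => s; rewrite /lpos/= -scalerDl (rexp_scale _ gv) mul1r addrC.
rewrite E in D1; have [_ <-] := D1; have [_ ->] := D2.
by rewrite scale1r mulr0 add0r.
Qed.

Lemma derive_second_order (F : R -> R) (a d C e : R) : 0 < e -> is_derive (0 : R) 1 F d ->
  F 0 = 0 -> 0 <= C -> (forall s, `|s| < e -> `|F s - s * a| <= C * s ^+ 2) -> d = a.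
Proof.
move=> e0 [Fd <-] F0 C0 H.
have lin : linear (fun s : R => s * a) by move=> k u v; rewrite mulrDl /GRing.scale/= mulrA.
pose L : {linear R -> R} := HB.pack (fun s : R => s * a) (GRing.isLinear.Build _ _ _ _ _ lin).
have [D E] : is_diff (0 : R) F L.
  apply: is_diff_of => [u|e' e'0].
    by apply: cvgMl; exact: cvg_id.
  have [d' d'0 Hd'] := small_mul C0 e'0.
  exists (Num.min e d'); first by rewrite lt_min e0.
  move=> s; rewrite lt_min add0r F0 subr0 => /andP[se sd].
  apply: le_trans (H s se) _.
  by rewrite -real_normK ?num_real// expr2 mulrA ler_wpM2r// ltW// Hd'.
by rewrite deriveE// E /= mul1r.
Qed.

(** The pairing at time 1, as a function [F] of [s], is [half_gap] up to [C * s ^+ 2], and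
    [half_gap] is [s * inner X xi] up to [s ^+ 2]. So [F] has derivative [inner X xi] at 0. The
    chain rule computes the same derivative as the left-hand side, [transport X X] being the
    velocity of [gamma] at time 1. *)
Lemma gauss x (X xi : tangent x) : geodesically_complete M ->
  differentiable (coord (chart_at (rexp X)) \o @rexp _ _ M x) X ->
  inner (transport X xi) (transport X X) = inner X xi.
Proof.
move=> complete D.
have [gamma gX] := complete x X.
have /choice[Sg HSg] : forall s : R, exists sigma, geodesic_from (X + s *: xi) sigma.
  by move=> s; exact: complete.
have gg : geodesic gamma by case: gX.
have gs s : geodesic (Sg s) by case: (HSg s).
have E1 : rexp X = gamma 1 := rexpE gX.
(* All these geodesics start at [x], so the pairing is 0 at time 0, and the initial velocities
   differ by [s *: xi]. *)
have tr0 : tracks gamma Sg (chart_at (gamma 0)) 0.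
  exists `|xi : V| => //; exists 1 => // s _.
  have g0 : gamma 0 = x by case: gX.
  have s0 : Sg s 0 = gamma 0 by rewrite g0; case: (HSg s).
  have cg0 := chart_at_dom (gamma 0).
  have sv : (velocity (Sg s) 0 : V) = X + s *: xi by case: (HSg s).
  have gv : (velocity gamma 0 : V) = X by case: gX.
  have EP : lpos (chart_at (gamma 0)) (Sg s) 0 = lpos (chart_at (gamma 0)) gamma 0.
    by rewrite /lpos/= s0.
  have EV : lvel (chart_at (gamma 0)) (Sg s) 0 - lvel (chart_at (gamma 0)) gamma 0 = s *: xi.
    rewrite (lvel0 gg (gs s) s0 cg0 sv) (lvel0 gg gg erefl cg0 gv).
    by rewrite !to_chart_at addrAC subrr add0r.
  split; first split.
  - by rewrite s0.
  - by rewrite EP subrr normr0 mulr_ge0.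
  - by rewrite EV normrZ mulrC.
  rewrite (pairing_eq0 EP) mul0r subrr normr0.
  by rewrite mulr_ge0// sqr_ge0.
have := tracks_propagate gg gs tr0 ler01 (lexx 1); rewrite -E1.
set c := chart_at _ in D * => -[C C0 [d d0 H]].
pose A := gram c (lpos c gamma 1).
pose F s := bil A ((coord c \o @rexp _ _ M x) (X + s *: xi) - lpos c gamma 1) (lvel c gamma 1).
have FE s : F s = pairing c gamma (Sg s) 1.
  by rewrite /F /= (rexpE (HSg s)).
have DF : is_derive (0 : R) 1 F (bil A (transport X xi) (lvel c gamma 1)).
  apply: is_derive_bil_const.
  have : is_derive (0 : R) 1 (fun s : R => (coord c \o @rexp _ _ M x) (X + s *: xi))
      ('D_xi (coord c \o @rexp _ _ M x) (X + 0 *: xi)).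
    by apply: is_derive_line; rewrite scale0r addr0; exact: diff_derivable.
  by rewrite scale0r addr0 deriveE.
have gapE s : half_gap gamma (Sg s) = s * inner X xi + 2^-1 * inner xi xi * s ^+ 2.
  rewrite /half_gap (energy_from 0 (HSg s)) (energy_from 0 gX).
  rewrite !(innerDl, innerDr, innerZl, innerZr) (inner_sym xi X).
  by move: (inner X X) (inner X xi) (inner xi xi) => u v w; field.
have TX : (transport X X : V) = lvel c gamma 1.
  have := @transport_line x X gamma 1 gX; rewrite /transport /exp_velocity scale1r.
  by apply.
have K0 : 0 <= 2^-1 * inner xi xi by rewrite mulr_ge0// inner_ge0.
have F0 : F 0 = 0.
  rewrite /F /= scale0r addr0 E1 -[coord c (gamma 1)]/(lpos c gamma 1).
  by rewrite bilDl bilNl subrr.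
have <- : bil A (transport X xi) (lvel c gamma 1) = inner X xi.
  apply: (derive_second_order d0 DF F0 (addr_ge0 C0 K0)) => s sd.
  have [_] := H s sd; rewrite mul1r gapE FE => P.
  rewrite mulrDl; apply: norm_tri_le P _ (lexx _).
  by rewrite addrAC subrr add0r ger0_norm// mulr_ge0// sqr_ge0.
rewrite (inner_chart _ _ (chart_at_dom (rexp X))) !to_chart_at -/c.
have -> : coord c (rexp X) = lpos c gamma 1 by rewrite E1.
by rewrite TX.
Qed.

Lemma arc_length_ge0 gamma : 0 <= arc_length gamma.
Proof. by apply: Rintegral_ge0 => t _; exact: rnorm_ge0. Qed.

Lemma piecewise_C1_length_ge0 (x y : M) l : piecewise_C1_length x y l -> 0 <= l.
Proof. by elim=> // gamma l' _ l0 _; rewrite addr_ge0// arc_length_ge0. Qed.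

(** [rdist (rexp X) x] measures curves starting at [rexp X], hence the geodesic is run backwards
    over [[0, 1]], at constant speed [rnorm X]. *)
Lemma rdist_rexp x (X : tangent x) : geodesically_complete M ->
  rdist (rexp X) x <= rnorm X.
Proof.
move=> complete; have [gamma gX] := complete x X.
have gg : geodesic gamma by case: gX.
pose sigma t := gamma (-1 * t + 1).
have gs : geodesic sigma := geodesic_affine (-1) 1 gg.
have s0 : sigma 0 = rexp X by rewrite /sigma mulr0 add0r (rexpE gX).
have s1 : sigma 1 = x by rewrite /sigma mulr1 addNr; case: gX.
have speed t : rnorm (velocity sigma t) = rnorm X.
  rewrite /rnorm -[inner (velocity _ _) _]/(energy sigma t) (energy_const t 1 gs).
  rewrite -(energy_from 0 gX); congr Num.sqrt.
  have E : -1 * 1 + 1 = 0 :> R by rewrite mulr1 addNr.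
  rewrite /energy (velocity_affine (-1) 1 1 gg : _ = _).
  rewrite -[LHS]/(inner (-1 *: velocity gamma (-1 * 1 + 1)) (-1 *: velocity gamma (-1 * 1 + 1))).
  by rewrite E scaleN1r innerNl innerNr opprK.
have L : arc_length sigma = rnorm X.
  rewrite /arc_length; under eq_Rintegral do rewrite speed.
  rewrite Rintegral_cst//= lebesgue_measure_itv/= lte_fin ltr01.
  by rewrite oppr0 adde0 mulr1.
have := pC1_rcons (x := rexp X) (gamma := sigma) (l := 0).
rewrite s0 s1 L add0r => /(_ (pC1_nil _) (geodesic_C1 gs)) P.
by apply: ge_inf => //; exists 0 => l /piecewise_C1_length_ge0.
Qed.

End Tracking.

(** * Rayleigh quotients, gradient and Hessian *)

Section Rayleigh.
Context {R : realType} {n : nat}.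
Local Notation V := 'rV[R]_n.

Lemma loclip_continuous (W : normedModType R) (F : W -> R) p :
  loclip F p -> {for p, continuous F}.
Proof.
move=> [C C0 [d d0 H]]; apply/cvgrPdist_lt => e e0; apply/near_norm.
have C1 : 0 < C + 1 by rewrite ltr_wpDl.
exists (Num.min d (e / (C + 1))); first by rewrite lt_min d0 divr_gt0.
move=> w; rewrite lt_min ltr_pdivlMr// => /andP[wd we].
have pp : `|p - p| < d by rewrite subrr normr0.
apply: le_lt_trans (H _ _ pp wd) _; apply: le_lt_trans we.
by rewrite distrC mulrC ler_wpM2l// lerDl.
Qed.

Lemma bil_continuous (A B : 'M[R]_n) : continuous (fun v : V => bil A (v *m B) v).
Proof.
move=> p; apply: loclip_continuous.
apply: loclip_sum => i _; apply: loclip_sum => j _; apply: loclipM; last exact: loclip_coord.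
apply: loclipM; first exact: loclip_cst.
have -> : (fun w : V => (w *m B) 0 i) = (fun w => \sum_k w 0 k * B k i).
  by apply/funext => w; rewrite mxE.
by apply: loclip_sum => k _; apply: loclipM; [exact: loclip_coord|exact: loclip_cst].
Qed.

Lemma bilZl (A : 'M[R]_n) k (a b : V) : bil A (k *: a) b = k * bil A a b.
Proof.
rewrite /bil mulr_sumr; apply: eq_bigr => i _; rewrite mulr_sumr.
by apply: eq_bigr => j _; rewrite !mxE /=; ring.
Qed.

Lemma bilZr (A : 'M[R]_n) k (a b : V) : bil A a (k *: b) = k * bil A a b.
Proof.
rewrite /bil mulr_sumr; apply: eq_bigr => i _; rewrite mulr_sumr.
by apply: eq_bigr => j _; rewrite !mxE /=; ring.
Qed.

(* The minimum of the Rayleigh quotient over the unit sphere is attained, and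
   a minimizer is an eigenvector. *)
Lemma rayleigh (A H : 'M[R]_n) (nu : R) :
  (forall i j, A i j = A j i) -> (forall v : V, v != 0 -> 0 < bil A v v) ->
  (forall v w, bil A (v *m H) w = bil A (w *m H) v) ->
  (forall lambda, eigenvalue H lambda -> nu <= lambda) ->
  forall v, nu * bil A v v <= bil A (v *m H) v.
Proof.
move=> As Apos Hs Hev v; have [->|v0] := eqVneq v 0.
  by rewrite mul0mx -{1 3}(scale0r (0 : V)) !bilZl !mul0r mulr0.
(* This is the sphere of the coordinate norm, chosen for its compactness; the quotient is
   homogeneous of degree 0, so its minimum on [S] bounds it everywhere. *)
pose S := [set u : V | `|u| = 1].
have S0 : S !=set0.
  by exists (`|v|^-1 *: v); rewrite /S/= normrZ normfV normr_id mulVf// normr_eq0.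
have Sc : compact S.
  apply: bounded_closed_compact.
    exists 1; split; first exact: num_real.
    by move=> M M1 u /= ->; exact: ltW.
  have -> : S = (fun u : V => `|u|) @^-1` [set 1] by [].
  apply: preimage_closed; last exact: closed_eq.
  by move=> u _; exact: norm_continuous.
(* The factor [1%:M] gives the denominator the shape treated by [bil_continuous]. *)
pose r (u : V) := bil A (u *m H) u / bil A (u *m 1%:M) u.
have nz u : S u -> u != 0 by rewrite /S/= => u1; rewrite -normr_eq0 u1 oner_eq0.
have rc : {within S, continuous r}.
  apply: continuous_in_subspaceT => u; rewrite inE => /nz/Apos Au.
  apply: (@continuousM R V (fun u => bil A (u *m H) u) (fun u => (bil A (u *m 1%:M) u)^-1)).
    exact: bil_continuous.
  apply: (@continuousV R V (fun u => bil A (u *m 1%:M) u)); last exact: bil_continuous.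
  by rewrite mulmx1 gt_eqF.
have [u0 + rmin] := EVT_min_rV S0 Sc rc; rewrite inE => Su0.
set m := r u0 in rmin.
have Au0 := Apos _ (nz _ Su0).
have lowS u : S u -> 0 <= bil A (u *m H) u - m * bil A u u.
  move=> Su; have := rmin u; rewrite inE => /(_ Su).
  rewrite /r mulmx1 ler_pdivlMr ?subr_ge0//; last by rewrite Apos// nz.
have low u : 0 <= bil A (u *m H) u - m * bil A u u.
  have [->|un0] := eqVneq u 0.
    by rewrite mul0mx -{1 3}(scale0r (0 : V)) !bilZl !mul0r mulr0 subr0.
  have nu0 : 0 < `|u| by rewrite normr_gt0.
  have : 0 <= bil A ((`|u|^-1 *: u) *m H) (`|u|^-1 *: u) - m * bil A (`|u|^-1 *: u) (`|u|^-1 *: u).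
    by apply: lowS; rewrite /S/= normrZ normfV normr_id mulVf// gt_eqF.
  rewrite -scalemxAl !(bilZl, bilZr).
  set x := bil A (u *m H) u; set y := bil A u u; set k := `|u|^-1.
  have -> : k * (k * x) - m * (k * (k * y)) = k * (k * (x - m * y)) by ring.
  by rewrite !pmulr_rge0 ?invr_gt0.
have m0 : bil A (u0 *m H) u0 - m * bil A u0 u0 = 0.
  by rewrite /m /r mulmx1 divfK ?subrr// gt_eqF.
have crit w : bil A (u0 *m H) w - m * bil A u0 w = 0.
  set q := bil A (u0 *m H) w - m * bil A u0 w.
  set b := bil A (w *m H) w - m * bil A w w.
  have b0 : 0 <= b by exact: low.
  have quad t : 0 <= 2 * t * q + t ^+ 2 * b.
    have := low (u0 + t *: w).
    rewrite mulmxDl -scalemxAl !(bilDl, bilDr, bilZl, bilZr) (Hs w u0) (bil_sym w u0 As).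
    have -> : bil A (u0 *m H) u0 = m * bil A u0 u0 by apply/eqP; rewrite -subr_eq0 m0.
    rewrite /q /b; move: (bil _ _ _) (bil _ _ _) (bil _ _ _) (bil _ _ _) (bil _ _ _).
    by move=> x1 x2 x3 x4 x5; congr (0 <= _); ring.
  apply/eqP; apply: contraT => q0.
  have b1 : 0 < b + 1 by rewrite ltr_wpDl.
  (* At this point the quadratic would be negative if [q] were nonzero; [b + 1] allows for
     [b = 0]. *)
  have := quad (- q / (b + 1)).
  have -> : 2 * (- q / (b + 1)) * q + (- q / (b + 1)) ^+ 2 * b = - (q ^+ 2) * ((b + 2) / (b + 1) ^+ 2).
    by field; rewrite gt_eqF.
  rewrite pmulr_lge0; last by rewrite divr_gt0 ?exprn_gt0// ltr_wpDl.
  rewrite oppr_ge0 => q2; have : 0 < q ^+ 2 by rewrite exprn_even_gt0.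
  by rewrite ltNge q2.
have ev : eigenvalue H m.
  apply/eigenvalueP; exists u0; last exact: nz.
  apply/eqP; rewrite -subr_eq0; apply: contraT => /Apos.
  by rewrite {1}bilDl bilNl bilZl crit ltxx.
have := low v; rewrite subr_ge0; apply: le_trans.
by rewrite ler_wpM2r ?Hev// ltW// Apos.
Qed.

End Rayleigh.

(** * The gradient field in coordinates and its covariant derivative *)

Section GradientField.
Context {R : realType} {n : nat}.
Local Notation V := 'rV[R]_n.
Variables (U : set V) (g : V -> 'M[R]_n) (F : V -> R) (X : V -> V).
Hypothesis U_open : open U.
Hypothesis g_smooth : forall i j, smooth_on U (fun u => g u i j : R).
Hypothesis g_sym : forall u, U u -> forall i j, g u i j = g u j i.
Hypothesis g_unit : forall u, U u -> g u \in unitmx.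
Hypothesis F_smooth : smooth_on U F.
Hypothesis X_grad : forall u, U u -> forall z, bil (g u) (X u) z = pdiff F u z.

(** The coordinate Hessian; the Christoffel correction that makes it covariant appears in
    [cov_derivE]. *)
Definition hessian2 (u a b : V) : R :=
  \sum_i b 0 i * \sum_l a 0 l * partial l (partial i F) u.

Lemma hessian2_sym u a b : U u -> hessian2 u a b = hessian2 u b a.
Proof.
move=> Uu; rewrite /hessian2; under eq_bigr do rewrite mulr_sumr.
rewrite exchange_big; apply: eq_bigr => i _; rewrite mulr_sumr.
by apply: eq_bigr => j _; rewrite (schwarz i j U_open F_smooth Uu); ring.
Qed.

Lemma differentiable_bigsum (I : Type) (r : seq I) (P : pred I) (G : I -> V -> R) (p : V) :
  (forall i, differentiable (G i) p) ->
  differentiable (fun w => \sum_(i <- r | P i) G i w) p.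
Proof.
move=> H; elim: r => [|i r IH].
  rewrite (_ : (fun _ => _) = cst 0); first exact: differentiable_cst.
  by apply/funext => w; rewrite big_nil.
case Pi: (P i).
  rewrite (_ : (fun _ => _) = G i + (fun w => \sum_(i <- r | P i) G i w)).
    exact: differentiableD.
  by apply/funext => w; rewrite big_cons Pi.
rewrite (_ : (fun _ => _) = (fun w => \sum_(i <- r | P i) G i w)) //.
by apply/funext => w; rewrite big_cons Pi.
Qed.

Lemma differentiable_bigprod (I : Type) (r : seq I) (G : I -> V -> R) (p : V) :
  (forall i, differentiable (G i) p) ->
  differentiable (fun w => \prod_(i <- r) G i w) p.
Proof.
move=> H; elim: r => [|i r IH].
  rewrite (_ : (fun _ => _) = cst 1); first exact: differentiable_cst.
  by apply/funext => w; rewrite big_nil.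
rewrite (_ : (fun _ => _) = G i * (fun w => \prod_(i <- r) G i w)).
  exact: differentiableM.
by apply/funext => w; rewrite big_cons.
Qed.

Lemma differentiable_scale (k : R) (G : V -> R) (p : V) :
  differentiable G p -> differentiable (fun w => k * G w) p.
Proof.
move=> H; apply: (@differentiableM _ _ (cst k) G) => //; exact: differentiable_cst.
Qed.

Lemma differentiable_det m (A : V -> 'M[R]_m) (p : V) :
  (forall i j, differentiable (fun w => A w i j) p) ->
  differentiable (fun w => \det (A w)) p.
Proof.
move=> H; apply: differentiable_bigsum => s.
by apply: differentiable_scale; exact: differentiable_bigprod.
Qed.

(** [X] is known only through its pairings. On [U] they force it to be the row of partial
    derivatives times [invmx (g w)], which is differentiable by the cofactor formula. *)
Lemma gradient_field_differentiable u : U u -> differentiable X u.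
Proof.
move=> Uu; have [|//] := @differentiable_rV R n n X u.
move=> k.
have gd i j : differentiable (fun w => g w i j) u.
  by have [] := smooth_is_diff U_open (g_smooth i j) Uu.
have XE w : U w -> X w 0 k = \sum_i partial i F w *
    ((\det (g w))^-1 * ((-1) ^+ (k + i) * \det (row' k (col' i (g w))))).
  move=> Uw; have -> : X w = (\row_i partial i F w) *m invmx (g w).
    rewrite -[LHS](mulmxK (g_unit Uw)); congr (_ *m _); apply/rowP => i.
    rewrite !mxE; have := X_grad Uw (delta_mx 0 i).
    rewrite /pdiff (bigD1 i)//= big1 ?addr0; last first.
      by move=> j ji; rewrite mxE (negbTE ji) andbF mul0r.
    rewrite mxE !eqxx mul1r => <-; apply: eq_bigr => j _.
    rewrite (bigD1 i)//= big1 ?addr0; last first.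
      by move=> l li; rewrite mxE (negbTE li) andbF mulr0.
    by rewrite mxE !eqxx mulr1 mulrC.
  rewrite mxE; apply: eq_bigr => i _.
  by rewrite mxE /invmx (g_unit Uw) !mxE.
have nX : \forall w \near u, \sum_i partial i F w *
    ((\det (g w))^-1 * ((-1) ^+ (k + i) * \det (row' k (col' i (g w))))) = X w 0 k.
  have : \forall w \near u, U w by exact: open_nbhs_nbhs.
  by apply: filterS => w Uw; rewrite XE.
have D : differentiable (fun w => \sum_i partial i F w *
    ((\det (g w))^-1 * ((-1) ^+ (k + i) * \det (row' k (col' i (g w)))))) u.
  apply: differentiable_bigsum => i.
  apply: (@differentiableM _ _ (partial i F)).
    by have [] := smooth_is_diff U_open (smooth_on_partial i F_smooth) Uu.
  apply: (@differentiableM _ _ (fun w => (\det (g w))^-1)).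
    apply: (@differentiableV _ _ (fun w => \det (g w))); first exact: differentiable_det.
    by have := g_unit Uu; rewrite unitmxE unitfE.
  apply: differentiable_scale.
  apply: differentiable_det => a b.
  by rewrite (_ : (fun _ => _) = (fun w => g w (lift k a) (lift i b)))//; apply/funext => w; rewrite !mxE.
by have [] := near_eq_is_diff nX (differentiableP D).
Qed.

(** Both sides of [X_grad] are differentiated along the line [u + s *: a] with [b] fixed; the
    product rule yields the term in the derivative of the metric. *)
Lemma diff_gradient_field u a b : U u ->
  bil (g u) ('d X u a) b = hessian2 u a b - tri (dmetric g u) a (X u) b.
Proof.
move=> Uu; pose l (s : R) : V := u + s *: a.
have l0 : l 0 = u by rewrite /l scale0r addr0.
have Dl : is_derive (0 : R) 1 l a.
  have H : is_derive (0 : R) 1 (fun s : R => id (u + s *: a)) ('D_a id (u + 0 *: a)).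
    by apply: is_derive_line; exact: derivable_id.
  by apply: (is_derive_eq H); rewrite derive_id.
have Ul : U (l 0) by rewrite l0.
have dX : differentiable X (l 0) by rewrite l0; exact: gradient_field_differentiable.
have [_ E1] := is_derive_bil U_open g_smooth Ul Dl (is_derive_comp_diff dX Dl)
  (is_derive_cst b (0 : R) (1 : R)).
have D2 : is_derive (0 : R) 1 (fun s => pdiff F (l s) b) (hessian2 u a b).
  apply: is_derive_sumE => i.
  have [pd pE] := smooth_is_diff U_open (smooth_on_partial i F_smooth) Ul.
  have H := is_deriveZ (b 0 i) (is_derive_comp_diff pd Dl).
  by apply: (is_derive_eq H); rewrite pE l0.
have nl : \forall s \near (0 : R), pdiff F (l s) b = bil (g (l s)) ((X \o l) s) (cst b s).
  have lc : {for 0, continuous l} := is_derive_continuous Dl.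
  have : \forall s \near (0 : R), U (l s) by apply: lc; exact: open_nbhs_nbhs.
  by apply: filterS => s Us; rewrite /= X_grad.
have [_ E2] := near_eq_is_derive nl D2.
move: E1; rewrite E2 /= l0 => ->.
have -> : bil (g u) (X u) 0 = 0 by rewrite -(scale0r (0 : V)) bilZr mul0r.
by rewrite addr0 addrAC subrr add0r.
Qed.

Definition cov_deriv (u a : V) : V := 'd X u a + chris_vec g u a (X u).

Lemma cov_deriv_linear u : linear (cov_deriv u).
Proof.
move=> k a b; rewrite /cov_deriv linearP scalerDr addrACA; congr (_ + _).
apply/rowP => l; rewrite !mxE mulr_sumr -big_split; apply: eq_bigr => i _.
rewrite mulr_sumr -big_split; apply: eq_bigr => j _.
by rewrite !mxE /=; ring.
Qed.

Lemma cov_derivE u a b : U u -> bil (g u) (cov_deriv u a) b = hessian2 u a b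
  + 2^-1 * (tri (dmetric g u) (X u) a b - tri (dmetric g u) a b (X u)
            - tri (dmetric g u) b a (X u)).
Proof.
move=> Uu; rewrite /cov_deriv bilDl diff_gradient_field// -(bil_sym _ _ (g_sym Uu)).
rewrite (bil_chris g_unit)//.
rewrite (tri_sym a (X u) b (dmetric_sym U_open g_sym Uu)).
by move: (tri _ a _ _) (tri _ b _ _) (tri _ (X u) _ _) (hessian2 _ _ _) => x y z w; field.
Qed.

(** In [cov_derivE] second partial derivatives commute, and the three metric terms are together
    symmetric in [a] and [b]. This is the self-adjointness that [rayleigh] asks for. *)
Lemma cov_deriv_sym u a b : U u ->
  bil (g u) (cov_deriv u a) b = bil (g u) (cov_deriv u b) a.
Proof.
move=> Uu; rewrite !cov_derivE// (hessian2_sym a b Uu).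
rewrite (tri_sym a b (X u) (dmetric_sym U_open g_sym Uu)).
rewrite (tri_sym (X u) a b (dmetric_sym U_open g_sym Uu)).
rewrite (tri_sym b a (X u) (dmetric_sym U_open g_sym Uu)).
rewrite -(tri_sym a b (X u) (dmetric_sym U_open g_sym Uu)).
rewrite -(tri_sym b a (X u) (dmetric_sym U_open g_sym Uu)).
by rewrite addrAC.
Qed.

(** The derivative of the metric and the acceleration of the geodesic combine into the Christoffel
    term of [cov_deriv]: the second derivative of [F] along a geodesic is the covariant Hessian on
    the velocity. *)
Lemma is_derive_slope (u du : R -> V) (t : R) : U (u t) ->
  is_derive t 1 u (du t) -> is_derive t 1 du (accel g (u t) (du t)) ->
  is_derive t 1 (fun s => pdiff F (u s) (du s)) (bil (g (u t)) (cov_deriv (u t) (du t)) (du t)).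
Proof.
move=> Ut Hu Hdu.
have dX := gradient_field_differentiable Ut.
have D := is_derive_bil U_open g_smooth Ut Hu (is_derive_comp_diff dX Hu) Hdu.
have nU : \forall s \near t, bil (g (u s)) ((X \o u) s) (du s) = pdiff F (u s) (du s).
  have uc : {for t, continuous u} := is_derive_continuous Hu.
  have : \forall s \near t, U (u s) by apply: uc; exact: open_nbhs_nbhs.
  by apply: filterS => s Us; rewrite /= X_grad.
apply: (is_derive_eq (near_eq_is_derive nU D)).
rewrite /= cov_derivE// diff_gradient_field// (bil_accel U_open g_sym g_unit)//.
rewrite (tri_sym (du t) (du t) (X (u t)) (dmetric_sym U_open g_sym Ut)).
by move: (tri _ _ _ _) (tri _ _ _ _) (hessian2 _ _ _) => x y z; field.
Qed.

End GradientField.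

(** * Gradient, Hessian and slope along geodesics on the manifold *)

Section Gradient.
Context {R : realType} {n : nat} {M : riemannian_manifold R n}.
Local Notation V := 'rV[R]_n.
Variable f : M -> R.
Hypothesis f_smooth : smooth_fun f.

(** [grad] is chosen by [xget]; the row of partial derivatives times the inverse Gram matrix shows
    that a representative exists, so the default is not taken. *)
Lemma inner_grad x (v : tangent x) : inner (grad f x) v = dfun f v.
Proof.
move: v; have : [set w : tangent x | forall v, inner w v = dfun f v] (grad f x); last exact.
apply: xgetPex.
have cx := chart_at_dom x; set c := chart_at x in cx.
have im : chart_image c (coord c x) by exists x.
exists ((\row_i partial i (f \o param c) (coord c x)) *m invmx (gram c (coord c x))) => v.
rewrite (inner_chart _ _ cx) (dfun_chart v f_smooth cx) !to_chart_at bil_mulmx.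
rewrite (mulmxKV (gram_unit im)) mxE; apply: eq_bigr => i _.
by rewrite !mxE mulrC.
Qed.

Definition chart_grad (c : chart M) (u : V) : V := to_chart c (grad f (param c u)).

Lemma chart_gradE c u : chart_image c u ->
  forall z, bil (gram c u) (chart_grad c u) z = pdiff (f \o param c) u z.
Proof.
move=> cu z; have cy := param_dom cu; have cE := paramK cu.
have := inner_chart (grad f (param c u)) (of_chart c (param c u) z) cy.
by rewrite inner_grad (dfun_chart _ f_smooth cy) (of_chartK _ cy) cE => <-.
Qed.

Lemma HessE x (xi : tangent x) : Hess f xi =
  cov_deriv (gram (chart_at x)) (chart_grad (chart_at x)) (coord (chart_at x) x) xi.
Proof. by []. Qed.

(** The matrix of the Hessian is self-adjoint for the Gram matrix, so [rayleigh] turns the bound on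
    its eigenvalues into one on the quadratic form. *)
Lemma hess_lower x (nu : R) :
  (forall lambda, eigenvalue (lin1_mx (Hess f (x := x))) lambda -> nu <= lambda) ->
  forall xi : tangent x, nu * inner xi xi <= inner (Hess f xi) xi.
Proof.
move=> ev xi; have cx := chart_at_dom x; set c := chart_at x in cx.
have im : chart_image c (coord c x) by exists x.
have iop := @chart_image_open _ _ M c.
pose H : {linear V -> V} := HB.pack (cov_deriv (gram c) (chart_grad c) (coord c x))
  (GRing.isLinear.Build _ _ _ _ _ (cov_deriv_linear _ _ _)).
have HE v : v *m lin1_mx (Hess f (x := x)) = cov_deriv (gram c) (chart_grad c) (coord c x) v.
  exact: (mul_rV_lin1 H).
rewrite !(inner_chart _ _ cx) !to_chart_at HessE -/c -HE.
apply: rayleigh.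
- by move=> i j; exact: gram_sym.
- by move=> v v0; have := @inner_gt0 _ _ M x v v0; rewrite (inner_chart _ _ cx) to_chart_at.
- move=> v w; rewrite !HE.
  exact: (cov_deriv_sym iop (@gram_smooth _ _ M c) (fun u _ i j => gram_sym c u i j)
    (fun u => @gram_unit _ _ M c u) (@f_smooth c) (@chart_gradE c) v w im).
- exact: ev.
Qed.

Definition slope (gamma : R -> M) t := inner (grad f (gamma t)) (velocity gamma t).

Lemma slope_chart c gamma t : geodesic gamma -> chart_dom c (gamma t) ->
  slope gamma t = pdiff (f \o param c) (lpos c gamma t) (lvel c gamma t).
Proof.
move=> gg cg; rewrite /slope inner_grad (dfun_chart _ f_smooth cg).
by rewrite (to_chart_velocity gg cg).
Qed.

Lemma is_derive_slope_fun gamma (t : R) : geodesic gamma ->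
  is_derive t 1 (f \o gamma) (slope gamma t).
Proof.
move=> gg; have cg := chart_at_dom (gamma t).
rewrite (slope_chart gg cg).
exact: is_derive_along f_smooth (geodesic_continuous gg) cg (geodesic_lpos gg cg).
Qed.

Lemma is_derive_slope_hess gamma (t : R) : geodesic gamma ->
  is_derive t 1 (slope gamma) (inner (Hess f (velocity gamma t)) (velocity gamma t)).
Proof.
move=> gg; have cg := chart_at_dom (gamma t); set c := chart_at _ in cg.
have iop := @chart_image_open _ _ M c.
have D := is_derive_slope iop (@gram_smooth _ _ M c) (fun u _ i j => gram_sym c u i j)
    (fun u => @gram_unit _ _ M c u) (@f_smooth c) (@chart_gradE c) (lpos_image cg)
    (geodesic_lpos gg cg) (geodesic_lvel gg cg).
rewrite (inner_chart _ _ cg) HessE -/c to_chart_at (to_chart_velocity gg cg).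
have -> : (velocity gamma t : V) = lvel c gamma t by [].
apply: near_eq_is_derive D.
apply: filterS (curve_near (geodesic_continuous gg) cg) => s cs.
by rewrite (slope_chart gg cs).
Qed.

Lemma slope_increase x (v : tangent x) gamma (nu a : R) : geodesic_from v gamma ->
  (forall p xi, nu * inner xi xi <= inner (Hess f (x := p) xi) xi) -> 0 <= a ->
  nu * a * inner v v <= slope gamma a - slope gamma 0.
Proof.
move=> gv hess a0; have gg : geodesic gamma by case: gv.
have [||t] := @MVT_segment R (slope gamma)
    (fun t => inner (Hess f (velocity gamma t)) (velocity gamma t)) 0 a a0.
- by move=> t _; exact: is_derive_slope_hess.
- apply: derivable_within_continuous => t _.
  by have [] := is_derive_slope_hess t gg.
move=> _ ->; rewrite subr0 mulrAC ler_wpM2r//.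
by rewrite -(energy_from t gv); exact: hess.
Qed.

Lemma slope0 x (v : tangent x) gamma : geodesic_from v gamma ->
  slope gamma 0 = inner (grad f x) v.
Proof. by move=> [gg g0 gv]; rewrite /slope; subst x; rewrite gv. Qed.

Lemma slope_exp x (v : tangent x) gamma t : geodesic_from v gamma ->
  slope gamma t = inner (grad f (rexp (t *: v))) (exp_velocity v gamma t).
Proof. by move=> gv; rewrite /exp_velocity (rexp_scale t gv). Qed.

Lemma derive1_rexp x (v : tangent x) gamma t : geodesic_from v gamma ->
  (fun s : R => f (rexp (s *: v)))^`() t = slope gamma t.
Proof.
move=> gv; have -> : (fun s : R => f (rexp (s *: v))) = f \o gamma.
  by apply/funext => s; rewrite /= (rexp_scale s gv).
have gg : geodesic gamma by case: gv.
by rewrite derive1E; have [_ ->] := is_derive_slope_fun t gg.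
Qed.

End Gradient.

(** * One step of the method *)

Section Step.
Context {R : realType} {n : nat} {M : riemannian_manifold R n}.

(* If the exponential map is not differentiable at a *: v then its
   differential is 0 by convention. *)
Lemma transport_cases (x : M) (v : tangent x) gamma (a : R) : geodesically_complete M ->
  geodesic_from v gamma -> 0 < a ->
  (transport (a *: v) v = exp_velocity v gamma a /\
   forall xi, inner (transport (a *: v) xi) (transport (a *: v) v) = inner xi v)
  \/ forall xi, transport (a *: v) xi = 0.
Proof.
move=> complete gv a0.
have [D|D] := pselect (differentiable (coord (chart_at (rexp (a *: v))) \o @rexp _ _ M x) (a *: v)).
  left; split; first exact: transport_line.
  move=> xi; have := gauss xi complete D.
  have -> : transport (a *: v) (a *: v) = a *: transport (a *: v) v by rewrite /transport linearZ.
  rewrite innerZr innerZl (inner_sym v xi).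
  by move=> /(mulfI (lt0r_neq0 a0)).
by right => xi; exact: diff_eq0_not_differentiable.
Qed.

(** With [r = inner g t / inner y t], the part due to [HZ_beta] is
    [inner g y * r - mu * inner y y * r ^+ 2]. Completing the square bounds it by
    [inner g y ^+ 2 / (4 * mu * inner y y)], and Cauchy-Schwarz by [inner g g / (4 * mu)]. If
    [inner y t] is 0 then [r] is 0 by the convention on division. *)
Lemma HZ_descent (mu : R) (x : M) (g y t : tangent x) : 0 < mu ->
  inner g (- g + HZ_beta mu g y t *: t) <= - (1 - (4 * mu)^-1) * inner g g.
Proof.
move=> mu0; rewrite innerDr innerNr innerZr /HZ_beta sqr_rnorm.
set G := inner g g; set a := inner g y; set D := inner y t; set b := inner g t.
set Y := inner y y.
have -> : - G + (a / D - mu * (Y * b / D ^+ 2)) * b = - G + (a * (b / D) - mu * Y * (b / D) ^+ 2).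
  by rewrite expr_div_n; ring.
move: (b / D) => r.
have CS : a ^+ 2 <= G * Y.
  have := cauchy_schwarz g y; rewrite -(ler_pXn2r (_ : 0 < 2)%N)// ?nnegrE ?mulr_ge0 ?rnorm_ge0//.
  by rewrite exprMn !sqr_rnorm real_normK ?num_real.
have G0 : 0 <= G := inner_ge0 g.
have Y0 : 0 <= Y := inner_ge0 y.
suff : a * r - mu * Y * r ^+ 2 <= (4 * mu)^-1 * G.
  by move=> ?; rewrite mulNr mulrBl mul1r opprB addrC lerD2r.
have m4 : 0 < 4 * mu by rewrite mulr_gt0.
rewrite [leRHS]mulrC ler_pdivlMr//.
have [Y00|Yn0] := eqVneq Y 0.
  have a0 : a = 0.
    by apply/eqP; rewrite -sqrf_eq0 eq_le sqr_ge0 andbT (le_trans CS)// Y00 mulr0.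
  by rewrite a0 Y00 mul0r mulr0 mul0r subr0 mul0r.
have Yp : 0 < Y by rewrite lt_neqAle eq_sym Yn0.
rewrite -(ler_pM2r Yp); apply: le_trans CS.
have -> : (a * r - mu * Y * r ^+ 2) * (4 * mu) * Y = a ^+ 2 - (a - 2 * mu * Y * r) ^+ 2 by ring.
by rewrite gerBl sqr_ge0.
Qed.

(** The two terms of [HZ_beta] contribute [s] and [mu * s ^+ 2] times [rnorm g], where
    [s = rnorm y * E / inner y t]. The step size cancels in this ratio, which leaves
    [s <= L / nu]. *)
Lemma HZ_bound (mu nu L a E : R) (x : M) (g y t : tangent x) : 0 < mu -> 0 < nu -> 0 < a -> 0 < E ->
  rnorm t = E -> rnorm y <= L * (a * E) -> nu * a * E ^+ 2 <= inner y t ->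
  rnorm (- g + HZ_beta mu g y t *: t) <= (1 + L / nu + mu * (L / nu) ^+ 2) * rnorm g.
Proof.
move=> mu0 nu0 a0 E0 tE yL D0.
set D := inner y t in D0 *.
have low : 0 < nu * a * E ^+ 2 by rewrite !mulr_gt0// exprn_gt0.
have Dp : 0 < D by apply: lt_le_trans D0.
have [Dp' E0' mu0'] : [/\ 0 <= D^-1, 0 <= E & 0 <= mu] by rewrite invr_ge0; split; exact: ltW.
have q : rnorm y * E / D <= L / nu.
  rewrite ler_pdivrMr// mulrAC ler_pdivlMr//.
  apply: (@le_trans _ _ (L * (a * E) * E * nu)).
    by rewrite !ler_wpM2r//; exact: ltW.
  have -> : L * (a * E) * E * nu = L * (nu * a * E ^+ 2) by ring.
  rewrite ler_wpM2l//; have := le_trans (rnorm_ge0 y) yL.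
  by rewrite pmulr_lge0// mulr_gt0.
set s := rnorm y * E / D in q.
have s0 : 0 <= s by rewrite divr_ge0 ?mulr_ge0 ?rnorm_ge0// ltW.
have B : `|HZ_beta mu g y t| * E <= (s + mu * s ^+ 2) * rnorm g.
  have -> : (s + mu * s ^+ 2) * rnorm g =
    (rnorm g * rnorm y / D + mu * (rnorm y ^+ 2 * (rnorm g * E) / D ^+ 2)) * E.
    by rewrite /s; field; rewrite gt_eqF.
  rewrite ler_wpM2r// /HZ_beta -/D.
  apply: le_trans (ler_normB _ _) _; apply: lerD.
    by rewrite normrM normfV (gtr0_norm Dp) ler_wpM2r// cauchy_schwarz.
  rewrite !normrM (gtr0_norm mu0) normfV !normrX (gtr0_norm Dp) (ger0_norm (rnorm_ge0 y)).
  rewrite ler_wpM2l// -exprVn ler_wpM2r ?exprn_ge0// ler_wpM2l ?mulr_ge0 ?rnorm_ge0//.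
  by rewrite -tE cauchy_schwarz.
apply: le_trans (rnormD _ _) _; rewrite rnormN rnormZ tE.
rewrite -addrA mulrDl mul1r lerD2l; apply: le_trans B _.
by rewrite ler_wpM2r ?rnorm_ge0// lerD// ler_wpM2l// lerXn2r ?nnegrE// (le_trans s0).
Qed.

(** The constant [L1 / (1 - c2) + L1 + L2] adds the bounds of the two cases of [transport_cases].
    The point [p] is a variable because the next iterate is only propositionally equal to
    [rexp (a *: eta)]. *)
Lemma HZ_step (f : M -> R) (c2 mu nu L1 L2 a : R) (x p : M)
  (eta : tangent x) (eta' : tangent p) :
  geodesically_complete M -> smooth_fun f -> c2 < 1 -> 0 < mu -> 0 < nu ->
  0 < L1 -> 0 < L2 -> 0 < a ->
  (forall q (xi : tangent q), nu * inner xi xi <= inner (Hess f xi) xi) ->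
  (let dphi := (fun t : R => f (rexp (t *: eta)))^`() in
   forall s t : R, `|dphi s - dphi t| <= L1 * `|s - t| * rnorm eta ^+ 2) ->
  (forall (q : M) (X : tangent q),
     rnorm (grad f (rexp X) - transport X (grad f q)) <= L2 * rdist (rexp X) q) ->
  p = rexp (a *: eta) -> inner (grad f x) eta < 0 ->
  let T := fun xi : tangent x => transport (a *: eta) xi : tangent p in
  let y : tangent p := grad f p - T (grad f x) in
  c2 * inner (grad f x) eta <= inner (grad f p) (T eta) ->
  eta' = - grad f p + HZ_beta mu (grad f p) y (T eta) *: T eta ->
  [/\ inner (grad f p) eta' <= - (1 - (4 * mu)^-1) * rnorm (grad f p) ^+ 2,
      rnorm eta' <= (1 + L2 / nu + mu * (L2 / nu) ^+ 2) * rnorm (grad f p) &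
      - inner (grad f x) eta <= (L1 / (1 - c2) + L1 + L2) * a * rnorm eta ^+ 2].
Proof.
move=> complete sf c21 mu0 nu0 L10 L20 a0 hess lip lip2 Ep S0; subst p => /= wolfe eta'E.
have [gamma gv] := complete x eta.
have E0 : 0 < rnorm eta.
  rewrite lt_neqAle rnorm_ge0 andbT eq_sym; apply/eqP => /rnorm_eq0 e0.
  by move: S0; rewrite e0 inner0r ltxx.
have aE : 0 < a * rnorm eta by rewrite mulr_gt0.
set w := exp_velocity eta gamma a.
have wE : rnorm w = rnorm eta by rewrite /rnorm inner_exp_velocity.
have s0 := slope0 f gv.
have sa : slope f gamma a = inner (grad f (rexp (a *: eta))) w := slope_exp f a gv.
have sdiff : `|slope f gamma a - slope f gamma 0| <= L1 * a * rnorm eta ^+ 2.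
  have := lip a 0; rewrite /= !(derive1_rexp sf _ gv) subr0 (gtr0_norm a0).
  exact.
have yL : rnorm (grad f (rexp (a *: eta)) - transport (a *: eta) (grad f x)) <= L2 * (a * rnorm eta).
  apply: le_trans (lip2 _ _) _; rewrite ler_wpM2l//; first exact: ltW.
  apply: le_trans (rdist_rexp _ complete) _.
  by rewrite rnormZ gtr0_norm.
have K1 : 0 <= L1 / (1 - c2) by rewrite divr_ge0 ?subr_ge0// ltW.
have aE2 : 0 <= a * rnorm eta ^+ 2 by rewrite mulr_ge0 ?exprn_ge0 ?rnorm_ge0// ltW.
have Kle k : k <= L1 / (1 - c2) + L1 + L2 ->
    k * a * rnorm eta ^+ 2 <= (L1 / (1 - c2) + L1 + L2) * a * rnorm eta ^+ 2.
  by move=> kK; rewrite -!mulrA ler_wpM2r.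
split.
- by rewrite eta'E sqr_rnorm; exact: HZ_descent.
- rewrite eta'E.
  have [[TE TG]|T0] := transport_cases complete gv a0.
    have tE : rnorm (transport (a *: eta) eta) = rnorm eta by rewrite TE.
    apply: (HZ_bound (grad f (rexp (a *: eta))) mu0 nu0 a0 E0 tE yL).
    rewrite innerDl innerNl TG TE -sa -s0 sqr_rnorm.
    by have := slope_increase sf gv hess (ltW a0); exact.
  (* With a vanishing transport the new direction is minus the gradient, whatever [HZ_beta] is. *)
  rewrite !T0 scaler0 addr0 rnormN ler_peMl ?rnorm_ge0// -addrA lerDl.
  have r0 : 0 <= L2 / nu by apply: divr_ge0; exact: ltW.
  by rewrite addr_ge0// mulr_ge0 ?exprn_ge0//; exact: ltW.
(* Here the curvature condition bounds [(1 - c2) * - slope f gamma 0] by the increment of the slope,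
   hence by [L1 * a * rnorm eta ^+ 2]. *)
- have [[TE TG]|T0] := transport_cases complete gv a0.
    apply: le_trans (Kle (L1 / (1 - c2)) _); last by rewrite -addrA lerDl addr_ge0// ltW.
    rewrite mulrAC mulrAC -mulrA mulrAC ler_pdivlMr ?subr_gt0//.
    move: wolfe sdiff; rewrite TE -sa -s0 ler_norml mulrA => A /andP[_ B].
    move: (slope f gamma a) (slope f gamma 0) A B => u v A B.
    have -> : - v * (1 - c2) = c2 * v - v by ring.
    by apply: le_trans B; rewrite lerD2r.
  (* With a vanishing transport [yL] bounds the new gradient itself, hence the slope at time [a],
     and [L1] controls the change of slope from time 0. *)
  apply: le_trans (Kle (L1 + L2) _); last by rewrite -addrA lerDr.
  move: yL; rewrite T0 subr0 => gL.
  have : `|slope f gamma a| <= L2 * a * rnorm eta ^+ 2.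
    rewrite sa; apply: le_trans (cauchy_schwarz _ _) _; rewrite wE expr2 mulrA.
    by rewrite ler_wpM2r ?rnorm_ge0// -mulrA.
  move: sdiff; rewrite -s0.
  move: (slope f gamma a) (slope f gamma 0) => u v; rewrite !mulrDl !ler_norml.
  by move=> /andP[? ?] /andP[? ?]; lra.
Qed.

End Step.

(** * Convergence of the method *)

(** [F] is nonincreasing and bounded below, hence convergent, so its consecutive differences tend to
    0 and dominate [c * G k ^+ 2]. *)
Lemma sqr_decrease_cvg0 (R : realType) (F G : nat -> R) (c m : R) : 0 < c ->
  (forall k, m <= F k) -> (forall k, 0 <= G k) ->
  (forall k, c * G k ^+ 2 <= F k - F k.+1) -> G @ \oo --> (0 : R).
Proof.
move=> c0 Fm G0 H.
have dec : nonincreasing_seq F.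
  apply/nonincreasing_seqP => k; rewrite -subr_ge0; apply: le_trans (H k).
  by rewrite mulr_ge0 ?exprn_ge0 ?G0// ltW.
have Fc : cvgn F.
  by apply: nonincreasing_is_cvgn => //; exists m => _ [k _ <-].
have Dc : (fun k => F k - F k.+1) @ \oo --> (0 : R).
  rewrite -(subrr (limn F)); apply: cvgB; first exact: Fc.
  by rewrite (cvg_shiftS F (nbhs (limn F))).
apply/cvgrPdist_lt => e e0.
have ce : 0 < c * e ^+ 2 by rewrite mulr_gt0// exprn_gt0.
have /cvgrPdist_lt/(_ _ ce) := Dc.
apply: filterS => k; rewrite !sub0r !normrN (ger0_norm (G0 k)).
move=> /(le_lt_trans (ler_norm _))/(le_lt_trans (H k)).
by rewrite ltr_pM2l// ltr_pXn2r// ?nnegrE ?G0// ltW.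
Qed.

Theorem theorem3p3 (R : realType) (n : nat) (M : riemannian_manifold R n)
  (M_connected : connected [set: M])
  (M_complete : geodesically_complete M)
  (f : M -> R) (f_smooth : smooth_fun f)
  (c1 c2 mu : R) (c1_gt0 : 0 < c1) (c1_lt_c2 : c1 < c2) (c2_lt1 : c2 < 1)
  (mu_gt : 1 / 4 < mu)
  (x : nat -> M) (alpha : nat -> R) (eta : forall k, tangent (x k))
  (x_run : HZ_run f c1 c2 mu alpha eta)
  (f_bounded_below : exists m : R, forall p : M, m <= f p)
  (f_exp_C11 : exists2 L1 : R, 0 < L1 &
     forall k, running f x k ->
       let phi := fun t : R => f (rexp (t *: eta k)) in
       let dphi := phi^`() in
       (forall t : R, derivable phi t 1) /\
       (forall s t : R,
          `|dphi s - dphi t| <= L1 * `|s - t| * rnorm (eta k) ^+ 2))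
  (grad_transport_lipschitz : exists2 L2 : R, 0 < L2 &
     forall (y : M) (X : tangent y),
       rnorm (grad f (rexp X) - transport X (grad f y))
         <= L2 * rdist (rexp X) y)
  (f_strongly_convex : exists2 nu : R, 0 < nu &
     forall (p : M) (lambda : R),
       eigenvalue (lin1_mx (Hess f (x := p))) lambda -> nu <= lambda) :
  (exists k0, rnorm (grad f (x k0)) = 0) \/
  (fun k => rnorm (grad f (x k))) @ \oo --> (0 : R).
Proof.
have [[k0 g0]|ng] := pselect (exists k0, grad f (x k0) = 0).
  by left; exists k0; rewrite g0 /rnorm inner0l sqrtr0.
right.
(* No gradient vanishes from here on, so the method never stops and its rules hold at every
   index. *)
have gn0 k : grad f (x k) <> 0 by move=> g0; apply: ng; exists k.
have run k : running f x k by move=> j _; exact: gn0.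
have [m fm] := f_bounded_below.
have [L1 L10 HL1] := f_exp_C11.
have [L2 L20 HL2] := grad_transport_lipschitz.
have [nu nu0 Hnu] := f_strongly_convex.
have hess p := hess_lower f_smooth (Hnu p).
have [eta0 HZ] := x_run.
have mu0 : 0 < mu by apply: lt_trans mu_gt; rewrite divr_gt0.
pose kappa := 1 - (4 * mu)^-1.
have kappa0 : 0 < kappa.
  by rewrite subr_gt0 invf_lt1 ?mulr_gt0// -ltr_pdivrMl// mulrC.
have kappa1 : kappa <= 1 by rewrite gerBl invr_ge0 mulr_ge0// ltW.
pose G k := rnorm (grad f (x k)); pose S k := inner (grad f (x k)) (eta k).
have G0 k : 0 < G k.
  rewrite lt_neqAle rnorm_ge0 andbT eq_sym; apply/eqP => /rnorm_eq0; exact: gn0.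
pose C := 1 + L2 / nu + mu * (L2 / nu) ^+ 2.
have r0 : 0 <= L2 / nu by apply: divr_ge0; exact: ltW.
have C1 : 1 <= C.
  by rewrite /C -addrA lerDl addr_ge0// mulr_ge0 ?exprn_ge0//; exact: ltW.
pose K := L1 / (1 - c2) + L1 + L2.
have K0 : 0 < K by rewrite !addr_gt0 ?divr_gt0 ?subr_gt0.
have neg k : S k <= - kappa * G k ^+ 2 -> S k < 0.
  move=> /le_lt_trans; apply; rewrite mulNr oppr_lt0 mulr_gt0// exprn_gt0//; exact: G0.
have step k : S k < 0 -> [/\ S k.+1 <= - kappa * G k.+1 ^+ 2,
    rnorm (eta k.+1) <= C * G k.+1 & - S k <= K * alpha k * rnorm (eta k) ^+ 2].
  move=> Sk; have [a0 xE _ wolfe etaE] := HZ k (run k).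
  exact: (HZ_step M_complete f_smooth c2_lt1 mu0 nu0 L10 L20 a0 hess (HL1 k (run k)).2 HL2 xE Sk wolfe etaE).
(* The descent inequality is carried along because [HZ_step] requires a negative slope. At index 0
   the direction is minus the gradient, and [kappa <= 1 <= C]. *)
have inv k : S k <= - kappa * G k ^+ 2 /\ rnorm (eta k) <= C * G k.
  elim: k => [|k [/neg Sk _]]; last by have [] := step k Sk.
  rewrite /S /G eta0 innerNr rnormN sqr_rnorm mulNr lerN2; split.
    by rewrite ler_piMl// inner_ge0.
  by rewrite ler_peMl// rnorm_ge0.
(* The Armijo condition yields a decrease of [c1 * (alpha k * - S k)], and [alpha k * - S k] is at
   least [kappa ^+ 2 * G k ^+ 2 / (K * C ^+ 2)] by [Z] below. *)
apply: (@sqr_decrease_cvg0 _ (fun k => f (x k)) G (c1 * kappa ^+ 2 / (K * C ^+ 2)) m).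
- by rewrite divr_gt0 ?mulr_gt0 ?exprn_gt0// (lt_le_trans _ C1).
- by move=> k; exact: fm.
- by move=> k; exact: ltW.
move=> k; have [Sk Ek] := inv k; have [_ _ Zk] := step k (neg k Sk).
have [a0 xE armijo _ _] := HZ k (run k).
rewrite -xE in armijo.
have KC : 0 < K * C ^+ 2 by rewrite mulr_gt0 ?exprn_gt0// (lt_le_trans _ C1).
(* Zoutendijk: multiply the descent inequality Sk by itself and bound one of
   the two factors - S k by the lower bound Zk on the step size. *)
have Z : kappa ^+ 2 * G k ^+ 2 <= K * C ^+ 2 * (alpha k * - S k).
  rewrite -(ler_pM2r (exprn_gt0 2 (G0 k))).
  apply: (@le_trans _ _ ((- S k) ^+ 2)).
    rewrite (_ : kappa ^+ 2 * _ * _ = (kappa * G k ^+ 2) ^+ 2); last by ring.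
    have kG : 0 <= kappa * G k ^+ 2.
      by apply: mulr_ge0; [exact: ltW|exact: exprn_ge0 (ltW (G0 k))].
    have kS : kappa * G k ^+ 2 <= - S k by rewrite lerNr -mulNr.
    by rewrite lerXn2r// nnegrE; exact: le_trans kS.
  rewrite expr2; have SkN : 0 <= - S k by rewrite oppr_ge0 ltW ?neg.
  apply: (@le_trans _ _ (- S k * (K * alpha k * (C * G k) ^+ 2))).
    rewrite ler_wpM2l//; apply: le_trans Zk _.
    apply: ler_wpM2l; first by rewrite mulr_ge0//; exact: ltW.
    by rewrite lerXn2r// nnegrE ?rnorm_ge0//; exact: le_trans (rnorm_ge0 _) Ek.
  by rewrite le_eqVlt; apply/orP; left; apply/eqP; ring.
have -> : c1 * kappa ^+ 2 / (K * C ^+ 2) * G k ^+ 2 = c1 * (kappa ^+ 2 * G k ^+ 2 / (K * C ^+ 2)) by ring.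
apply: (@le_trans _ _ (c1 * (alpha k * - S k))).
  by rewrite ler_wpM2l ?(ltW c1_gt0)// ler_pdivrMr// [leRHS]mulrC.
rewrite lerBrDl; move: armijo; rewrite -/(S k) => armijo.
by apply: le_trans (lerD armijo (lexx _)) _; rewrite le_eqVlt; apply/orP; left; apply/eqP; ring.
Qed.
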